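(* Let $k_0>0$ be an integer, $\tau>0$, $d>0$ an integer with $d<n$, and let $E\subseteq\mathbb{R}^n$ be a $(c,d)$-lower content regular set. Let $\mathscr{D}_k$ denote the Christ--David cubes of $E$ of scale (generation) $k$, $\mathscr{D}=\bigcup_{k\in\mathbb{Z}}\mathscr{D}_k$, let $Q_0\in\mathscr{D}_0$ and $\mathscr{D}(k_0)=\bigcup_{k=0}^{k_0}\{Q\in\mathscr{D}_k: Q\subseteq Q_0\}$. Then $\mathscr{D}(k_0)$ may be partitioned into stopping-time regions $\mathrm{Tree}(R)$, for $R$ ranging over some collection $\mathrm{Top}(k_0)\subseteq\mathscr{D}(k_0)$ ($R$ being the maximal cube of $\mathrm{Tree}(R)$), with the following properties. (1) $\displaystyle\sum_{R\in \mathrm{Top}(k_0)}\ell(R)^d\lesssim_{c,d}\mathscr{H}^d(Q_0)$. (2) Let $R\in\mathrm{Top}(k_0)$ and let $\mathscr{T}\subseteq\mathrm{Tree}(R)$ be a stopping-time region with maximal cube $T$. Let $\mathscr{F}$ be the set of minimal cubes of $\mathscr{T}$ (the cubes of $\mathscr{T}$ that do not properly contain another cube of $\mathscr{T}$) and $$d_{\mathscr{F}}(x)=\inf_{Q\in\mathscr{F}}\big(\ell(Q)+\operatorname{dist}(x,Q)\big).$$ For $C_0>4$ and $\tau>0$, there is a collection $\mathscr{C}$ of disjoint dyadic cubes covering $C_0B_T\cap E$ such that, setting $E(\mathscr{T})=\bigcup_{I\in\mathscr{C}}\partial_dI$, the following hold: (a) $E(\mathscr{T})$ is Ahlfors $d$-regular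 with constants depending on $C_0,\tau,d$ and $c$; (b) $C_0B_T\cap E\subseteq\bigcup_{I\in\mathscr{C}}I\subseteq 2C_0B_T$; (c) $E$ is close to $E(\mathscr{T})$ in $C_0B_T$ in the sense that $\operatorname{dist}(x,E(\mathscr{T}))\lesssim\tau\, d_{\mathscr{F}}(x)$ for all $x\in E\cap C_0B_T$; (d) $\ell(I)\sim\tau\inf_{x\in I}d_{\mathscr{F}}(x)$ for all $I\in\mathscr{C}$. The constants do not depend on $k_0$.
   Context: $\mathscr{H}^d$ is Hausdorff measure and $\mathscr{H}^d_\infty$ is Hausdorff content. $a\lesssim b$ means $a\le Cb$ for a constant $C$, $a\lesssim_t b$ means $C$ depends on $t$ (dependence on the ambient dimension $n$ is not indicated), and $a\sim b$ means $a\lesssim b\lesssim a$. Lower content regular: $E$ is $(c,d)$-lower content regular if $\mathscr{H}^d_\infty(E\cap B(x,r))\ge c r^d$ for all $x\in E$, $r\in(0,\operatorname{diam}E)$. A set $A$ is Ahlfors $d$-regular if for some constant $K>0$, $r^d/K\le\mathscr{H}^d(B(\xi,r)\cap A)\le Kr^d$ for all $\xi\in A$, $r\in(0,\operatorname{diam}A)$. Christ--David cubes: fix $0<\rho<1/1000$, $c_0=1/500$, and a nested sequence $(X_k)_{k\in\mathbb{Z}}$ of maximal $\rho^k$-nets of $E$. For each $k\in\mathbb{Z}$ there is a collection $\mathscr{D}_k$ of Borel subsets of $E$ (''cubes'') with: (1) $E=\bigcup_{Q\in\mathscr{D}_k}Q$; (2) if $Q,Q'\in\mathscr{D}$ and $Q\cap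 Q'\ne\emptyset$, then $Q\subseteq Q'$ or $Q'\subseteq Q$; (3) for $Q\in\mathscr{D}$ let $k(Q)$ be the integer with $Q\in\mathscr{D}_{k(Q)}$ and $\ell(Q)=5\rho^{k(Q)}$; there is $\zeta_Q\in X_{k(Q)}$ with $E\cap B(\zeta_Q,c_0\ell(Q))\subseteq Q\subseteq B(\zeta_Q,\ell(Q))$, and $X_k=\{\zeta_Q: Q\in\mathscr{D}_k\}$. Cubes carry their generation $k(Q)$ (the same set in two generations counts as two cubes), and containment $Q\subseteq R$ of cubes includes $k(Q)\ge k(R)$. Put $B_Q=B(\zeta_Q,\ell(Q))$; $\lambda B$ is the ball with the same center and $\lambda$ times the radius. For $Q\in\mathscr{D}_k$, $\mathrm{Child}(Q)=\{Q'\in\mathscr{D}_{k+1}:Q'\subseteq Q\}$. Stopping-time region: a collection $\mathscr{T}\subseteq\mathscr{D}$ such that (i) there is a cube $Q(\mathscr{T})\in\mathscr{T}$ (the maximal cube) containing every cube of $\mathscr{T}$; (ii) if $Q\in\mathscr{T}$, $R\in\mathscr{D}$ and $Q\subseteq R\subseteq Q(\mathscr{T})$, then $R\in\mathscr{T}$; (iii) if $Q\in\mathscr{T}$ and some $Q'\in\mathrm{Child}(Q)$ is not in $\mathscr{T}$, then no child of $Q$ is in $\mathscr{T}$. Dyadic cubes are the usual (half-open) dyadic cubes of $\mathbb{R}^n$; $\ell(I)$ is the side length of $I$, and $\partial_dI$ is its $d$-dimensional skeleton, i.e. the union of its $d$-dimensional faces.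
   Formalization: (1) is asserted only when c_0 ℓ(Q_0) ≤ diam E, since it fails e.g. when E is a point; the constants in (c) and (d) depend on n and on an upper bound τ_0 for τ, since for fixed C_0 and large τ (d) with a constant depending only on n contradicts (b). *)

(* Defs.v *)
From HB Require Import structures.
From mathcomp Require Import all_boot all_order all_algebra.
From mathcomp Require Import all_classical all_reals all_analysis.
Set Implicit Arguments.
Unset Strict Implicit.
Unset Printing Implicit Defensive.
Import Order.TTheory GRing.Theory Num.Theory.
Import numFieldNormedType.Exports.
Local Open Scope classical_set_scope.
Local Open Scope ring_scope.

(** Euclidean geometry of R^n, represented by ['rV[R]_n].  The library norm on
    matrices is the sup norm, hence the explicit Euclidean one; the library
    topology on ['rV[R]_n] is the usual one. *)

Definition edistance (R : realType) (n : nat) (x y : 'rV[R]_n) : R :=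
  Num.sqrt (\sum_(i < n) (x ord0 i - y ord0 i) ^+ 2).

(** Balls are closed. *)
Definition cball (R : realType) (n : nat) (x : 'rV[R]_n) (r : R) :
    set 'rV[R]_n :=
  [set y | edistance x y <= r].

(** The maximum with 0 gives the empty set diameter 0, not -oo. *)
Definition diameter (R : realType) (n : nat) (A : set 'rV[R]_n) : \bar R :=
  maxe 0%E (ereal_sup [set z | exists x y, [/\ A x, A y &
                                  z = (edistance x y)%:E]]).

Definition dist_set (R : realType) (n : nat) (x : 'rV[R]_n)
    (A : set 'rV[R]_n) : \bar R :=
  ereal_inf [set (edistance x y)%:E | y in A].

(** Hausdorff measure and content are normalised by (diam U)^d, with no
    dimensional factor.  These are used for d > 0 only. *)
Definition hausdorff_delta (R : realType) (n d : nat) (delta : \bar R)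
    (A : set 'rV[R]_n) : \bar R :=
  ereal_inf [set (\sum_(0 <= i <oo) diameter (U i) ^+ d)%E |
    U in [set U : nat -> set 'rV[R]_n |
            A `<=` \bigcup_i U i /\ forall i, (diameter (U i) <= delta)%E]].

Definition hausdorff_content (R : realType) (n d : nat) (A : set 'rV[R]_n) :
    \bar R :=
  hausdorff_delta d +oo%E A.

Definition hausdorff_measure (R : realType) (n d : nat) (A : set 'rV[R]_n) :
    \bar R :=
  ereal_sup [set hausdorff_delta d delta%:E A |
               delta in [set delta : R | 0 < delta]].

Definition lower_content_regular (R : realType) (n d : nat) (c : R)
    (E : set 'rV[R]_n) : Prop :=
  forall x r, E x -> 0 < r -> (r%:E < diameter E)%E ->
    ((c * r ^+ d)%:E <= hausdorff_content d (E `&` cball x r))%E.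

Definition ahlfors_regular (R : realType) (n d : nat) (K : R)
    (A : set 'rV[R]_n) : Prop :=
  0 < K /\
  forall xi r, A xi -> 0 < r -> (r%:E < diameter A)%E ->
    ((r ^+ d / K)%:E <= hausdorff_measure d (cball xi r `&` A))%E /\
    (hausdorff_measure d (cball xi r `&` A) <= (K * r ^+ d)%:E)%E.

Definition separated_in (R : realType) (n : nat) (e : R)
    (E X : set 'rV[R]_n) : Prop :=
  X `<=` E /\ forall x y, X x -> X y -> x <> y -> e <= edistance x y.

Definition maximal_net (R : realType) (n : nat) (e : R)
    (E X : set 'rV[R]_n) : Prop :=
  separated_in e E X /\
  forall Y, separated_in e E Y -> X `<=` Y -> Y = X.

(** A cube is a set together with its generation, so that one set occurring in
    two generations gives two cubes. *)
Definition gcube (R : realType) (n : nat) : Type := (int * set 'rV[R]_n)%type.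

Definition generation (R : realType) (n : nat) (Q : gcube R n) : int := Q.1.

Definition cube_set (R : realType) (n : nat) (Q : gcube R n) : set 'rV[R]_n :=
  Q.2.

Definition subcube (R : realType) (n : nat) (Q Q' : gcube R n) : Prop :=
  generation Q' <= generation Q /\ cube_set Q `<=` cube_set Q'.

Definition cube_len (R : realType) (n : nat) (rho : R) (Q : gcube R n) : R :=
  5%:R * rho ^ generation Q.

Definition c_cube (R : realType) : R := 500%:R^-1.

(** [X] is the sequence of nets, [D] the collection of all cubes and [zeta] the
    choice of centres.  In [cd_nested] the case of equal generations says that
    cubes of one generation are pairwise disjoint.  [E] need not be a Borel set,
    so in [cd_borel] the cubes are Borel relative to [E]. *)
Record christ_david (R : realType) (n : nat) (rho : R) (E : set 'rV[R]_n)
    (X : int -> set 'rV[R]_n) (D : set (gcube R n))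
    (zeta : gcube R n -> 'rV[R]_n) : Prop := ChristDavid {
  cd_net : forall k, maximal_net (rho ^ k) E (X k) ;
  cd_net_nested : forall k, X k `<=` X (k + 1) ;
  cd_borel : forall Q, D Q ->
    exists2 B, <<s @open 'rV[R]_n >> B & cube_set Q = E `&` B ;
  cd_cover : forall k,
    \bigcup_(Q in [set Q | D Q /\ generation Q = k]) cube_set Q = E ;
  cd_nested : forall Q Q', D Q -> D Q' -> generation Q' <= generation Q ->
    cube_set Q `&` cube_set Q' !=set0 -> subcube Q Q' ;
  cd_inner : forall Q, D Q ->
    E `&` cball (zeta Q) (c_cube R * cube_len rho Q) `<=` cube_set Q ;
  cd_outer : forall Q, D Q -> cube_set Q `<=` cball (zeta Q) (cube_len rho Q) ;
  cd_centers : forall k,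
    X k = [set zeta Q | Q in [set Q | D Q /\ generation Q = k]]
}.

Definition child (R : realType) (n : nat) (D : set (gcube R n))
    (Q : gcube R n) : set (gcube R n) :=
  [set Q' | [/\ D Q', generation Q' = generation Q + 1 &
                cube_set Q' `<=` cube_set Q]].

Record stopping_time_region (R : realType) (n : nat) (D : set (gcube R n))
    (T : set (gcube R n)) (QT : gcube R n) : Prop := StoppingTimeRegion {
  str_sub : T `<=` D ;
  str_top : T QT ;
  str_max : forall Q, T Q -> subcube Q QT ;
  str_convex : forall Q Q', T Q -> D Q' -> subcube Q Q' -> subcube Q' QT ->
    T Q' ;
  str_children : forall Q, T Q -> (exists2 Q', child D Q Q' & ~ T Q') ->
    forall Q'', child D Q Q'' -> ~ T Q''
}.

Definition cubes_upto (R : realType) (n : nat) (D : set (gcube R n))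
    (Q0 : gcube R n) (k0 : nat) : set (gcube R n) :=
  [set Q | [/\ D Q, 0 <= generation Q, generation Q <= k0%:Z &
               cube_set Q `<=` cube_set Q0]].

Definition tree_partition (R : realType) (n : nat) (D : set (gcube R n))
    (S Top : set (gcube R n)) (Tree : gcube R n -> set (gcube R n)) : Prop :=
  [/\ Top `<=` S,
      forall Q, Top Q -> stopping_time_region D (Tree Q) Q,
      trivIset Top Tree &
      \bigcup_(Q in Top) Tree Q = S].

Definition minimal_cubes (R : realType) (n : nat) (T : set (gcube R n)) :
    set (gcube R n) :=
  [set Q | T Q /\ forall Q', T Q' -> subcube Q' Q -> Q' = Q].

Definition d_family (R : realType) (n : nat) (rho : R) (F : set (gcube R n))
    (x : 'rV[R]_n) : \bar R :=
  ereal_inf [set ((cube_len rho Q)%:E + dist_set x (cube_set Q))%E | Q in F].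

(** The dyadic cube [(k, m)] is the product of the intervals
    [[m_i 2^k, (m_i + 1) 2^k[]. *)
Definition dyadic (n : nat) : Type := (int * 'rV[int]_n)%type.

Definition dyadic_len (R : realType) (n : nat) (I : dyadic n) : R := 2%:R ^ I.1.

Definition dyadic_corner (R : realType) (n : nat) (I : dyadic n) (i : 'I_n) :
    R :=
  (I.2 ord0 i)%:~R * dyadic_len R I.

Definition dyadic_set (R : realType) (n : nat) (I : dyadic n) :
    set 'rV[R]_n :=
  [set x | forall i, dyadic_corner R I i <= x ord0 i
                       < dyadic_corner R I i + dyadic_len R I].

(** The closed face whose free coordinates are those in [S]; [e] says which
    endpoint each of the other coordinates takes. *)
Definition dyadic_face (R : realType) (n : nat) (I : dyadic n) (S : {set 'I_n})
    (e : 'I_n -> bool) : set 'rV[R]_n :=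
  [set x | forall i,
     if i \in S then
       dyadic_corner R I i <= x ord0 i <= dyadic_corner R I i + dyadic_len R I
     else x ord0 i == dyadic_corner R I i + (e i)%:R * dyadic_len R I].

Definition skeleton (R : realType) (n d : nat) (I : dyadic n) :
    set 'rV[R]_n :=
  [set x | exists (S : {set 'I_n}) (e : 'I_n -> bool), #|S| = d /\ dyadic_face I S e x].

Definition dyadic_skeleton (R : realType) (n d : nat) (C : set (dyadic n)) :
    set 'rV[R]_n :=
  \bigcup_(I in C) @skeleton R n d I.

(* Main.v *)
Require Import Defs.
From HB Require Import structures.
From mathcomp Require Import all_boot all_order all_algebra.
From mathcomp Require Import all_classical all_reals all_analysis.
From mathcomp Require Import finmap ring lra zify.
Set Implicit Arguments.
Unset Strict Implicit.
Unset Printing Implicit Defensive.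
Import Order.TTheory GRing.Theory Num.Theory.
Import numFieldNormedType.Exports.
Local Open Scope classical_set_scope.
Local Open Scope ring_scope.

(** The trees come from a mass that is sent up from the last generation. A cube of
    generation [k0] starts with the [d]-th power of its length; a larger cube
    receives the masses of its children, unless they add up to more than twice the
    [d]-th power of its length. In that case the cube is cut: its mass is reset to
    that power, and its children become tops of new trees ([mass], [cut], [tree]).
    Inside a tree the mass is additive. It is at most twice the [d]-th power of the
    length by construction, and at least a constant times it by lower content
    regularity, because the cubes at which the mass started or was reset cover the
    cube ([mass_le], [mass_ge]). Each reset destroys at least half of the mass of
    the children, so the sum over the tops is at most a constant times the initial
    mass ([tops_sum_below]). This in turn is at most a constant times the Hausdorff
    measure of [Q0], because the cubes of the last generation have inner balls at
    positive distance from each other ([bottom_sum_le_measure]).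

    For a region inside a tree let [dist_min] be the distance function of its
    minimal cubes. The cover consists of the maximal dyadic cubes that meet the
    part of [E] to be covered and whose side is at most [t] times [dist_min] on
    the cube. Since [dist_min] is Lipschitz with constant 1, the side is also at
    least [t / 3] times [dist_min], and everything but the Ahlfors regularity of the
    skeleton follows ([cover_properties]).

    Lower regularity is clear at radii comparable to the cube whose skeleton
    contains the centre ([lower_regular_near]). At larger radii the ball contains a
    comparable ball around a point of [E] inside which [E] is covered by cubes of
    the cover that stay in the first ball. The content of [E] bounds the sum of the
    [d]-th powers of their sides from below, and the middle parts of their lower
    faces are disjoint ([lower_regular_far]).

    For upper regularity one needs that the sum of the [d]-th powers of the sides of
    the small dyadic cubes near a ball is at most a constant times the [d]-th power
    of the radius ([local_sum]). Each dyadic cube of the cover is marked by a point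
    of [E] and is near a minimal cube that is not much larger than itself. The
    difficulty is that the marked point may belong to another cube than the near
    one, and this may happen at many scales over the same minimal cubes, as the
    cubes need not have small boundaries. But the central child of a cube [P] is
    deep inside [P], so that small dyadic cubes near it are marked by points of
    [P]. Thus the dyadic cubes near [P] and marked by points outside of [P] are of a
    size comparable to [P], or near a child of [P] other than the central one. The
    mass of the central child pays for those of the first kind, and induction gives
    that their total is at most a constant times the mass of [P] ([outer_sum]).
    Applying this to the neighbours of a minimal cube bounds the sum over the dyadic
    cubes marked by its points ([inner_sum]), and the sum over the minimal cubes
    below a cube of the region is controlled by its mass ([minimal_sum_len]). *)

(** * Sums over covers *)

Section Sums.
Variable (R : realType).

Lemma big_seq_le_cover (A K : eqType) (r : seq K) (s : seq A)
    (p : A -> pred K) (F : K -> R) :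
  (forall x, x \in r -> 0 <= F x) ->
  (forall x, x \in r -> exists2 a, a \in s & p a x) ->
  \sum_(x <- r) F x <= \sum_(a <- s) \sum_(x <- r | p a x) F x.
Proof.
move=> F0 cov.
have -> : \sum_(a <- s) \sum_(x <- r | p a x) F x =
          \sum_(x <- r) \sum_(a <- s | p a x) F x.
  rewrite (eq_bigr (fun a => \sum_(x <- r) if p a x then F x else 0)); last first.
    by move=> a _; rewrite big_mkcond.
  rewrite exchange_big /=; apply: eq_bigr => x _.
  by rewrite -big_mkcond.
rewrite big_seq [leRHS]big_seq; apply: ler_sum => x xr.
have [a ain pax] := cov x xr.
rewrite (big_rem a) //= pax lerDl.
by apply: sumr_ge0 => *; exact: F0.
Qed.

Lemma big_seq_le_size (K : eqType) (r : seq K) (P : pred K) (F : K -> R) (N : nat) (b : R) :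
  0 <= b -> (size [seq x <- r | P x] <= N)%N ->
  (forall x, x \in r -> P x -> F x <= b) ->
  \sum_(x <- r | P x) F x <= N%:R * b.
Proof.
move=> b0 sN Fb.
have H : \sum_(x <- r | P x) F x <= (size [seq x <- r | P x])%:R * b.
  rewrite -big_filter mulr_natl.
  have -> : b *+ size [seq x <- r | P x] = \sum_(x <- [seq x <- r | P x]) b.
    by rewrite big_const_seq count_predT iter_addr_0.
  rewrite big_seq [leRHS]big_seq; apply: ler_sum => x.
  by rewrite mem_filter => /andP[Px xr]; exact: Fb.
apply: (le_trans H); apply: ler_wpM2r => //.
by rewrite ler_nat.
Qed.

Lemma half_le (a b : R) : a <= 2%:R * b -> a / 2%:R <= b.
Proof. lra. Qed.

Lemma small_triple (a r : R) : 0 < r -> a <= r * 32%:R^-1 -> a + (a + a) <= r.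
Proof. lra. Qed.

End Sums.

(** * Euclidean distance and packing *)

Section Euclidean.
Variables (R : realType) (n : nat).
Implicit Types x y z : 'rV[R]_n.

Lemma edistance_ge0 x y : 0 <= edistance x y.
Proof. exact: sqrtr_ge0. Qed.

Lemma edistancexx x : edistance x x = 0.
Proof.
rewrite /edistance big1 ?sqrtr0 // => i _; by rewrite subrr expr0n.
Qed.

Lemma edistanceC x y : edistance x y = edistance y x.
Proof.
by rewrite /edistance; congr Num.sqrt; apply: eq_bigr => i _; rewrite -sqrrN opprB.
Qed.

Lemma cauchy_schwarz_sum (a b : 'I_n -> R) :
  (\sum_i a i * b i) ^+ 2 <= (\sum_i a i ^+ 2) * (\sum_i b i ^+ 2).
Proof.
rewrite -subr_ge0.
have : 0 <= \sum_i \sum_j (a i * b j - a j * b i) ^+ 2.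
  by apply: sumr_ge0 => i _; apply: sumr_ge0 => j _; exact: sqr_ge0.
have -> : \sum_i \sum_j (a i * b j - a j * b i) ^+ 2 =
  2 * ((\sum_i a i ^+ 2) * (\sum_i b i ^+ 2) - (\sum_i a i * b i) ^+ 2).
  have E1 (f g : 'I_n -> R) : \sum_i \sum_j f i * g j = (\sum_i f i) * (\sum_j g j).
    by rewrite mulr_suml; apply: eq_bigr => i _; rewrite mulr_sumr.
  have -> : \sum_i \sum_j (a i * b j - a j * b i) ^+ 2 =
     \sum_i \sum_j (a i ^+ 2 * b j ^+ 2) + \sum_i \sum_j (b i ^+ 2 * a j ^+ 2)
     - 2 * \sum_i \sum_j ((a i * b i) * (a j * b j)).
    rewrite -big_split mulr_sumr -sumrB; apply: eq_bigr => i _ /=.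
    rewrite -big_split mulr_sumr -sumrB; apply: eq_bigr => j _ /=.
    ring.
  rewrite !E1; ring.
by rewrite pmulr_rge0.
Qed.

Lemma edistance_triangle y x z : edistance x z <= edistance x y + edistance y z.
Proof.
rewrite /edistance.
set a := fun i : 'I_n => x ord0 i - y ord0 i.
set b := fun i : 'I_n => y ord0 i - z ord0 i.
set A := \sum_(i < n) a i ^+ 2; set B := \sum_(i < n) b i ^+ 2.
have A0 : 0 <= A by apply: sumr_ge0 => i _; exact: sqr_ge0.
have B0 : 0 <= B by apply: sumr_ge0 => i _; exact: sqr_ge0.
have -> : \sum_(i < n) (x ord0 i - z ord0 i) ^+ 2 = A + B + 2 * \sum_i a i * b i.
  rewrite mulr_sumr -!big_split; apply: eq_bigr => i _ /=; rewrite /a /b; ring.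
have ab : \sum_i a i * b i <= Num.sqrt A * Num.sqrt B.
  apply: (le_trans (ler_norm _)); rewrite -sqrtr_sqr -sqrtrM //.
  by rewrite ler_sqrt ?mulr_ge0 //; exact: cauchy_schwarz_sum.
rewrite -[leRHS]ger0_norm ?addr_ge0 ?sqrtr_ge0 // -sqrtr_sqr ler_sqrt ?sqr_ge0 //.
rewrite sqrrD !sqr_sqrtr // -mulr_natl; lra.
Qed.

Lemma coord_le_edistance x y i : `|x ord0 i - y ord0 i| <= edistance x y.
Proof.
rewrite -sqrtr_sqr /edistance ler_sqrt; last first.
  by apply: sumr_ge0 => j _; exact: sqr_ge0.
by rewrite (bigD1 i) //= lerDl; apply: sumr_ge0 => j _; exact: sqr_ge0.
Qed.

Lemma edistance_le_coord x y (w : R) :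
  0 <= w -> (forall i, `|x ord0 i - y ord0 i| <= w) -> edistance x y <= n%:R * w.
Proof.
move=> w0 H; rewrite -[leRHS]ger0_norm ?mulr_ge0 // -sqrtr_sqr /edistance.
rewrite ler_sqrt ?sqr_ge0 //.
apply: (@le_trans _ _ (\sum_(i < n) w ^+ 2)).
  by apply: ler_sum => i _; rewrite -[leLHS]real_normK ?num_real // lerXn2r ?nnegrE //.
rewrite sumr_const card_ord -[leLHS]mulr_natl exprMn.
apply: ler_wpM2r; first exact: sqr_ge0.
by rewrite -natrX ler_nat; case: (n) => // k; rewrite expnS expn1 leq_pmulr.
Qed.

(** The unit [w / (n + 1)] of the grid is so small that points of one cell are
    closer than [w]. *)
Definition packing_number (L : R) : nat := (Num.truncn (2 * L * n.+1%:R)).+1 ^ n.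

Lemma packing (K : eqType) (r : seq K) (g : K -> 'rV[R]_n) (x : 'rV[R]_n) (w L : R) :
  0 < w -> uniq r ->
  (forall a b, a \in r -> b \in r -> a != b -> w <= edistance (g a) (g b)) ->
  (forall a, a \in r -> edistance x (g a) <= L * w) ->
  (size r <= packing_number L)%N.
Proof.
move=> w0 ur sep near.
have [->|/negP/negP r0] := eqVneq r [::]; first by [].
have L0 : 0 <= L.
  case: r r0 ur sep near => // a r _ _ _ near.
  have := le_trans (edistance_ge0 _ _) (near a (mem_head _ _)).
  by rewrite pmulr_lge0.
set M := (Num.truncn (2 * L * n.+1%:R)).
set u := w / n.+1%:R.
have u0 : 0 < u by rewrite divr_gt0.
pose q (a : K) (i : 'I_n) : R := (g a ord0 i - x ord0 i + L * w) / u.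
have q0 a i : a \in r -> 0 <= q a i.
  move=> ar; apply: divr_ge0; last exact: ltW.
  have := le_trans (coord_le_edistance x (g a) i) (near a ar).
  rewrite ler_norml; lra.
have qM a i : a \in r -> q a i <= 2 * L * n.+1%:R.
  move=> ar; rewrite /q /u ler_pdivrMr //.
  have := le_trans (coord_le_edistance x (g a) i) (near a ar).
  have -> : 2 * L * n.+1%:R * (w / n.+1%:R) = 2 * (L * w).
    by field.
  rewrite ler_norml; lra.
pose h a : {ffun 'I_n -> 'I_M.+1} := [ffun i => inord (Num.truncn (q a i))].
have hinj : {in r &, injective h}.
  move=> a b ar br hab; apply/eqP; apply: contraT => /sep => /(_ ar br).
  have tE c i : c \in r -> (h c i : nat) = Num.truncn (q c i).
    move=> cr; rewrite ffunE inordK // ltnS.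
    by apply: le_truncn; exact: qM.
  have same i : `|g a ord0 i - g b ord0 i| <= u.
    have E : Num.truncn (q a i) = Num.truncn (q b i) by rewrite -!tE // hab.
    have /truncn_itv/andP[a1 a2] := q0 _ i ar.
    have /truncn_itv/andP[b1 b2] := q0 _ i br.
    rewrite -E in b1 b2.
    have : `|q a i - q b i| <= 1.
      by rewrite ler_norml; rewrite -natr1 in a2 b2; apply/andP; split; lra.
    have -> : q a i - q b i = (g a ord0 i - g b ord0 i) / u.
      by rewrite /q; field; rewrite gt_eqF.
    by rewrite normrM (@gtr0_norm _ u^-1) ?invr_gt0 // ler_pdivrMr // mul1r.
  have := edistance_le_coord (ltW u0) same.
  move=> le1 le2; have := le_trans le2 le1.
  rewrite leNgt /u mulrCA; have -> : w * (n%:R / n.+1%:R) < w; last by [].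
  by rewrite gtr_pMr // ltr_pdivrMr // mul1r ltr_nat.
rewrite -(size_map h) /packing_number -/M.
have -> : (M.+1 ^ n = #|{ffun 'I_n -> 'I_M.+1}|)%N by rewrite card_ffun !card_ord.
have /card_uniqP <- : uniq (map h r) by rewrite map_inj_in_uniq.
exact: max_card.
Qed.

End Euclidean.

Lemma finite_of_packing (K : choiceType) (A : set K) (N : nat) :
  (forall r : seq K, uniq r -> (forall a, a \in r -> A a) -> (size r <= N)%N) ->
  finite_set A.
Proof.
move=> H; apply: contrapT => infA.
have [B BA Bn] := infinite_set_fset N.+1 infA.
have := H (enum_fset B) (fset_uniq B) (fun a aB => BA a aB).
by move=> s_N; have := leq_trans Bn s_N; rewrite ltnn.
Qed.

(** * Hausdorff content and measure *)

Section Hausdorff.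
Variables (R : realType) (n d : nat).
Hypothesis d_gt0 : (0 < d)%N.
Implicit Types (A B : set 'rV[R]_n) (delta : \bar R).

Lemma diameter_ge0 A : (0 <= diameter A)%E.
Proof. by rewrite /diameter le_max lexx. Qed.

Lemma edistance_le_diameter A x y : A x -> A y -> ((edistance x y)%:E <= diameter A)%E.
Proof.
move=> Ax Ay; rewrite /diameter le_max; apply/orP; right.
by apply: ereal_sup_ubound; exists x, y.
Qed.

Lemma diameter_le A (b : \bar R) : (0 <= b)%E ->
  (forall x y, A x -> A y -> ((edistance x y)%:E <= b)%E) -> (diameter A <= b)%E.
Proof.
move=> b0 H; rewrite /diameter ge_max b0 /=; apply: ge_ereal_sup => z.
by move=> [x [y [Ax Ay ->]]]; exact: H.
Qed.

Lemma diameter_gt A (r : R) : 0 <= r -> (r%:E < diameter A)%E ->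
  exists x y, [/\ A x, A y & r < edistance x y].
Proof.
move=> r0 lt; apply: contrapT => nex; move: lt; rewrite ltNge => /negP; apply.
apply: diameter_le => [|x y Ax Ay]; first by rewrite lee_fin.
by rewrite lee_fin leNgt; apply/negP => xy; apply: nex; exists x, y.
Qed.

Lemma dist_set_ge0 (x : 'rV[R]_n) A : (0 <= dist_set x A)%E.
Proof. by apply: le_ereal_inf_tmp => _ [y _ <-]; rewrite lee_fin edistance_ge0. Qed.

Lemma diameter0 : diameter (set0 : set 'rV[R]_n) = 0%E.
Proof. by apply/eqP; rewrite eq_le diameter_ge0 diameter_le. Qed.

Lemma lee_expe_ge0 (a b : \bar R) : (0 <= a)%E -> (a <= b)%E -> (a ^+ d <= b ^+ d)%E.
Proof.
move=> a0 ab; elim: d => [//|k IH]; rewrite !expeS.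
apply: lee_pmul => //; exact: expe_ge0.
Qed.

Lemma expe_diameter0 : (diameter (set0 : set 'rV[R]_n) ^+ d = 0)%E.
Proof. by apply/eqP; rewrite diameter0 expe_eq0 d_gt0 eqxx. Qed.

Lemma expe_diameter_ge0 A : (0 <= diameter A ^+ d)%E.
Proof. by apply: expe_ge0; exact: diameter_ge0. Qed.
Hint Resolve expe_diameter_ge0 : core.

Lemma hausdorff_delta_ge0 delta A : (0 <= hausdorff_delta d delta A)%E.
Proof.
apply: le_ereal_inf_tmp => z [U _ <-]; apply: nneseries_ge0 => i _ _.
exact: expe_diameter_ge0.
Qed.
Hint Resolve hausdorff_delta_ge0 : core.

Lemma hausdorff_delta_le_series delta A (U : nat -> set 'rV[R]_n) :
  A `<=` \bigcup_i U i -> (forall i, (diameter (U i) <= delta)%E) ->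
  (hausdorff_delta d delta A <= \sum_(0 <= i <oo) diameter (U i) ^+ d)%E.
Proof. by move=> AU Ud; apply: ereal_inf_lbound; exists U. Qed.

Lemma hausdorff_delta_subset delta A B :
  A `<=` B -> (hausdorff_delta d delta A <= hausdorff_delta d delta B)%E.
Proof.
move=> AB; apply: le_ereal_inf_tmp => z [U [BU Ud] <-].
by apply: hausdorff_delta_le_series => //; exact: subset_trans BU.
Qed.

Lemma hausdorff_delta_anti delta delta' A :
  (delta <= delta')%E -> (hausdorff_delta d delta' A <= hausdorff_delta d delta A)%E.
Proof.
move=> dd; apply: le_ereal_inf_tmp => z [U [BU Ud] <-].
by apply: hausdorff_delta_le_series => // i; exact: le_trans (Ud i) dd.
Qed.

Lemma hausdorff_delta_le_diameter delta A : (diameter A <= delta)%E ->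
  (hausdorff_delta d delta A <= diameter A ^+ d)%E.
Proof.
move=> Ad; pose U (i : nat) : set 'rV[R]_n := if i == 0%N then A else set0.
have := @hausdorff_delta_le_series delta A U.
rewrite nneseries_recl ?expe_diameter_ge0 // eseries0 ?adde0; last first.
  by case=> // i _ _; rewrite expe_diameter0.
apply; first by move=> x Ax; exists 0%N.
by case=> //= i; rewrite diameter0; exact: le_trans (diameter_ge0 _) Ad.
Qed.

(** The covers of the two sets are interleaved. *)
Lemma hausdorff_delta_setU delta A B :
  (hausdorff_delta d delta (A `|` B) <=
     hausdorff_delta d delta A + hausdorff_delta d delta B)%E.
Proof.
have [fA|] := boolP (hausdorff_delta d delta A \is a fin_num); last first.
  rewrite ge0_fin_numE // -leNgt leye_eq => /eqP ->.
  by rewrite addye ?leey // gt_eqF // (lt_le_trans _ (hausdorff_delta_ge0 _ _)).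
have [fB|] := boolP (hausdorff_delta d delta B \is a fin_num); last first.
  rewrite ge0_fin_numE // -leNgt leye_eq => /eqP ->.
  by rewrite addey ?leey // gt_eqF // (lt_le_trans _ (hausdorff_delta_ge0 _ _)).
apply/lee_addgt0Pr => e e0.
have e2 : (0 < e / 2)%R by rewrite divr_gt0.
have [a [U [AU Ud] Ua] aA] := lb_ereal_inf_adherent e2 fA.
have [b [V [BV Vd] Vb] bB] := lb_ereal_inf_adherent e2 fB.
pose W i := if odd i then V i./2 else U i./2.
have W0 i : (0 <= diameter (W i) ^+ d)%E by exact: expe_diameter_ge0.
apply: (@le_trans _ _ (a + b)%E); last first.
  have -> : (hausdorff_delta d delta A + hausdorff_delta d delta B + e%:E =
    (hausdorff_delta d delta A + (e / 2)%:E) + (hausdorff_delta d delta B + (e / 2)%:E))%E.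
    rewrite addeACA -EFinD; congr (_ + _%:E)%E; lra.
  exact: leeD (ltW aA) (ltW bB).
apply: (@le_trans _ _ (\sum_(0 <= i <oo) diameter (W i) ^+ d)%E).
  apply: hausdorff_delta_le_series.
    move=> x [/AU [i _ Uix]|/BV [i _ Vix]].
      by exists i.*2 => //; rewrite /W odd_double doubleK.
    by exists i.*2.+1 => //; rewrite /W /= odd_double uphalf_double.
  by move=> i; rewrite /W; case: ifP.
apply: lime_le; first exact: is_cvg_nneseries.
apply: nearW => N.
apply: (@le_trans _ _ (\sum_(0 <= i < N.*2) diameter (W i) ^+ d)%E).
  rewrite (@big_cat_nat _ _ _ N 0 N.*2) //=; last by rewrite -addnn leq_addr.
  by apply: leeDl; apply: sume_ge0.
have -> : (\sum_(0 <= i < N.*2) diameter (W i) ^+ d =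
   \sum_(0 <= i < N) diameter (U i) ^+ d + \sum_(0 <= i < N) diameter (V i) ^+ d)%E.
  elim: N => [|N IH]; first by rewrite !big_nil ?adde0.
  rewrite doubleS !big_nat_recr //= IH /W /= odd_double /= uphalf_double doubleK.
  by rewrite -!addeA; congr (_ + _)%E; rewrite addeCA.
by rewrite -Ua -Vb; apply: leeD; apply: nneseries_lim_ge.
Qed.

Lemma hausdorff_delta_set0 delta : (0 <= delta)%E -> (hausdorff_delta d delta (set0 : set 'rV[R]_n) = 0)%E.
Proof.
move=> d0; apply/eqP; rewrite eq_le hausdorff_delta_ge0 andbT.
by have := @hausdorff_delta_le_diameter delta set0; rewrite expe_diameter0 diameter0; exact.
Qed.

Lemma hausdorff_delta_le_sum (K : eqType) (r : seq K) (V : K -> set 'rV[R]_n) delta A :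
  (0 <= delta)%E -> (forall x, A x -> exists2 k, k \in r & V k x) ->
  (hausdorff_delta d delta A <= \sum_(k <- r) hausdorff_delta d delta (V k))%E.
Proof.
move=> d0; elim: r A => [|k r IH] A AV.
  rewrite big_nil -(hausdorff_delta_set0 d0); apply: hausdorff_delta_subset.
  by move=> x /AV [].
rewrite big_cons; apply: (@le_trans _ _ (hausdorff_delta d delta (V k `|` (A `\` V k)))).
  by apply: hausdorff_delta_subset => x Ax; case: (pselect (V k x)); [left|right].
apply: (le_trans (hausdorff_delta_setU _ _ _)); apply: leeD => //.
apply: IH => x [/AV [j]]; rewrite in_cons => /orP[/eqP -> //|jr Vjx] _.
by exists j.
Qed.

(** A set of diameter at most [delta] cannot meet both of two sets that are
    further than [delta] apart, so a cover splits in two. *)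
Lemma hausdorff_delta_separated (delta : R) A B : 0 <= delta ->
  (forall x y, A x -> B y -> delta < edistance x y) ->
  (hausdorff_delta d delta%:E A + hausdorff_delta d delta%:E B <=
     hausdorff_delta d delta%:E (A `|` B))%E.
Proof.
move=> d0 sep; apply: le_ereal_inf_tmp => z [U [ABU Ud] <-].
pose UA i := if `[< U i `&` A !=set0 >] then U i else set0.
pose UB i := if `[< U i `&` B !=set0 >] then U i else set0.
apply: (@le_trans _ _ (\sum_(0 <= i <oo) diameter (UA i) ^+ d +
                       \sum_(0 <= i <oo) diameter (UB i) ^+ d)%E).
  apply: leeD; apply: hausdorff_delta_le_series.
  - move=> x Ax; have [i _ Uix] := ABU x (or_introl Ax).
    by exists i => //; rewrite /UA asboolT //; exists x.
  - by move=> i; rewrite /UA; case: ifP => // _; rewrite diameter0 lee_fin.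
  - move=> x Ax; have [i _ Uix] := ABU x (or_intror Ax).
    by exists i => //; rewrite /UB asboolT //; exists x.
  - by move=> i; rewrite /UB; case: ifP => // _; rewrite diameter0 lee_fin.
rewrite -nneseriesD //; apply: lee_nneseries => [i _ _|i _]; first exact: adde_ge0.
rewrite /UA /UB; case: asboolP => [[x [Ux Ax]]|_]; case: asboolP => [[y [Uy By]]|_].
- have := sep x y Ax By; rewrite ltNge => /negP; case.
  by rewrite -lee_fin; apply: le_trans (Ud i); exact: edistance_le_diameter.
- by rewrite expe_diameter0 adde0.
- by rewrite expe_diameter0 add0e.
- by rewrite expe_diameter0 add0e.
Qed.

Lemma hausdorff_delta_sum_separated (K : eqType) (r : seq K) (V : K -> set 'rV[R]_n)
    (delta : R) A : 0 <= delta -> uniq r ->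
  (forall j k x y, j \in r -> k \in r -> j != k -> V j x -> V k y ->
     delta < edistance x y) ->
  (forall k, k \in r -> V k `<=` A) ->
  (\sum_(k <- r) hausdorff_delta d delta%:E (V k) <= hausdorff_delta d delta%:E A)%E.
Proof.
move=> d0 ur sep VA.
apply: (@le_trans _ _ (hausdorff_delta d delta%:E [set x | exists2 k, k \in r & V k x])).
  elim: r ur sep {VA} => [|k r IH] /=; first by rewrite big_nil.
  move=> /andP[kr ur] sep; rewrite big_cons.
  apply: (@le_trans _ _ (hausdorff_delta d delta%:E (V k) +
     hausdorff_delta d delta%:E [set x | exists2 k, k \in r & V k x])%E).
    apply: leeD => //; apply: IH => // i j x y ir jr; apply: sep;
    by rewrite in_cons ?ir ?jr orbT.
  apply: (le_trans (hausdorff_delta_separated d0 _)).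
    move=> x y Vx [j jr Vy]; apply: (sep k j) => //.
    - exact: mem_head.
    - by rewrite in_cons jr orbT.
    - by apply: contraNneq kr => ->.
  apply: hausdorff_delta_subset => x [Vx|[j jr Vx]]; first by exists k => //; exact: mem_head.
  by exists j => //; rewrite in_cons jr orbT.
by apply: hausdorff_delta_subset => x [k kr]; exact: VA.
Qed.

Lemma hausdorff_delta_le_measure (delta : R) A :
  0 < delta -> (hausdorff_delta d delta%:E A <= hausdorff_measure d A)%E.
Proof. by move=> d0; apply: ereal_sup_ubound; exists delta. Qed.

Lemma hausdorff_content_le_delta delta A :
  (hausdorff_content d A <= hausdorff_delta d delta A)%E.
Proof. by apply: hausdorff_delta_anti; exact: leey. Qed.

Lemma hausdorff_content_le_measure A :
  (hausdorff_content d A <= hausdorff_measure d A)%E.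
Proof.
apply: (@le_trans _ _ (hausdorff_delta d 1%:E A)); first exact: hausdorff_content_le_delta.
exact: hausdorff_delta_le_measure.
Qed.

Lemma hausdorff_measure_le (b : \bar R) A :
  (forall delta : R, 0 < delta -> (hausdorff_delta d delta%:E A <= b)%E) ->
  (hausdorff_measure d A <= b)%E.
Proof. by move=> H; apply: ge_ereal_sup => z [delta d0 <-]; exact: H. Qed.

Lemma hausdorff_measure_subset A B :
  A `<=` B -> (hausdorff_measure d A <= hausdorff_measure d B)%E.
Proof.
move=> AB; apply: hausdorff_measure_le => delta d0.
apply: (le_trans (hausdorff_delta_subset _ AB)); exact: hausdorff_delta_le_measure.
Qed.

Lemma hausdorff_measure_le_sum (K : eqType) (r : seq K) (V : K -> set 'rV[R]_n)
    (b : K -> R) A :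
  (forall x, A x -> exists2 k, k \in r & V k x) ->
  (forall k, k \in r -> (hausdorff_measure d (V k) <= (b k)%:E)%E) ->
  (hausdorff_measure d A <= (\sum_(k <- r) b k)%:E)%E.
Proof.
move=> AV Vb; apply: hausdorff_measure_le => delta d0.
apply: (le_trans (hausdorff_delta_le_sum _ AV)); first by rewrite lee_fin ltW.
rewrite -sumEFin big_seq [leRHS]big_seq; apply: lee_sum => k kr.
exact: le_trans (hausdorff_delta_le_measure _ d0) (Vb k kr).
Qed.

Lemma hausdorff_delta_le_diameters (K : eqType) (r : seq K) (V : K -> set 'rV[R]_n)
    (b : K -> R) delta A :
  (0 <= delta)%E ->
  (forall x, A x -> exists2 k, k \in r & V k x) ->
  (forall k, k \in r -> [/\ 0 <= b k, ((b k)%:E <= delta)%E & (diameter (V k) <= (b k)%:E)%E]) ->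
  (hausdorff_delta d delta A <= (\sum_(k <- r) b k ^+ d)%:E)%E.
Proof.
move=> d0 AV Vb; apply: (le_trans (hausdorff_delta_le_sum d0 AV)).
rewrite -sumEFin big_seq [leRHS]big_seq; apply: lee_sum => k kr.
have [b0 bd Vk] := Vb k kr.
apply: (le_trans (hausdorff_delta_le_diameter (le_trans Vk bd))).
by rewrite EFin_expe; apply: lee_expe_ge0 => //; exact: diameter_ge0.
Qed.

End Hausdorff.
(** * Content and measure of boxes *)

Section Boxes.
Variables (R : realType) (n d : nat).
Hypothesis d_gt0 : (0 < d)%N.

Definition box (p : 'I_n -> R) (S : {set 'I_n}) (a : R) : set 'rV[R]_n :=
  [set x | forall i, if i \in S then p i <= x ord0 i <= p i + a
                     else x ord0 i == p i].

Lemma box_edistance p S a x y : 0 <= a -> box p S a x -> box p S a y ->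
  edistance x y <= n%:R * a.
Proof.
move=> a0 bx yb; apply: edistance_le_coord => // i.
have := bx i; have := yb i; case: ifP => _.
  move=> /andP[y1 y2] /andP[x1 x2]; rewrite ler_norml; apply/andP; split; lra.
by move=> /eqP -> /eqP ->; rewrite subrr normr0.
Qed.

(** A box is cut into [N ^ d] boxes, and the bound does not depend on [N]. *)
Lemma hausdorff_measure_box_le p (S : {set 'I_n}) a : #|S| = d -> 0 < a ->
  (hausdorff_measure d (box p S a) <= ((n%:R * a) ^+ d)%:E)%E.
Proof.
move=> cS a0; apply: hausdorff_measure_le => delta delta0.
pose N := Num.truncn (n%:R * a / delta).
set u := a / N.+1%:R.
have u0 : 0 < u by rewrite divr_gt0.
have nu : n%:R * u <= delta.
  rewrite /u mulrA ler_pdivrMr // -ler_pdivrMl // mulrC.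
  by rewrite ltW // truncnS_gt.
pose J := enum (pffun_on ord0 (mem S) (mem 'I_N.+1)).
pose V (f : {ffun 'I_n -> 'I_N.+1}) := box (fun i => p i + (f i)%:R * u) S u.
have E : \sum_(f <- J) (n%:R * u) ^+ d = (n%:R * a) ^+ d.
  rewrite big_const_seq count_predT iter_addr_0 -cardE card_pffun_on cS card_ord.
  rewrite -[LHS]mulr_natl natrX -exprMn /u; congr (_ ^+ _); field.
  by rewrite nat1r.
rewrite -E; apply: (@hausdorff_delta_le_diameters R n d d_gt0 _ J V (fun=> n%:R * u)).
- by rewrite lee_fin ltW.
- move=> x bx.
  pose q i := (x ord0 i - p i) / u.
  exists [ffun i => if i \in S then inord (minn N (Num.truncn (q i))) else ord0].
    rewrite mem_enum; apply/pffun_onP; split; last by move=> ? ?; rewrite inE.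
    by apply/fintype.subsetP => i; rewrite inE ffunE; case: ifP => //; rewrite eqxx.
  move=> i; rewrite ffunE; have := bx i; case: ifP => iS; last first.
    by rewrite mul0r addr0.
  move=> /andP[x1 x2].
  rewrite inordK ?ltnS ?geq_minl //.
  have q0 : 0 <= q i by apply: divr_ge0; [rewrite subr_ge0|exact: ltW].
  have /truncn_itv/andP[t1 t2] := q0.
  have xE : x ord0 i = p i + q i * u by rewrite /q divfK ?gt_eqF // addrC subrK.
  have aE : a = N%:R * u + u.
    by rewrite /u -natr1; field; rewrite natr1.
  have [h|h] := leqP N (Num.truncn (q i)).
    have Nq : N%:R <= q i by apply: le_trans t1; rewrite ler_nat.
    by rewrite -addrA -aE x2 andbT xE lerD2l ler_wpM2r // ltW.
  rewrite xE lerD2l ler_wpM2r ?(ltW u0) //= -addrA lerD2l.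
  by rewrite -[X in _ + X]mul1r -mulrDl ler_wpM2r ?(ltW u0) // natr1 ltW.
- move=> f _; split.
  + by rewrite mulr_ge0 // ltW.
  + by rewrite lee_fin.
  + apply: diameter_le; first by rewrite lee_fin mulr_ge0 // ltW.
    by move=> x y Vx Vy; rewrite lee_fin; apply: box_edistance Vx Vy; exact: ltW.
Qed.

(** The progression is [u]-separated, so this is packing in dimension one. *)
Lemma card_progression_near (N : nat) (p u w y : R) : 0 < u -> u <= w ->
  (#|[pred k : 'I_N | `|p + k%:R * u - y| < w]|)%:R <= 5%:R * (w / u).
Proof.
move=> u0 uw.
have w0 : 0 < w by apply: lt_le_trans uw.
pose r := enum [pred k : 'I_N | `|p + k%:R * u - y| < w].
pose g (k : 'I_N) : 'rV[R]_1 := \row_(_ < 1) (p + k%:R * u).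
have : (size r <= packing_number 1 (w / u))%N.
  apply: (@packing R 1 _ r g (\row_(_ < 1) y) u) => //.
  - exact: enum_uniq.
  - move=> a b _ _ ab; apply: le_trans (coord_le_edistance _ _ ord0).
    rewrite !mxE opprD addrACA subrr add0r -mulrBl normrM [X in _ * X]gtr0_norm //.
    rewrite ler_peMl ?(ltW u0) // -[a%:R]/((a%:Z)%:~R) -[b%:R]/((b%:Z)%:~R).
    rewrite -intrB -intr_norm -[1]/(1%:~R) ler_int.
    have : (a : nat) != b by [].
    lia.
  - move=> k; rewrite mem_enum inE => kw.
    rewrite divfK ?gt_eqF // -[w]mul1r.
    apply: edistance_le_coord => [|i]; first exact: ltW.
    by rewrite !mxE distrC ltW.
rewrite -cardE /packing_number expn1 => H.
have q1 : 1 <= w / u by rewrite ler_pdivlMr // mul1r.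
apply: (@le_trans _ _ ((Num.truncn (2 * (w / u) * 2)).+1%:R)); first by rewrite ler_nat.
rewrite -natr1; have : (Num.truncn (2 * (w / u) * 2))%:R <= 2 * (w / u) * 2.
  by rewrite truncn_le; lra.
lra.
Qed.

Lemma card_grid_near (N : nat) (S : {set 'I_n}) (p y : 'I_n -> R) (u w : R) :
  #|S| = d -> 0 < u -> u <= w ->
  (#|[pred f in pffun_on (@ord0 N) (mem S) (mem 'I_N.+1) |
     [forall i in S, `|p i + (f i)%:R * u - y i| < w]]|)%:R <= (5%:R * (w / u)) ^+ d.
Proof.
move=> cS u0 uw.
pose F (i : 'I_n) := [pred k : 'I_N.+1 | `|p i + k%:R * u - y i| < w].
apply: (@le_trans _ _ (#|pfamily (@ord0 N) (mem S) F|%:R)).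
  rewrite ler_nat; apply: subset_leq_card; apply/fintype.subsetP => f.
  rewrite inE => /andP[/pffun_onP[fs _] /forall_inP H].
  by apply/pfamilyP; split => // i iS; rewrite inE; exact: H.
rewrite card_pfamily.
have w0 : 0 < w by apply: lt_le_trans uw.
have b0 : 0 <= 5%:R * (w / u) by rewrite mulr_ge0 // divr_ge0 // ltW.
have -> : d = size (enum (mem S)) by rewrite -cS cardE.
rewrite /image_mem; elim: (enum (mem S)) => [|i s IH] /=; first by rewrite expr0.
rewrite natrM exprS ler_pM //; exact: card_progression_near.
Qed.

Lemma ball_rV (y x : 'rV[R]_n) (w : R) : 0 < w ->
  ball y w x = (forall i, `|y ord0 i - x ord0 i| < w).
Proof.
move=> w0; apply/propext; split.
  by case=> _ h i; exact: h.
move=> h; split => // i j; rewrite (ord1 i); exact: h.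
Qed.

(** By compactness finitely many slightly enlarged sets of the cover suffice;
    each of them holds at most the share [(5 w / u) ^ d] of the points of a fine
    grid in the box. *)
Lemma hausdorff_content_box_ge p (S : {set 'I_n}) a : #|S| = d -> 0 < a ->
  (((a / 10%:R) ^+ d)%:E <= hausdorff_content d (box p S a))%E.
Proof.
move=> cS a0; apply: le_ereal_inf_tmp => _ [U [bU _] <-].
have D0 i : (0 <= diameter (U i) ^+ d)%E by exact: expe_diameter_ge0.
have [finS|] := boolP ((\sum_(0 <= i <oo) diameter (U i) ^+ d)%E \is a fin_num); last first.
  by rewrite ge0_fin_numE ?nneseries_ge0 // -leNgt leye_eq => /eqP ->; rewrite leey.
have finU i : diameter (U i) \is a fin_num.
  rewrite ge0_fin_numE ?diameter_ge0 // ltey; apply/negP => /eqP dy.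
  have : (diameter (U i) ^+ d = +oo)%E.
    rewrite dy; case: (d) d_gt0 => // k _; elim: k => [//|k IH].
    by rewrite expeS IH mulyy.
  move=> /(@nneseries_pinfty R _ xpredT i (fun i _ => D0 i) isT) E.
  by move: finS; rewrite E.
pose del i := fine (diameter (U i)).
have delE i : diameter (U i) = (del i)%:E by rewrite fineK.
have del0 i : 0 <= del i by rewrite fine_ge0 // diameter_ge0.
apply/lee_addgt0Pr => e' e'0.
pose e := Num.min e' 1.
have e0 : 0 < e by rewrite lt_min e'0 ltr01.
pose eps (i : nat) := e / (2 ^ i.+1)%:R.
have eps0 i : 0 < eps i by rewrite divr_gt0 // ltr0n expn_gt0.
have eps1 i : eps i <= 1.
  rewrite ler_pdivrMr ?ltr0n ?expn_gt0 // mul1r.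
  apply: (@le_trans _ _ 1); first by rewrite ge_min lexx orbT.
  by rewrite ler1n expn_gt0.
pose w i := del i + eps i.
have w0 i : 0 < w i by rewrite ltr_wpDl.
pose V (i : nat) : set 'rV[R]_n := if pselect (U i !=set0) is left ne
  then ball (projT1 (cid ne)) (w i) else set0.
have UV i : U i `<=` V i.
  move=> x Ux; rewrite /V; case: pselect => [ne|[]]; last by exists x.
  case: (cid ne) => y /= Uy; rewrite ball_rV //= => j.
  apply: (le_lt_trans (coord_le_edistance _ _ _)).
  apply: (@le_lt_trans _ _ (del i)); last by rewrite ltrDl.
  by rewrite -lee_fin -delE; exact: edistance_le_diameter.
have Vopen i : setT i -> open (V i).
  by rewrite /V; case: pselect => [ne|_] _; [exact: ball_open|exact: open0].
have cbox : compact (box p S a).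
  pose Ai i := `[p i, p i + (if i \in S then a else 0)]%classic.
  have -> : box p S a = [set v : 'rV[R]_n | forall i, Ai i (v ord0 i)].
    apply/seteqP; split => x bx i; have := bx i; rewrite /Ai /= in_itv /=; case: ifP => // _.
      by move=> /eqP ->; rewrite addr0 lexx.
    by rewrite addr0 => h; rewrite eq_le andbC.
  by apply: rV_compact => i; exact: segment_compact.
rewrite compact_cover in cbox.
have [||D' _ bD'] := cbox nat setT V; first exact: Vopen.
  by move=> x /bU [i _ Uix]; exists i => //; exact: UV.
(* a grid finer than every set of the finite cover *)
have [N HN] : exists N : nat, forall i, i \in D' -> a / N.+1%:R <= w i.
  exists (\max_(i <- enum_fset D') Num.truncn (a / w i))%N => i iD.
  rewrite ler_pdivrMr // -ler_pdivrMl // mulrC.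
  apply: (@le_trans _ _ (Num.truncn (a / w i)).+1%:R); first by rewrite ltW // truncnS_gt.
  by rewrite ler_nat ltnS; apply: (@leq_bigmax_seq _ _ xpredT (fun i => Num.truncn (a / w i)) i).
pose u := a / N.+1%:R.
have u0 : 0 < u by rewrite divr_gt0.
have wu i : i \in D' -> u <= w i by exact: HN.
pose J := pffun_on (@ord0 N) (mem S) (mem 'I_N.+1).
pose g (f : {ffun 'I_n -> 'I_N.+1}) : 'rV[R]_n := \row_i (p i + (f i)%:R * u).
have gbox f : f \in J -> box p S a (g f).
  move=> /pffun_onP[/fintype.subsetP fs _] i; rewrite mxE; case: ifP => iS.
    rewrite lerDl mulr_ge0 ?(ltW u0) //= lerD2l /u mulrA ler_pdivrMr // mulrC.
    by rewrite ler_wpM2l ?(ltW a0) // ler_nat ltnW // ltn_ord.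
  have -> : f i = ord0 by apply/eqP; apply: contraFT iS => fi; exact: fs.
  by rewrite mul0r addr0.
have cJ : (#|J| = N.+1 ^ d)%N by rewrite card_pffun_on cS card_ord.
have count : (N.+1 ^ d)%:R <= \sum_(i <- enum_fset D') (5%:R * (w i / u)) ^+ d.
  have H1 : (#|J|%:R : R) = \sum_(f <- enum J) 1.
    by rewrite big_const_seq count_predT iter_addr_0 -cardE.
  rewrite -cJ H1.
  apply: (le_trans (@big_seq_le_cover R _ _ (enum J) (enum_fset D') (fun i f => `[< V i (g f) >]) _ _ _)) => //.
    move=> f; rewrite mem_enum => fJ; have [i iD Vi] := bD' _ (gbox f fJ).
    by exists i => //; exact/asboolP.
  rewrite big_seq [leRHS]big_seq; apply: ler_sum => i iD.
  have [ne|ne] := pselect (U i !=set0); last first.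
    rewrite big1; first by rewrite exprn_ge0 // mulr_ge0 // divr_ge0 // ltW.
    by move=> f /asboolP; rewrite /V; case: pselect.
  pose y := projT1 (cid ne).
  apply: le_trans (@card_grid_near N S p (fun i => y ord0 i) u (w i) cS u0 (wu i iD)).
  rewrite -big_filter big_const_seq count_predT iter_addr_0 ler_nat.
  rewrite cardE; apply: uniq_leq_size; first by rewrite filter_uniq // enum_uniq.
  move=> f; rewrite mem_filter !mem_enum => /andP[/asboolP Vf fJ].
  rewrite inE fJ /=; apply/forall_inP => j jS.
  move: Vf; rewrite /V; case: pselect => // ne'.
  rewrite (Prop_irrelevance ne' ne) ball_rV // => /(_ j).
  by rewrite mxE distrC.
have count2 : a ^+ d <= \sum_(i <- enum_fset D') (5%:R * w i) ^+ d.
  have -> : a = N.+1%:R * u by rewrite mulrC divfK.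
  rewrite exprMn -natrX; apply: (@le_trans _ _ ((\sum_(i <- enum_fset D') (5%:R * (w i / u)) ^+ d) * u ^+ d)).
    by rewrite ler_wpM2r // exprn_ge0 // ltW.
  rewrite mulr_suml; apply: ler_sum => i _.
  by rewrite -exprMn -mulrA divfK // gt_eqF.
have count3 : (a / 10%:R) ^+ d <= \sum_(i <- enum_fset D') (del i ^+ d + eps i).
  rewrite expr_div_n ler_pdivrMr ?exprn_gt0 // mulrC mulr_sumr.
  apply: (le_trans count2); apply: ler_sum => i _.
  have -> : 5%:R * w i = 10%:R * (w i / 2) by field.
  rewrite exprMn ler_wpM2l // ?exprn_ge0 //.
  have ed : eps i ^+ d <= eps i.
    by case: (d) d_gt0 => // k _; rewrite exprS ler_piMr ?(ltW (eps0 i)) // exprn_ile1 // ltW.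
  have w20 : 0 <= w i / 2 by rewrite divr_ge0 // ltW.
  have e20 := ltW (eps0 i).
  have [le|/ltW le] := leP (del i) (eps i).
    apply: (@le_trans _ _ (eps i ^+ d)).
      by rewrite lerXn2r ?nnegrE // ler_pdivrMr // /w; lra.
    by apply: (le_trans ed); rewrite lerDr exprn_ge0.
  apply: (@le_trans _ _ (del i ^+ d)); last by rewrite lerDl ltW.
  by rewrite lerXn2r ?nnegrE // ler_pdivrMr // /w; lra.
apply: (@le_trans _ _ (\big[+%E/0%E]_(i <- enum_fset D') (diameter (U i) ^+ d + (eps i)%:E)%E)).
  rewrite (eq_bigr (fun i => (del i ^+ d + eps i)%:E)) ?sumEFin ?lee_fin //.
  by move=> i _; rewrite delE EFinD EFin_expe.
have f0 i : xpredT i -> (0 <= diameter (U i) ^+ d + (eps i)%:E)%E.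
  by move=> _; rewrite adde_ge0 // lee_fin ltW.
have H0 := @lee_sum_fset_lim R _ D' xpredT f0.
apply: (le_trans H0).
apply: (le_trans (epsilon_trick xpredT D0 (ltW e0))).
by rewrite leeD2l // lee_fin ge_min lexx.
Qed.

End Boxes.
(** * Dyadic cubes and their skeleta *)

Lemma fset_setP (K : choiceType) (A : set K) (x : K) :
  finite_set A -> reflect (A x) (x \in fset_set A).
Proof. by move=> finA; rewrite in_fset_set //; apply: (iffP idP); rewrite in_setE. Qed.

Section Dyadic.
Variables (R : realType) (n : nat).
Implicit Types (I J : dyadic n) (x y : 'rV[R]_n).

Lemma dyadic_len_gt0 I : 0 < dyadic_len R I.
Proof. by rewrite /dyadic_len exprz_gt0. Qed.

Lemma dyadic_len_ge0 I : 0 <= dyadic_len R I.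
Proof. exact: ltW (dyadic_len_gt0 I). Qed.

Lemma dyadic_len_le I J : (dyadic_len R I <= dyadic_len R J) = (I.1 <= J.1).
Proof. by rewrite /dyadic_len ler_eXz2l // ltr1n. Qed.

Lemma dyadic_len_dvd I J : I.1 <= J.1 ->
  exists q : nat, dyadic_len R J = q%:R * dyadic_len R I /\ (0 < q)%N.
Proof.
move=> IJ; exists (2 ^ `|J.1 - I.1|)%N; rewrite expn_gt0; split => //.
rewrite /dyadic_len natrX -[in LHS](subrK I.1 J.1) expfzDr // -{1}(@gez0_abs (J.1 - I.1)) //.
by rewrite subr_ge0.
Qed.

Definition dyadic_at (k : int) x : dyadic n :=
  (k, \row_i Num.floor (x ord0 i / 2%:R ^ k)).

Lemma mem_dyadic_at k x : @dyadic_set R n (dyadic_at k x) x.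
Proof.
have k0 : (0 : R) < 2%:R ^ k by rewrite exprz_gt0.
move=> i; rewrite /dyadic_corner /dyadic_len /= mxE.
set q := x ord0 i / 2%:R ^ k.
have -> : x ord0 i = q * 2%:R ^ k by rewrite /q divfK // gt_eqF.
have /andP[h1 h2] := floor_itv q; rewrite ler_pM2r // h1 /=.
by rewrite -[X in _ + X]mul1r -mulrDl ltr_pM2r //; rewrite intrD in h2.
Qed.

Definition dyadic_corner_pt I : 'rV[R]_n := \row_i dyadic_corner R I i.

Lemma mem_dyadic_corner_pt I : @dyadic_set R n I (dyadic_corner_pt I).
Proof. by move=> i; rewrite mxE lexx ltrDl dyadic_len_gt0. Qed.

(** Corners of a smaller cube and of a larger one both lie in the grid of the
    smaller cube, so that intervals that overlap are nested. *)
Lemma dyadic_coord_nested I J i (t : R) : I.1 <= J.1 ->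
  dyadic_corner R I i <= t < dyadic_corner R I i + dyadic_len R I ->
  dyadic_corner R J i <= t < dyadic_corner R J i + dyadic_len R J ->
  dyadic_corner R J i <= dyadic_corner R I i /\
  dyadic_corner R I i + dyadic_len R I <= dyadic_corner R J i + dyadic_len R J.
Proof.
move=> /dyadic_len_dvd[q [E q0]]; rewrite /dyadic_corner.
set a := I.2 ord0 i; set b := J.2 ord0 i; set w := dyadic_len R I.
have w0 : 0 < w by exact: dyadic_len_gt0.
rewrite E -[q%:R]/((q%:Z)%:~R) -/w.
have -> : a%:~R * w + w = (a + 1)%:~R * w by rewrite intrD mulrDl mul1r.
have -> : b%:~R * (q%:~R * w) + q%:~R * w = ((b + 1) * q)%:~R * w.
  by rewrite intrM intrD mulrA; ring.
rewrite mulrA -intrM => /andP[a1 a2] /andP[b1 b2].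
have := le_lt_trans b1 a2; have := le_lt_trans a1 b2.
rewrite !ltr_pM2r // !ltr_int !ler_pM2r // !ler_int; lia.
Qed.

Lemma dyadic_nested I J x : I.1 <= J.1 -> @dyadic_set R n I x -> @dyadic_set R n J x ->
  @dyadic_set R n I `<=` @dyadic_set R n J.
Proof.
move=> IJ Ix Jx y Iy i; have [h1 h2] := dyadic_coord_nested IJ (Ix i) (Jx i).
by have /andP[y1 y2] := Iy i; rewrite (le_trans h1 y1) (lt_le_trans y2 h2).
Qed.

Lemma dyadic_eq I J x : I.1 = J.1 -> @dyadic_set R n I x -> @dyadic_set R n J x -> I = J.
Proof.
move=> IJ Ix Jx.
have le1 : I.1 <= J.1 by rewrite IJ.
have le2 : J.1 <= I.1 by rewrite IJ.
have h1 i := dyadic_coord_nested le1 (Ix i) (Jx i).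
have h2 i := dyadic_coord_nested le2 (Jx i) (Ix i).
case: I J IJ Ix Jx le1 le2 h1 h2 => [k a] [k' b] /= <- _ _ _ _ h1 h2; congr (_, _).
apply/rowP => i; have [+ _] := h1 i; have [+ _] := h2 i.
rewrite /dyadic_corner /dyadic_len /= !ler_pM2r ?exprz_gt0 // !ler_int.
by move=> e1 e2; apply/eqP; rewrite eq_le e1 e2.
Qed.

(** In each coordinate the interval of the smaller cube lies inside that of the
    larger one or is disjoint from it; were it inside every time, so would be the
    cube. *)
Lemma dyadic_disjoint_coord I J : ~ (@dyadic_set R n I `&` @dyadic_set R n J !=set0) ->
  exists i, dyadic_corner R I i + dyadic_len R I <= dyadic_corner R J i \/
            dyadic_corner R J i + dyadic_len R J <= dyadic_corner R I i.
Proof.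
wlog IJ : I J / I.1 <= J.1.
  move=> H dis; have [|/ltW] := leP I.1 J.1; first by move=> /H; exact.
  by move=> /H; rewrite setIC => /(_ dis) [i [|]]; exists i; [right|left].
move=> dis; apply: contrapT => /forallNP H; apply: dis.
exists (dyadic_corner_pt I); split; first exact: mem_dyadic_corner_pt.
move=> i; rewrite mxE.
have [/negP h1 /negP h2] : ~ (dyadic_corner R I i + dyadic_len R I <= dyadic_corner R J i) /\
   ~ (dyadic_corner R J i + dyadic_len R J <= dyadic_corner R I i).
  by split => h; apply: (H i); [left|right].
rewrite -!ltNge in h1 h2; rewrite h2 andbT.
have [le|lt] := leP (dyadic_corner R I i) (dyadic_corner R J i); last exact: ltW.
have := @dyadic_coord_nested I J i (dyadic_corner R J i) IJ.
by rewrite le h1 lexx ltrDl dyadic_len_gt0 => /(_ isT isT) [].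
Qed.

Lemma dyadic_corner_separated I J (w : R) : w <= dyadic_len R I -> w <= dyadic_len R J ->
  ~ (@dyadic_set R n I `&` @dyadic_set R n J !=set0) ->
  w <= edistance (dyadic_corner_pt I) (dyadic_corner_pt J).
Proof.
move=> wI wJ /dyadic_disjoint_coord [i H].
apply: le_trans (coord_le_edistance _ _ i); rewrite !mxE.
case: H => H; first by rewrite distrC; apply: le_trans (ler_norm _); lra.
by apply: le_trans (ler_norm _); lra.
Qed.

Definition dyadic_hull I : set 'rV[R]_n :=
  [set x | forall i, dyadic_corner R I i <= x ord0 i
                       <= dyadic_corner R I i + dyadic_len R I].

Lemma dyadic_set_hull I : @dyadic_set R n I `<=` dyadic_hull I.
Proof. by move=> x Ix i; have /andP[-> /ltW ->] := Ix i. Qed.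

Lemma skeleton_hull d I : @skeleton R n d I `<=` dyadic_hull I.
Proof.
move=> x [S [e [_ h]]] i; have := h i; case: ifP => // _ /eqP ->.
have l0 := dyadic_len_ge0 I.
case: (e i); rewrite ?mul1r ?mul0r ?addr0; apply/andP; split => //; lra.
Qed.

Lemma dyadic_hull_edistance I x y : dyadic_hull I x -> dyadic_hull I y ->
  edistance x y <= n%:R * dyadic_len R I.
Proof.
move=> Ix Iy; apply: edistance_le_coord => [|i]; first exact: dyadic_len_ge0.
have /andP[x1 x2] := Ix i; have /andP[y1 y2] := Iy i.
by rewrite ler_norml; apply/andP; split; lra.
Qed.

Definition dyadic_parent I : dyadic n := dyadic_at (I.1 + 1) (dyadic_corner_pt I).

Lemma dyadic_parent_sub I : @dyadic_set R n I `<=` @dyadic_set R n (dyadic_parent I).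
Proof.
apply: (@dyadic_nested _ _ (dyadic_corner_pt I)).
- by rewrite /= lerDl.
- exact: mem_dyadic_corner_pt.
- exact: mem_dyadic_at.
Qed.

Lemma dyadic_parent_len I : dyadic_len R (dyadic_parent I) = 2%:R * dyadic_len R I.
Proof. by rewrite /dyadic_len /= expfzDr // mulrC. Qed.

Section Skeleton.
Variable d : nat.
Hypotheses (d_gt0 : (0 < d)%N) (d_lt_n : (d < n)%N).

Definition face_corner I (S : {set 'I_n}) (e : 'I_n -> bool) (i : 'I_n) : R :=
  dyadic_corner R I i + (if i \in S then 0 else (e i)%:R * dyadic_len R I).

Lemma dyadic_faceE I S e : dyadic_face I S e = box (face_corner I S e) S (dyadic_len R I).
Proof.
by apply/seteqP; split => x h i; have := h i; rewrite /face_corner /=; case: (i \in S);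
  rewrite ?addr0.
Qed.

Lemma hausdorff_measure_skeleton_le I :
  (hausdorff_measure d (@skeleton R n d I) <=
     ((4 ^ n)%:R * (n%:R * dyadic_len R I) ^+ d)%:E)%E.
Proof.
pose r := [seq Se : {set 'I_n} * {ffun 'I_n -> bool} <- enum {: {set 'I_n} * {ffun 'I_n -> bool}} | #|Se.1| == d].
have := @hausdorff_measure_le_sum R n d d_gt0 _ r (fun Se => dyadic_face I Se.1 Se.2)
  (fun=> (n%:R * dyadic_len R I) ^+ d) (@skeleton R n d I).
move=> H; apply: (le_trans (H _ _)).
- move=> x [S [e [cS h]]]; exists (S, [ffun i => e i]).
    by rewrite mem_filter mem_enum /= cS eqxx.
  by move=> i; have := h i; case: ifP => //= _; rewrite ffunE.
- move=> Se; rewrite mem_filter => /andP[/eqP cS _].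
  rewrite dyadic_faceE; apply: hausdorff_measure_box_le => //; exact: dyadic_len_gt0.
- rewrite lee_fin; apply: big_seq_le_size => //.
    by rewrite exprn_ge0 // mulr_ge0 // dyadic_len_ge0.
  rewrite filter_predT; apply: (@leq_trans (size (enum {: {set 'I_n} * {ffun 'I_n -> bool}}))).
    by rewrite size_filter count_size.
  have cP : #|{: {set 'I_n}}| = (2 ^ n)%N.
    have := card_powerset [set: 'I_n]%SET; rewrite cardsT card_ord => <-.
    by apply: eq_card => S; rewrite !inE finset.subsetT.
  by rewrite -cardE card_prod cP card_ffun card_bool card_ord -expnMn.
Qed.

Definition initial_set : {set 'I_n} := [set i : 'I_n | (i < d)%N]%SET.

Lemma card_initial_set : #|initial_set| = d.
Proof.
rewrite /initial_set -sum1_card (eq_bigl (fun i : 'I_n => (i < d)%N)); last by move=> i; rewrite inE.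
by rewrite -(big_ord_widen n (fun=> 1%N) (ltnW d_lt_n)) sum1_card card_ord.
Qed.

Lemma skeleton_corner_pt I : @skeleton R n d I (dyadic_corner_pt I).
Proof.
exists initial_set, (fun=> false); split; first exact: card_initial_set.
move=> i; rewrite mxE; case: ifP; rewrite ?mul0r ?addr0 // lexx.
by rewrite lerDl dyadic_len_ge0.
Qed.

(** A point of a face lies in a box of any smaller side inside the face. *)
Lemma hausdorff_content_skeleton_ge I x a : @skeleton R n d I x -> 0 < a -> a <= dyadic_len R I ->
  (((a / 10%:R) ^+ d)%:E <=
     hausdorff_content d (cball x (n%:R * a) `&` @skeleton R n d I))%E.
Proof.
move=> [S [e [cS xS]]] a0 aI.
rewrite dyadic_faceE in xS; set p := face_corner I S e in xS.
pose p' i := if i \in S then Num.min (x ord0 i) (p i + dyadic_len R I - a) else p i.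
apply: (le_trans (hausdorff_content_box_ge d_gt0 p' cS a0)).
have xp' : box p' S a x.
  move=> i; have := xS i; rewrite /p'; case: ifP => // iS /andP[x1 x2].
  rewrite ge_min lexx /= -lerBlDr le_min lerBlDr lerDl (ltW a0) /=; lra.
apply: hausdorff_delta_subset => y yp'; split.
  by apply: box_edistance xp' yp'; exact: ltW.
exists S, e; split => //; rewrite dyadic_faceE => i.
have := xS i; have := yp' i; rewrite /p' -/p; case: ifP => iS; rewrite iS.
  rewrite minEle; case: (leP (x ord0 i) _) => h /andP[h2 h3] /andP[x1 x2].
    by apply/andP; split; lra.
  by apply/andP; split; lra.
by [].
Qed.

(** The middle half of a face lies in the half-open cube itself, so the middle
    halves for disjoint cubes are disjoint, and even at positive distance. *)
Definition middle_face I : set 'rV[R]_n :=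
  box (fun i => dyadic_corner R I i + (if i \in initial_set then dyadic_len R I / 4%:R else 0))
      initial_set (dyadic_len R I / 2%:R).

Lemma middle_face_skeleton I : middle_face I `<=` @skeleton R n d I.
Proof.
have l0 := dyadic_len_ge0 I.
move=> x h; exists initial_set, (fun=> false); split; first exact: card_initial_set.
move=> i; have := h i; case: ifP => iS; rewrite iS.
  by move=> /andP[h1 h2]; apply/andP; split; lra.
by rewrite mul0r.
Qed.

Lemma hausdorff_content_middle_face_ge I :
  (((dyadic_len R I / 20%:R) ^+ d)%:E <= hausdorff_content d (middle_face I))%E.
Proof.
have -> : dyadic_len R I / 20%:R = (dyadic_len R I / 2%:R) / 10%:R by field.
apply: hausdorff_content_box_ge => //; first exact: card_initial_set.
by rewrite divr_gt0 // dyadic_len_gt0.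
Qed.

Lemma middle_face_separated I J (w : R) x y :
  w <= dyadic_len R I -> w <= dyadic_len R J -> 0 < w ->
  ~ (@dyadic_set R n I `&` @dyadic_set R n J !=set0) ->
  middle_face I x -> middle_face J y -> w / 4%:R < edistance x y.
Proof.
move=> wI wJ w0 /dyadic_disjoint_coord [i H] Ix Jy.
apply: lt_le_trans (coord_le_edistance _ _ i).
have := Ix i; have := Jy i; case: ifP => iS; rewrite iS.
  move=> /andP[y1 y2] /andP[x1 x2].
  case: H => H; first by rewrite distrC; apply: lt_le_trans (ler_norm _); lra.
  by apply: lt_le_trans (ler_norm _); lra.
move=> /eqP -> /eqP ->; rewrite !addr0.
case: H => H; first by rewrite distrC; apply: lt_le_trans (ler_norm _); lra.
by apply: lt_le_trans (ler_norm _); lra.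
Qed.

(** The skeleton of a large cube lies in the skeleton of the grid. *)
Lemma skeleton_dyadic_at I x (s : int) : s <= I.1 -> @skeleton R n d I x ->
  @skeleton R n d (dyadic_at s x) x.
Proof.
move=> sI [S [e [cS h]]]; exists S, (fun=> false); split => // i.
have /andP[h1 h2] := mem_dyadic_at s x i; have := h i; case: ifP => _.
  by rewrite h1 (ltW h2).
move=> /eqP xE; rewrite mul0r addr0; apply/eqP.
have [q [E q0]] := @dyadic_len_dvd (dyadic_at s x) I sI.
have s0 : (0 : R) < 2%:R ^ s by rewrite exprz_gt0.
have -> : dyadic_corner R (dyadic_at s x) i =
   (Num.floor (x ord0 i / 2%:R ^ s))%:~R * 2%:R ^ s by rewrite /dyadic_corner mxE.
have -> : x ord0 i = ((I.2 ord0 i + (e i)%:R) * q%:Z)%:~R * 2%:R ^ s.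
  rewrite xE /dyadic_corner E /dyadic_len /= intrM intrD mulrA mulrA -mulrDl.
  by rewrite natz -!pmulrn -[in LHS]mulrDl.
by rewrite mulfK ?gt_eqF // intrKfloor.
Qed.

(** Whatever the large cubes are, their skeleta lie in those of the boundedly many
    grid cubes of side [2 ^ s] near the ball. *)
Lemma hausdorff_measure_large_skeleton_le (C : set (dyadic n)) (xi : 'rV[R]_n) (r : R) (s : int) :
  2%:R ^ s <= r -> r <= 2%:R * 2%:R ^ s ->
  (forall I, C I -> s <= I.1) ->
  (hausdorff_measure d (cball xi r `&` @dyadic_skeleton R n d C) <=
    ((packing_number n (2%:R * n.+1%:R : R))%:R * ((4 ^ n)%:R * (n%:R * r) ^+ d))%:E)%E.
Proof.
move=> sr rs sC.
have s0 : (0 : R) < 2%:R ^ s by rewrite exprz_gt0.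
pose A := [set J : dyadic n | J.1 = s /\ edistance xi (dyadic_corner_pt J) <= n.+1%:R * r].
have packA (l : seq (dyadic n)) : uniq l -> (forall a, a \in l -> A a) ->
    (size l <= packing_number n (2%:R * n.+1%:R : R))%N.
  move=> ul lA; apply: (@packing R n _ l dyadic_corner_pt xi (2%:R ^ s)) => //.
    move=> a b /lA[a1 _] /lA[b1 _] ab; apply: dyadic_corner_separated.
    - by rewrite /dyadic_len a1.
    - by rewrite /dyadic_len b1.
    - move=> [x [ax bx]]; move/eqP: ab; apply.
      by apply: dyadic_eq ax bx; rewrite a1 b1.
  move=> a /lA[_ h]; apply: (le_trans h).
  by rewrite -mulrA mulrCA ler_wpM2l.
have finA : finite_set A by apply: finite_of_packing packA.
apply: (le_trans (@hausdorff_measure_le_sum R n d d_gt0 _ (fset_set A) (@skeleton R n d)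
  (fun=> (4 ^ n)%:R * (n%:R * r) ^+ d) _ _ _)).
- move=> x [xr [I CI Ix]]; exists (dyadic_at s x); last by apply: skeleton_dyadic_at Ix; exact: sC.
  apply/fset_setP => //; split => //=.
  apply: (le_trans (edistance_triangle x _ _)); rewrite -natr1 mulrDl mul1r addrC.
  apply: lerD => //; apply: (@le_trans _ _ (n%:R * 2%:R ^ s)); last by rewrite ler_wpM2l.
  apply: (@dyadic_hull_edistance (dyadic_at s x)); apply: dyadic_set_hull.
    exact: mem_dyadic_at.
  exact: mem_dyadic_corner_pt.
- move=> J /(fset_setP _ finA) [J1 _].
  apply: (le_trans (hausdorff_measure_skeleton_le J)); rewrite lee_fin ler_wpM2l //.
  have r0 : 0 <= r by apply: le_trans sr; exact: ltW.
  have Jr : dyadic_len R J <= r by rewrite /dyadic_len J1.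
  by rewrite lerXn2r ?nnegrE ?mulr_ge0 ?dyadic_len_ge0 // ler_wpM2l.
- rewrite lee_fin; apply: big_seq_le_size => //.
    by rewrite mulr_ge0 // exprn_ge0 // mulr_ge0 // (le_trans (ltW s0) sr).
  rewrite filter_predT; apply: packA; first exact: fset_uniq.
  by move=> a /(fset_setP _ finA).
Qed.

End Skeleton.
End Dyadic.

(** By Bernoulli's inequality the powers of [q] are unbounded. *)
Lemma integer_log (R : realType) (q b : R) : 1 < q -> 0 < b ->
  exists k : int, q ^ k <= b /\ b < q ^ (k + 1).
Proof.
move=> q1 b0; have q0 : 0 < q by apply: lt_trans q1.
have big (a : R) : exists N : nat, a < q ^+ N.
  have bern N : 1 + N%:R * (q - 1) <= q ^+ N.
    elim: N => [|N IH]; first by rewrite mul0r addr0 expr0.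
    rewrite exprS; apply: (@le_trans _ _ (q * (1 + N%:R * (q - 1)))).
      rewrite -natr1; have : 0 <= N%:R * (q - 1) * (q - 1) by rewrite !mulr_ge0 // subr_ge0 ltW.
      nra.
    by rewrite ler_pM2l.
  exists (Num.truncn (a / (q - 1))).+1; apply: lt_le_trans (bern _).
  have : a / (q - 1) < (Num.truncn (a / (q - 1))).+1%:R by exact: truncnS_gt.
  by rewrite ltr_pdivrMr ?subr_gt0 // => h; apply: lt_trans h _; rewrite ltrDr.
have [N0 hN0] := big b^-1; have [N1 hN1] := big b.
have low : q ^ (- N0%:Z) <= b.
  by rewrite -exprz_inv -exprnP exprVn -[b]invrK lef_pV2 ?posrE ?exprn_gt0 ?invr_gt0 // ltW.
have ex : exists j : nat, b < q ^ (- N0%:Z + j%:Z + 1).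
  exists (N0 + N1)%N; apply: (lt_le_trans hN1); rewrite -[leLHS]/(q ^ N1%:Z).
  rewrite ler_weXz2l ?(ltW q1) //; lia.
case: (ex_minnP ex) => j hj minj; exists (- N0%:Z + j%:Z); split => //.
case: j hj minj => [|j] hj minj; first by rewrite addr0.
rewrite leNgt; apply/negP => h; have := minj j; rewrite ltnn => H.
suff : (j.+1 <= j)%N by rewrite ltnn.
by apply: minj; have -> : - N0%:Z + j%:Z + 1 = - N0%:Z + j.+1%:Z by lia.
Qed.
(** * Christ-David cubes *)

Section Cubes.
Variables (R : realType) (n : nat) (rho : R) (E : set 'rV[R]_n).
Variables (X : int -> set 'rV[R]_n) (D : set (gcube R n)) (zeta : gcube R n -> 'rV[R]_n).
Hypotheses (rho_gt0 : 0 < rho) (rho_small : rho < 1000%:R^-1).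
Hypothesis CD : christ_david rho E X D zeta.
Implicit Types (P Q : gcube R n).
Local Notation gen := (@generation R n).
Local Notation ell := (cube_len rho).
Local Notation c0 := (c_cube R).

Lemma c_cube_gt0 : 0 < c0. Proof. rewrite /c_cube invr_gt0; exact: ltr0Sn. Qed.

Lemma cube_len_gt0 Q : 0 < ell Q.
Proof. by rewrite /cube_len mulr_gt0 // exprz_gt0. Qed.

Lemma cube_len_ge0 Q : 0 <= ell Q. Proof. exact: ltW (cube_len_gt0 Q). Qed.

Lemma rho_lt1 : rho < 1. Proof.
apply: lt_trans rho_small _; rewrite invf_lt1; last exact: ltr0Sn.
by rewrite ltr1n.
Qed.

Lemma cube_len_succ Q Q' : gen Q' = gen Q + 1 -> ell Q' = rho * ell Q.
Proof.
rewrite /cube_len => ->; rewrite expfzDr ?gt_eqF // expr1z; ring.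
Qed.

Lemma cube_len_le Q Q' : (ell Q' <= ell Q) = (gen Q <= gen Q').
Proof.
have H (k : int) : rho ^ k = rho^-1 ^ (- k) by rewrite exprz_inv opprK.
rewrite /cube_len ler_pM2l ?ltr0Sn // !H ler_eXz2l ?lerN2 //.
by rewrite invf_gt1 // rho_lt1.
Qed.

Lemma cube_sub Q x : D Q -> cube_set Q x -> E x.
Proof. by move=> DQ; have [B _ ->] := cd_borel CD DQ; case. Qed.

Lemma center_net Q : D Q -> X (gen Q) (zeta Q).
Proof. by move=> DQ; rewrite (cd_centers CD); exists Q. Qed.

Lemma center_in_E Q : D Q -> E (zeta Q).
Proof. by move=> DQ; have [[+ _] _] := cd_net CD (gen Q); apply; exact: center_net. Qed.

Lemma cube_inner Q x : D Q -> E x -> edistance (zeta Q) x <= c0 * ell Q -> cube_set Q x.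
Proof. by move=> DQ Ex xQ; apply: (cd_inner CD DQ). Qed.

Lemma cube_outer Q x : D Q -> cube_set Q x -> edistance (zeta Q) x <= ell Q.
Proof. by move=> DQ Qx; exact: (cd_outer CD DQ). Qed.

Lemma center_in_cube Q : D Q -> cube_set Q (zeta Q).
Proof.
move=> DQ; apply: cube_inner => //; first exact: center_in_E.
by rewrite edistancexx mulr_ge0 ?(ltW c_cube_gt0) // cube_len_ge0.
Qed.

Lemma cube_diam Q x y : D Q -> cube_set Q x -> cube_set Q y -> edistance x y <= 2%:R * ell Q.
Proof.
move=> DQ Qx Qy; apply: (le_trans (edistance_triangle (zeta Q) _ _)).
rewrite edistanceC; have := cube_outer DQ Qx; have := cube_outer DQ Qy; lra.
Qed.

Lemma cube_nested P Q x : D P -> D Q -> gen P <= gen Q -> cube_set P x -> cube_set Q x ->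
  subcube Q P.
Proof. by move=> DP DQ g Px Qx; apply: (cd_nested CD) => //; exists x. Qed.

Lemma cube_eq P Q x : D P -> D Q -> gen P = gen Q -> cube_set P x -> cube_set Q x -> P = Q.
Proof.
move=> DP DQ g Px Qx.
have [_ h1] : subcube Q P by apply: cube_nested Px Qx => //; rewrite g.
have [_ h2] : subcube P Q by apply: cube_nested Qx Px => //; rewrite g.
case: P Q g h1 h2 {DP DQ Px Qx} => [k A] [k' B]; rewrite /generation /cube_set /= => -> h1 h2.
by congr (_, _); apply/seteqP.
Qed.

Lemma subcube_eq P Q : D P -> D Q -> subcube P Q -> gen P = gen Q -> P = Q.
Proof.
move=> DP DQ [_ PQ] g; apply: (@cube_eq _ _ (zeta P)) => //; first exact: center_in_cube.
by apply: PQ; exact: center_in_cube.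
Qed.

Lemma cube_at (k : int) x : E x -> exists Q, [/\ D Q, gen Q = k & cube_set Q x].
Proof.
by rewrite -(cd_cover CD k) => -[Q [DQ gQ] Qx]; exists Q.
Qed.

Lemma ancestor Q (k : int) : D Q -> k <= gen Q ->
  exists P, [/\ D P, gen P = k & subcube Q P].
Proof.
move=> DQ kQ; have [P [DP gP Px]] := cube_at k (center_in_E DQ).
exists P; split => //; apply: cube_nested Px (center_in_cube DQ) => //.
by rewrite gP.
Qed.

Lemma centers_separated P Q : D P -> D Q -> gen P = gen Q -> P <> Q ->
  rho ^ gen Q <= edistance (zeta P) (zeta Q).
Proof.
move=> DP DQ g PQ; have [[_ sep] _] := cd_net CD (gen Q).
apply: sep; [by rewrite -g; exact: center_net|exact: center_net|].
move=> zE; apply: PQ; apply: cube_eq g (center_in_cube DP) _ => //.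
by rewrite zE; exact: center_in_cube.
Qed.

Lemma packing_cubes (r : seq (gcube R n)) (k : int) (x : 'rV[R]_n) (L : R) : uniq r ->
  (forall Q, Q \in r -> [/\ D Q, gen Q = k & edistance x (zeta Q) <= L * rho ^ k]) ->
  (size r <= packing_number n L)%N.
Proof.
move=> ur H; apply: (@packing R n _ r zeta x (rho ^ k)) => //.
- by rewrite exprz_gt0.
- move=> P Q /H[DP gP _] /H[DQ gQ _] /eqP PQ.
  by rewrite -gQ; apply: centers_separated => //; rewrite gP gQ.
- by move=> Q /H[].
Qed.

Lemma finite_children Q : D Q -> finite_set (child D Q).
Proof.
move=> DQ; apply: (@finite_of_packing _ _ (packing_number n (5%:R / rho))) => r ur rQ.
apply: (@packing_cubes r (gen Q + 1) (zeta Q)) => // P /rQ[DP gP PQ]; split => //.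
have -> : 5%:R / rho * rho ^ (gen Q + 1) = ell Q.
  by rewrite /cube_len expfzDr ?gt_eqF // expr1z; field; rewrite gt_eqF.
by apply: cube_outer => //; apply: PQ; exact: center_in_cube.
Qed.

Definition children Q : {fset gcube R n} := fset_set (child D Q).

Lemma childrenP Q P : D Q -> reflect (child D Q P) (P \in children Q).
Proof. by move=> DQ; apply: fset_setP; exact: finite_children. Qed.

Lemma child_subcube Q P : child D Q P -> subcube P Q.
Proof. by move=> [_ gP PQ]; split => //; rewrite gP lerDl. Qed.

Lemma child_at Q x : D Q -> cube_set Q x -> exists2 P, child D Q P & cube_set P x.
Proof.
move=> DQ Qx; have [P [DP gP Px]] := cube_at (gen Q + 1) (cube_sub DQ Qx).
exists P => //; split => //.
have [//|] := @cube_nested Q P x DQ DP _ Qx Px; by rewrite gP lerDl.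
Qed.

Lemma central_child Q : D Q -> exists2 P, child D Q P & zeta P = zeta Q.
Proof.
move=> DQ; have := cd_net_nested CD (center_net DQ).
rewrite (cd_centers CD) => -[P [DP gP] zE]; exists P => //; split => //.
have gPQ : gen Q <= gen P by rewrite gP lerDl.
have Pz : cube_set P (zeta Q) by rewrite -zE; exact: center_in_cube.
by have [] := cube_nested DQ DP gPQ (center_in_cube DQ) Pz.
Qed.

Lemma child_of Q : D Q -> exists2 P, D P & child D P Q.
Proof.
move=> DQ; have [|P [DP gP [_ QP]]] := @ancestor Q (gen Q - 1) DQ; first by rewrite gerBl.
by exists P => //; split => //; rewrite gP subrK.
Qed.

(** Otherwise [E] lies in the inner ball of the cube. *)
Lemma cube_len_le_diameter Q : D Q -> ~ (E `<=` cube_set Q) ->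
  ((c0 * ell Q)%:E <= diameter E)%E.
Proof.
move=> DQ nE; rewrite leNgt; apply/negP => lt; apply: nE => x Ex.
apply: cube_inner => //; rewrite -lee_fin; apply: le_trans (ltW lt).
by apply: edistance_le_diameter => //; exact: center_in_E.
Qed.

Lemma half_core_lt_diameter Q : ((c0 * ell Q)%:E <= diameter E)%E ->
  ((c0 * ell Q / 2%:R)%:E < diameter E)%E.
Proof.
move=> h; apply: lt_le_trans h; rewrite lte_fin.
have := mulr_gt0 c_cube_gt0 (cube_len_gt0 Q); lra.
Qed.

(** * The mass of a cube *)

Section Mass.
Variables (d : nat) (c : R) (k0 : nat) (Q0 : gcube R n).
Hypotheses (d_gt0 : (0 < d)%N) (c_gt0 : 0 < c).
Hypothesis reg : lower_content_regular d c E.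
Hypotheses (DQ0 : D Q0) (gQ0 : gen Q0 = 0).

(** The mass that the cubes of the last generation send up, a cube that would
    receive more than twice the [d]-th power of its length being reset to that
    power. *)
Fixpoint mass_rec (j : nat) Q : R :=
  if j is j'.+1 then
    let m := \sum_(P <- children Q) mass_rec j' P in
    if m <= 2%:R * ell Q ^+ d then m else ell Q ^+ d
  else ell Q ^+ d.

Definition mass Q : R := mass_rec (absz (k0%:Z - gen Q)) Q.

Definition cut Q : Prop :=
  gen Q < k0%:Z /\ 2%:R * ell Q ^+ d < \sum_(P <- children Q) mass P.

Lemma mass_bottom Q : gen Q = k0%:Z -> mass Q = ell Q ^+ d.
Proof. by move=> gQ; rewrite /mass gQ subrr. Qed.

Lemma mass_recS Q : D Q -> gen Q < k0%:Z ->
  mass Q = if \sum_(P <- children Q) mass P <= 2%:R * ell Q ^+ d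
           then \sum_(P <- children Q) mass P else ell Q ^+ d.
Proof.
move=> DQ gQ; rewrite {1}/mass.
have -> : absz (k0%:Z - gen Q) = (absz (k0%:Z - (gen Q + 1))%R).+1 by lia.
rewrite /=; congr (if (_ <= _) then _ else _); rewrite big_seq [RHS]big_seq;
by apply: eq_bigr => P /(childrenP _ DQ) [_ gP _]; rewrite /mass gP.
Qed.

Lemma mass_uncut Q : D Q -> gen Q < k0%:Z -> ~ cut Q -> mass Q = \sum_(P <- children Q) mass P.
Proof.
move=> DQ gQ nc; rewrite mass_recS //; case: leP => // lt; by case: nc.
Qed.

Lemma mass_cut Q : D Q -> cut Q -> mass Q = ell Q ^+ d.
Proof. by move=> DQ [gQ lt]; rewrite mass_recS // leNgt lt. Qed.

Lemma mass_rec_ge0 j Q : 0 <= mass_rec j Q.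
Proof.
have l0 P : 0 <= ell P ^+ d by rewrite exprn_ge0 // cube_len_ge0.
elim: j Q => [|j IH] Q //=; case: ifP => // _; apply: sumr_ge0 => P _; exact: IH.
Qed.

Lemma mass_ge0 Q : 0 <= mass Q. Proof. exact: mass_rec_ge0. Qed.

Lemma mass_le Q : mass Q <= 2%:R * ell Q ^+ d.
Proof.
have l0 P : 0 <= ell P ^+ d by rewrite exprn_ge0 // cube_len_ge0.
rewrite /mass; case: `|_|%N => [|j] /=; first by have := l0 Q; lra.
by case: ifP => // _; have := l0 Q; lra.
Qed.

Lemma gen_ind (Phi : gcube R n -> Prop) :
  (forall Q, D Q -> gen Q = k0%:Z -> Phi Q) ->
  (forall Q, D Q -> gen Q < k0%:Z -> (forall P, child D Q P -> Phi P) -> Phi Q) ->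
  forall Q, D Q -> gen Q <= k0%:Z -> Phi Q.
Proof.
move=> H0 HS Q; have [j] := ubnP (absz (k0%:Z - gen Q)).
elim: j Q => // j IH Q lej DQ gQ.
have [lt|ge] := ltP (gen Q) k0%:Z; last by apply: H0 => //; apply/eqP; rewrite eq_le gQ.
apply: HS => // P [DP gP PQ]; apply: IH => //; lia.
Qed.

(** The cubes at which the mass starts or is reset cover the cube. *)
Lemma content_le_mass Q : D Q -> gen Q <= k0%:Z ->
  (hausdorff_content d (cube_set Q) <= (2%:R ^+ d * mass Q)%:E)%E.
Proof.
have base Q' : D Q' -> (hausdorff_content d (cube_set Q') <= (2%:R ^+ d * ell Q' ^+ d)%:E)%E.
  move=> DQ; apply: (le_trans (hausdorff_delta_le_diameter d_gt0 _)); first exact: leey.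
  rewrite -exprMn EFin_expe; apply: lee_expe_ge0; first exact: diameter_ge0.
  apply: diameter_le; first by rewrite lee_fin mulr_ge0 // cube_len_ge0.
  by move=> x y Qx Qy; rewrite lee_fin; exact: cube_diam Qx Qy.
move: Q; apply: gen_ind => Q DQ gQ; first by rewrite mass_bottom //; exact: base.
move=> IH; have [ct|nc] := pselect (cut Q); first by rewrite mass_cut //; exact: base.
rewrite mass_uncut // mulr_sumr -sumEFin.
apply: (le_trans (@hausdorff_delta_le_sum R n d d_gt0 _ (children Q) (@cube_set R n) +oo%E _ _ _)).
- exact: leey.
- move=> x /(child_at DQ) [P PQ Px]; exists P => //; exact/childrenP.
- rewrite big_seq [leRHS]big_seq; apply: lee_sum => P /(childrenP _ DQ); exact: IH.
Qed.

Lemma core_content_ge Q : D Q -> ((c0 * ell Q / 2%:R)%:E < diameter E)%E ->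
  ((c * (c0 * ell Q / 2%:R) ^+ d)%:E <=
    hausdorff_content d (E `&` cball (zeta Q) (c0 * ell Q / 2%:R)))%E.
Proof.
move=> DQ lt; apply: reg => //; first exact: center_in_E.
by rewrite divr_gt0 // mulr_gt0 ?c_cube_gt0 // cube_len_gt0.
Qed.

(** The inner half ball of a cube has content at least [c (c0 l / 2) ^ d], while
    the cubes that cover it have diameter at most twice their length. *)
Definition mass_constant : R := c * (c0 / 4%:R) ^+ d.

Lemma mass_constant_gt0 : 0 < mass_constant.
Proof. by rewrite /mass_constant mulr_gt0 // exprn_gt0 // divr_gt0 // c_cube_gt0. Qed.

Lemma mass_ge Q : D Q -> gen Q <= k0%:Z -> ((c0 * ell Q / 2%:R)%:E < diameter E)%E ->
  mass_constant * ell Q ^+ d <= mass Q.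
Proof.
move=> DQ gQ lt; have h := core_content_ge DQ lt.
have : ((c * (c0 * ell Q / 2%:R) ^+ d)%:E <= (2%:R ^+ d * mass Q)%:E)%E.
  apply: (le_trans h); apply: le_trans (content_le_mass DQ gQ).
  apply: hausdorff_delta_subset => x [Ex xB]; apply: cube_inner => //.
  apply: (le_trans xB); have := mulr_gt0 c_cube_gt0 (cube_len_gt0 Q); lra.
have -> : c * (c0 * ell Q / 2%:R) ^+ d = mass_constant * ell Q ^+ d * 2%:R ^+ d.
  have -> : c0 * ell Q / 2%:R = c0 / 4%:R * ell Q * 2%:R by field.
  by rewrite /mass_constant !exprMn !mulrA.
by rewrite lee_fin [leRHS]mulrC ler_pM2r ?exprn_gt0.
Qed.

(** Unlike the cubes themselves, the cores of different cubes of one generation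
    are at distance more than [delta], so that [hausdorff_delta] adds up. *)
Definition core (delta : R) Q : set 'rV[R]_n :=
  [set x | cube_set Q x /\ forall y, E y -> edistance x y <= delta -> cube_set Q y].

Fixpoint bottom_rec (j : nat) Q : R :=
  if j is j'.+1 then \sum_(P <- children Q) bottom_rec j' P else ell Q ^+ d.

Definition bottom_sum Q : R := bottom_rec (absz (k0%:Z - gen Q)) Q.

Lemma bottom_sum_bottom Q : gen Q = k0%:Z -> bottom_sum Q = ell Q ^+ d.
Proof. by move=> gQ; rewrite /bottom_sum gQ subrr. Qed.

Lemma bottom_sumS Q : D Q -> gen Q < k0%:Z ->
  bottom_sum Q = \sum_(P <- children Q) bottom_sum P.
Proof.
move=> DQ gQ; rewrite {1}/bottom_sum.
have -> : absz (k0%:Z - gen Q) = (absz (k0%:Z - (gen Q + 1))%R).+1 by lia.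
rewrite /= big_seq [RHS]big_seq; apply: eq_bigr => P /(childrenP _ DQ) [_ gP _].
by rewrite /bottom_sum gP.
Qed.

Lemma children_disjoint Q P P' x : D Q -> P \in children Q -> P' \in children Q ->
  cube_set P x -> cube_set P' x -> P = P'.
Proof.
move=> DQ /(childrenP _ DQ) [DP gP _] /(childrenP _ DQ) [DP' gP' _].
by apply: cube_eq => //; rewrite gP gP'.
Qed.

(** At the last generation the core contains the inner half ball, whose content is
    bounded below. *)
Lemma bottom_sum_le_measure Q : D Q -> gen Q <= k0%:Z ->
  ((c0 * (5%:R * rho ^ k0%:Z))%:E <= diameter E)%E ->
  ((c * (c0 / 2%:R) ^+ d * bottom_sum Q)%:E <= hausdorff_measure d (cube_set Q))%E.
Proof.
move=> DQ gQ big.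
set delta : R := c0 * (5%:R * rho ^ k0%:Z) / 2%:R.
have delta0 : 0 < delta by rewrite divr_gt0 // mulr_gt0 ?c_cube_gt0 // mulr_gt0 // exprz_gt0.
apply: (@le_trans _ _ (hausdorff_delta d delta%:E (core delta Q))); last first.
  apply: le_trans (hausdorff_delta_le_measure _ _ delta0) _.
  by apply: hausdorff_measure_subset => x [].
move: Q DQ gQ; apply: gen_ind => Q DQ gQ.
  have lE : ell Q = 5%:R * rho ^ k0%:Z by rewrite /cube_len gQ.
  rewrite bottom_sum_bottom // -mulrA -exprMn.
  have -> : c0 / 2%:R * ell Q = c0 * ell Q / 2%:R by field.
  apply: le_trans (hausdorff_content_le_delta _ _ _).
  apply: le_trans (core_content_ge DQ _) _.
    by apply: half_core_lt_diameter; rewrite lE.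
  have dl : delta = c0 * ell Q / 2%:R by rewrite /delta lE.
  apply: hausdorff_delta_subset => x [Ex xB]; split.
    apply: cube_inner => //; apply: (le_trans xB); rewrite -dl; lra.
  move=> y Ey xy; apply: cube_inner => //.
  apply: (le_trans (edistance_triangle x _ _)); rewrite /cball /= in xB; rewrite dl in xy; lra.
move=> IH; rewrite bottom_sumS // mulr_sumr -sumEFin.
apply: (@le_trans _ _ (\sum_(P <- children Q) hausdorff_delta d delta%:E (core delta P))%E).
  rewrite big_seq [leRHS]big_seq; apply: lee_sum => P /(childrenP _ DQ); exact: IH.
apply: hausdorff_delta_sum_separated => //.
- exact: ltW.
- move=> P P' x y PQ P'Q /eqP PP' [Px cx] [P'y cy]; rewrite ltNge; apply/negP => xy.
  apply: PP'; apply: (@children_disjoint Q _ _ y) => //; apply: cx => //.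
  by move/(childrenP _ DQ): P'Q => [DP' _ _]; exact: cube_sub P'y.
- move=> P /(childrenP _ DQ) [DP gP PQ] x [Px cx]; split; first exact: PQ.
  by move=> y Ey xy; apply: PQ; exact: cx.
Qed.


(** * Trees and the packing of their tops *)

Lemma subcube_refl Q : subcube Q Q. Proof. by split. Qed.

Lemma subcube_trans Q P P' : subcube P Q -> subcube Q P' -> subcube P P'.
Proof.
move=> [g1 s1] [g2 s2]; split; [exact: le_trans g2 g1|exact: subset_trans s1 s2].
Qed.

Lemma subcube_center P Q : D P -> subcube P Q -> cube_set Q (zeta P).
Proof. by move=> DP [_]; apply; exact: center_in_cube. Qed.

Lemma subcube_ltgen P Q : D P -> D Q -> subcube P Q -> P <> Q -> gen Q < gen P.
Proof.
move=> DP DQ PQ nPQ; have [g _] := PQ; rewrite lt_neqAle g andbT.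
by apply/eqP => gE; apply: nPQ; apply: subcube_eq.
Qed.

Lemma subcube_anti P Q : D P -> D Q -> subcube P Q -> subcube Q P -> P = Q.
Proof. by move=> DP DQ [g1 s1] [g2 s2]; apply: subcube_eq => //; apply/eqP; rewrite eq_le g1 g2. Qed.

Lemma subcube_parent P Q P' : D P -> D P' -> child D P Q -> subcube Q P' -> P' <> Q ->
  subcube P P'.
Proof.
move=> DP DP' CQ QP' nP'; have [DQ gQ QP] := CQ.
have lt : gen P' < gen Q by apply: subcube_ltgen => // /esym.
have le : gen P' <= gen P by lia.
by apply: cube_nested le (subcube_center DQ QP') (subcube_center DQ (child_subcube CQ)).
Qed.

Lemma subcube_child P Q : D P -> D Q -> subcube P Q -> P <> Q ->
  exists2 C, child D Q C & subcube P C.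
Proof.
move=> DP DQ PQ nPQ; have lt := subcube_ltgen DP DQ PQ nPQ.
have [C CC Cz] := child_at DQ (subcube_center DP PQ); exists C => //.
have [DC gC _] := CC; apply: cube_nested Cz (center_in_cube DP) => //.
by lia.
Qed.

Local Notation S := (cubes_upto D Q0 k0).

(** The cubes that are reached from the top without passing below a cut cube. *)
Definition tree (Q : gcube R n) : set (gcube R n) :=
  [set P | [/\ S P, subcube P Q &
     forall P', D P' -> cut P' -> subcube P P' -> subcube P' Q -> P' = P]].

Definition tops : set (gcube R n) :=
  [set Q | S Q /\ (Q = Q0 \/ exists2 P, D P & cut P /\ child D P Q)].

Lemma upto_Q0 : S Q0. Proof. by split => //; rewrite gQ0. Qed.

Lemma upto_between P Q : D P -> S Q -> subcube Q P -> 0 <= gen P ->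
  S P.
Proof.
move=> DP [DQ gQ gQk QQ0] QP g0; split => //; first by apply: le_trans gQk; case: QP.
have h : gen Q0 <= gen P by rewrite gQ0.
have := cube_nested DQ0 DP h (QQ0 _ (center_in_cube DQ)) (subcube_center DQ QP).
by case.
Qed.

Lemma upto_child P Q : D P -> gen P < k0%:Z -> S P -> child D P Q -> S Q.
Proof.
move=> DP gP [_ gP0 _ PQ0] [DQ gQ QP]; split => //; last exact: subset_trans PQ0.
- by rewrite gQ addr_ge0.
- by lia.
Qed.

Lemma tree_top Q : S Q -> tree Q Q.
Proof.
move=> SQ; have [DQ _ _ _] := SQ; split => //; first exact: subcube_refl.
by move=> P' DP' _ h1 h2; apply: subcube_anti.
Qed.

Lemma tree_region Q : S Q -> stopping_time_region D (tree Q) Q.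
Proof.
move=> SQ; have [DQ gQ _ _] := SQ; split.
- by move=> P [[]].
- exact: tree_top.
- by move=> P [].
- move=> P P' [SP PQ nc] DP' PP' P'Q.
  have SP' : S P'.
    by apply: upto_between SP PP' _ => //; case: P'Q => + _; exact: le_trans.
  split => // P'' DP'' ct h1 h2.
  have EP := nc _ DP'' ct (subcube_trans PP' h1) h2.
  have [DP _ _ _] := SP; rewrite EP in h1 *; exact: subcube_anti.
- move=> P [SP PQ nc] [C CC nTC] C' CC' [SC' C'Q nc'].
  have [DP gP gPk _] := SP.
  have gPk' : gen P < k0%:Z.
    by have [_ _ g _] := SC'; have [_ gC' _] := CC'; lia.
  have SC : S C by apply: upto_child CC.
  apply: nTC; split => //; first exact: subcube_trans (child_subcube CC) PQ.
  move=> P' DP' ct CP' P'Q; apply: contrapT => P'C.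
  have PP' := subcube_parent DP DP' CC CP' P'C.
  have P'P := nc _ DP' ct PP' P'Q.
  rewrite P'P in ct.
  have PE := nc' _ DP ct (child_subcube CC') PQ.
  by have [_ g _] := CC'; rewrite -PE in g; lia.
Qed.

Lemma tree_cover Q : S Q -> exists2 P, tops P & tree P Q.
Proof.
move=> SQ; have [j] := ubnP (absz (gen Q)); elim: j Q SQ => // j IH Q SQ lej.
have [DQ gQ gQk QQ0] := SQ.
have [/eqP g0|g0] := boolP (gen Q == 0).
  have -> : Q = Q0 by apply: subcube_eq => //; [split => //; rewrite gQ0 g0|rewrite g0].
  exists Q0; last exact: tree_top upto_Q0.
  by split; [exact: upto_Q0|left].
have [P DP CQ] := child_of DQ; have [_ gP QP] := CQ.
have gP0 : 0 <= gen P by lia.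
have SP : S P by apply: upto_between SQ (child_subcube CQ) gP0.
have [ct|nc] := pselect (cut P).
  exists Q; last exact: tree_top.
  by split => //; right; exists P.
have [|T TT [_ PT ncT]] := IH P SP; first by lia.
exists T => //; split => //; first exact: subcube_trans (child_subcube CQ) PT.
move=> P' DP' ct QP' P'T; apply: contrapT => nP'.
by apply: nc; rewrite -(ncT _ DP' ct (subcube_parent DP DP' CQ QP' nP') P'T).
Qed.

Lemma tree_disjoint Q P P' : tops P -> tops P' -> tree P Q -> tree P' Q -> P = P'.
Proof.
wlog le : P P' / gen P <= gen P'.
  move=> H TP TP' h h'; have [/H|/ltW/H] := leP (gen P) (gen P'); first exact.
  by move=> /(_ TP' TP h' h).
move=> [SP _] [SP' tP'] [SQ QP ncP] [_ QP' ncP'].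
have [DP gP0 _ _] := SP; have [DP' _ _ _] := SP'; have [DQ _ _ _] := SQ.
have P'P := cube_nested DP DP' le (subcube_center DQ QP) (subcube_center DQ QP').
apply: contrapT => nPP'.
have lt : gen P < gen P' by apply: subcube_ltgen => // /esym.
case: tP' => [QE|[C DC [ct CC]]].
  by move: lt; rewrite QE gQ0 ltNge gP0.
have CP : subcube C P by apply: subcube_parent P'P _.
have PE := ncP _ DC ct (subcube_trans QP' (child_subcube CC)) CP.
have [_ g _] := CC; have [g' _] := QP'; move: g'; rewrite g -PE; lia.
Qed.

Lemma tree_partition_tops : tree_partition D S tops tree.
Proof.
split.
- by move=> Q [].
- by move=> Q [SQ _]; exact: tree_region.
- move=> P P' TP TP' [Q [h h']]; exact: tree_disjoint h h'.
- apply/seteqP; split; first by move=> Q [P _ []].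
  by move=> Q /tree_cover [P TP tP]; exists P.
Qed.

(** Resetting the mass at a cut cube destroys at least half of the mass of its
    children, which is comparable to the new tops; the mass lost in total is at
    most the initial one. *)
Lemma tops_sum_below Q : ((c0 * ell Q0)%:E <= diameter E)%E ->
  D Q -> gen Q <= k0%:Z -> S Q -> forall r, uniq r ->
  (forall P, P \in r -> [/\ tops P, subcube P Q & P <> Q]) ->
  \sum_(P <- r) ell P ^+ d <= 2%:R / mass_constant * (bottom_sum Q - mass Q).
Proof.
move=> big0; have m0 := mass_constant_gt0.
have m_ge P : S P -> ell P ^+ d <= mass P / mass_constant.
  move=> [DP gP gPk PQ0]; rewrite ler_pdivlMr // mulrC; apply: mass_ge => //.
  apply: half_core_lt_diameter; apply: le_trans big0.
  by rewrite lee_fin ler_wpM2l ?(ltW c_cube_gt0) // cube_len_le gQ0.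
move: Q; apply: gen_ind => Q DQ gQ.
  move=> SQ r ur rQ; rewrite bottom_sum_bottom // mass_bottom // subrr mulr0.
  case: r ur rQ => [|P r] _ rQ; first by rewrite big_nil.
  have [[[DP _ gP _] _] PQ nPQ] := rQ P (mem_head _ _).
  by have := subcube_ltgen DP DQ PQ nPQ; rewrite gQ ltNge gP.
move=> IH SQ r ur rQ.
have SC C : child D Q C -> S C by move=> CC; apply: upto_child CC.
have below C : C \in children Q ->
    \sum_(P <- r | `[< subcube P C >]) ell P ^+ d <=
    (if `[< tops C >] then ell C ^+ d else 0) +
      2%:R / mass_constant * (bottom_sum C - mass C).
  move=> /(childrenP _ DQ) CC; have [DC gC _] := CC.
  rewrite -big_filter; set r' := [seq P <- r | _].
  have ur' : uniq r' by rewrite filter_uniq.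
  have r'C P : P \in r' -> tops P /\ subcube P C.
    by rewrite mem_filter => /andP[/asboolP PC /rQ[tP _ _]].
  have IHC : \sum_(P <- [seq P <- r' | P != C]) ell P ^+ d <=
      2%:R / mass_constant * (bottom_sum C - mass C).
    apply: IH => //; [exact: SC|by rewrite filter_uniq|].
    by move=> P; rewrite mem_filter => /andP[/eqP PC /r'C[tP sP]].
  have [Cr|Cr] := boolP (C \in r').
    have [tC _] := r'C _ Cr; rewrite asboolT //.
    rewrite (bigD1_seq C) //= lerD2l.
    by rewrite -big_filter.
  apply: (@le_trans _ _ (2%:R / mass_constant * (bottom_sum C - mass C))).
    have rE : [seq P <- r' | P != C] = r'.
      by apply/all_filterP/allP => P Pr; apply: contraNneq Cr => <-.
    by rewrite rE in IHC.
  by rewrite lerDr; case: ifP => // _; rewrite exprn_ge0 // cube_len_ge0.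
apply: (le_trans (@big_seq_le_cover R _ _ r (children Q) (fun C P => `[< subcube P C >]) _ _ _)).
- by move=> P _; rewrite exprn_ge0 // cube_len_ge0.
- move=> P /rQ[[[DP _ _ _] _] PQ nPQ].
  have [C CC PC] := subcube_child DP DQ PQ nPQ.
  by exists C; [exact/childrenP|exact/asboolP].
apply: (@le_trans _ _ (\sum_(C <- children Q) ((if `[< tops C >] then ell C ^+ d else 0) +
      2%:R / mass_constant * (bottom_sum C - mass C)))).
  by rewrite big_seq [leRHS]big_seq; apply: ler_sum => C; exact: below.
rewrite big_split /= -mulr_sumr sumrB -bottom_sumS //.
set M := \sum_(C <- children Q) mass C.
have [ct|nc] := pselect (cut Q).
  rewrite mass_cut //; have [_ lt] := ct; rewrite -/M in lt.
  have h : \sum_(C <- children Q) (if `[< tops C >] then ell C ^+ d else 0) <= M / mass_constant.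
    rewrite /M mulr_suml big_seq [leRHS]big_seq; apply: ler_sum => C /(childrenP _ DQ) CC.
    case: ifP => _; first exact: m_ge (SC _ CC).
    by rewrite divr_ge0 ?mass_ge0 // ltW.
  have -> : 2%:R / mass_constant * (bottom_sum Q - ell Q ^+ d) =
    M / mass_constant + 2%:R / mass_constant * (bottom_sum Q - M) +
     (M - 2%:R * ell Q ^+ d) / mass_constant by field; rewrite gt_eqF.
  by rewrite -addrA; apply: lerD => //; rewrite lerDl divr_ge0 ?subr_ge0 ?ltW.
rewrite mass_uncut // -/M big1_seq ?add0r // => C /= CC.
rewrite asboolF // => -[_ [QE|[P DP [ct CP]]]].
  move/(childrenP _ DQ): CC => [_ + _]; rewrite QE gQ0 => g.
  by have [_ g0 _ _] := SQ; lia.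
move/(childrenP _ DQ): CC => CC; have [DC gC _] := CC; have [_ gC' _] := CP.
apply: nc; have <- // : P = Q.
apply: (@cube_eq _ _ (zeta C)) => //.
- by apply: (addIr 1); rewrite -gC -gC'.
- exact: subcube_center (child_subcube CP).
- exact: subcube_center (child_subcube CC).
Qed.

Definition packing_constant : R := 2%:R / mass_constant / (c * (c0 / 2%:R) ^+ d).

Lemma packing_constant_gt0 : 0 < packing_constant.
Proof.
rewrite /packing_constant divr_gt0 ?divr_gt0 ?mass_constant_gt0 // mulr_gt0 // exprn_gt0 //.
by rewrite divr_gt0 // c_cube_gt0.
Qed.

Lemma tops_packing : ((c0 * ell Q0)%:E <= diameter E)%E ->
  (\esum_(Q in tops) (ell Q ^+ d)%:E <= packing_constant%:E * hausdorff_measure d (cube_set Q0))%E.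
Proof.
move=> big0; have m0 := mass_constant_gt0.
have SQ0 := upto_Q0; have [_ _ gk _] := SQ0.
have c1 : 0 < c * (c0 / 2%:R) ^+ d by rewrite mulr_gt0 // exprn_gt0 // divr_gt0 // c_cube_gt0.
apply: (@le_trans _ _ (2%:R / mass_constant * bottom_sum Q0)%:E).
  apply: ge_ereal_sup => _ [A [finA AT] <-].
  rewrite fsbig_finite // sumEFin lee_fin.
  set r := enum_fset (fset_set A).
  have ur : uniq r by exact: fset_uniq.
  have rT P : P \in r -> tops P by move/(fset_setP _ finA); exact: AT.
  have lt : ((c0 * ell Q0 / 2%:R)%:E < diameter E)%E by exact: half_core_lt_diameter.
  have mQ0 : ell Q0 ^+ d <= mass Q0 / mass_constant.
    by rewrite ler_pdivlMr // mulrC; apply: mass_ge.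
  have H : \sum_(P <- [seq P <- r | P != Q0]) ell P ^+ d <=
      2%:R / mass_constant * (bottom_sum Q0 - mass Q0).
    apply: tops_sum_below => //; first by rewrite filter_uniq.
    move=> P; rewrite mem_filter => /andP[/eqP nP /rT tP]; split => //.
    by case: tP => -[DP g0 _ PQ0] _; split => //; rewrite gQ0.
  have H2 : \sum_(P <- r) ell P ^+ d <= ell Q0 ^+ d + \sum_(P <- [seq P <- r | P != Q0]) ell P ^+ d.
    rewrite big_filter; have [Qr|Qr] := boolP (Q0 \in r); first by rewrite (bigD1_seq Q0).
    rewrite [in leRHS]big_seq_cond [leLHS]big_seq.
    rewrite (eq_bigl (fun P => (P \in r) && (P != Q0))) ?lerDr ?exprn_ge0 ?cube_len_ge0 //.
    by move=> P; case Pr: (P \in r) => //=; apply/esym; apply: contraNneq Qr => <-.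
  apply: (le_trans H2); apply: (le_trans (lerD mQ0 H)).
  have -> : 2%:R / mass_constant * bottom_sum Q0 =
    mass Q0 / mass_constant + 2%:R / mass_constant * (bottom_sum Q0 - mass Q0)
      + mass Q0 / mass_constant by field; rewrite gt_eqF.
  by rewrite lerDl divr_ge0 ?mass_ge0 // ltW.
have := @bottom_sum_le_measure Q0 DQ0 gk; set H := hausdorff_measure _ _ => h.
have {}h : ((c * (c0 / 2%:R) ^+ d * bottom_sum Q0)%:E <= H)%E.
  apply: h; apply: le_trans big0; rewrite lee_fin ler_wpM2l ?(ltW c_cube_gt0) //.
  by rewrite /cube_len gQ0 ler_pM2l ?ltr0Sn // expr0z exprn_ile1 // ltW // rho_lt1.
have -> : 2%:R / mass_constant * bottom_sum Q0 =
  packing_constant * (c * (c0 / 2%:R) ^+ d * bottom_sum Q0).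
  by rewrite /packing_constant mulrA divfK // gt_eqF.
by rewrite EFinM lee_pmul2l // lte_fin packing_constant_gt0.
Qed.

(** * Stopping-time regions in a tree *)

Section Region.
Variables (Rt : gcube R n) (T : set (gcube R n)) (QT : gcube R n).
Hypotheses (TR : T `<=` tree Rt) (str : stopping_time_region D T QT).
Local Notation F := (minimal_cubes T).

Lemma region_D P : T P -> D P.
Proof. by move=> TP; apply: (str_sub str). Qed.

Lemma region_gen P : T P -> gen P <= k0%:Z.
Proof. by move=> /TR [[_ _ g _] _ _]. Qed.

Lemma region_top_gen P : T P -> gen QT <= gen P.
Proof. by move=> /(str_max str) []. Qed.

Lemma minimal_region Q : F Q -> T Q. Proof. by case. Qed.

Lemma minimal_D Q : F Q -> D Q. Proof. by move=> /minimal_region; exact: region_D. Qed.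

(** A cube of the region that is not minimal has all its children in the
    region, so it is not cut and its mass is that of its children. *)
Lemma region_children P : T P -> ~ F P ->
  [/\ gen P < k0%:Z, mass P = \sum_(C <- children P) mass C &
      forall C, child D P C -> T C].
Proof.
move=> TP nF; have DP := region_D TP.
have [Q [TQ QP nQP]] : exists Q, [/\ T Q, subcube Q P & Q <> P].
  apply: contrapT => /forallNP h; apply: nF; split => // Q TQ QP.
  by apply: contrapT => nQ; apply: (h Q).
have DQ := region_D TQ.
have [C CC QC] := subcube_child DQ DP QP nQP; have [DC gC _] := CC.
have TC : T C.
  apply: (str_convex str TQ DC QC).
  exact: subcube_trans (child_subcube CC) (str_max str TP).
have gP : gen P < k0%:Z by have := region_gen TC; rewrite gC; lia.
split => //.
  apply: mass_uncut => // ct; have [_ _ nc] := TR TC; have [_ PR _] := TR TP.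
  have PC := nc P DP ct (child_subcube CC) PR.
  by rewrite PC in gC; lia.
move=> C' CC'; apply: contrapT => nC'.
by apply: (str_children str TP _ CC) => //; exists C'.
Qed.

Lemma region_minimal_at P x : T P -> cube_set P x ->
  exists Q, [/\ F Q, cube_set Q x & subcube Q P].
Proof.
move=> TP; have := TP; have := region_gen TP; have := region_D TP; move: P {TP}.
have triv P : F P -> cube_set P x -> exists Q, [/\ F Q, cube_set Q x & subcube Q P].
  by move=> FP Px; exists P; split => //; exact: subcube_refl.
move=> P DP gP; move: P DP gP.
apply: (@gen_ind (fun P => T P -> cube_set P x -> exists Q, [/\ F Q, cube_set Q x & subcube Q P])).
  move=> P DP gP TP Px; apply: triv => //; apply: contrapT => /(region_children TP) [lt _ _].
  by rewrite gP ltxx in lt.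
move=> P DP gP IH TP Px.
have [FP|/(region_children TP) [_ _ TC]] := pselect (F P); first exact: triv.
have [C CC Cx] := child_at DP Px; have [Q [FQ Qx QC]] := IH C CC (TC C CC) Cx.
by exists Q; split => //; exact: subcube_trans QC (child_subcube CC).
Qed.

Lemma minimal_eq P Q : F Q -> T P -> subcube P Q -> P = Q.
Proof. by move=> [_ h] TP; exact: h. Qed.

Lemma region_ancestor P (k : int) : T P -> gen QT <= k -> k <= gen P ->
  exists P', [/\ T P', gen P' = k & subcube P P'].
Proof.
move=> TP k1 k2; have DP := region_D TP.
have [P' [DP' gP' PP']] := ancestor DP k2; exists P'; split => //.
have PQT := str_max str TP.
apply: (str_convex str TP DP' PP').
have DQT : D QT by apply: region_D; exact: str_top str.
apply: cube_nested (subcube_center DP PQT) (subcube_center DP PP') => //.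
by rewrite gP'.
Qed.

(** The minimal cubes below [P] partition it, and the mass is additive in the
    region. *)
Lemma minimal_sum_mass P : T P -> forall r, uniq r ->
  (forall Q, Q \in r -> F Q /\ subcube Q P) ->
  \sum_(Q <- r) mass Q <= mass P.
Proof.
move=> TP; have := TP; have := region_gen TP; have := region_D TP; move: P {TP}.
have triv P : F P -> forall r, uniq r ->
  (forall Q, Q \in r -> F Q /\ subcube Q P) -> \sum_(Q <- r) mass Q <= mass P.
  move=> FP r ur rP.
  have E1 : {in r, forall Q, Q = P}.
    by move=> Q /rP [FQ QP]; apply: minimal_eq QP => //; exact: minimal_region.
  case: r ur rP E1 => [|Q [|Q' r]] /= ur rP E1.
  - by rewrite big_nil mass_ge0.
  - by rewrite big_seq1 (E1 Q) ?mem_head.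
  - have h1 : Q = P by apply: E1; exact: mem_head.
    have h2 : Q' = P by apply: E1; rewrite in_cons mem_head orbT.
    by move: ur; rewrite h1 h2 mem_head.
move=> P DP gP; move: P DP gP.
apply: (@gen_ind (fun P => T P -> forall r, uniq r ->
  (forall Q, Q \in r -> F Q /\ subcube Q P) -> \sum_(Q <- r) mass Q <= mass P)).
  move=> P DP gP TP; apply: triv => //; apply: contrapT => /(region_children TP) [lt _ _].
  by rewrite gP ltxx in lt.
move=> P DP gP IH TP r ur rP.
have [FP|nFP] := pselect (F P); first exact: triv ur rP.
have [_ -> TC] := region_children TP nFP.
apply: (le_trans (@big_seq_le_cover R _ _ r (children P) (fun C Q => `[< subcube Q C >]) _ _ _)).
- by move=> Q _; exact: mass_ge0.
- move=> Q /rP [FQ QP].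
  have nQP : Q <> P by move=> QE; rewrite QE in FQ.
  have [C CC QC] := subcube_child (minimal_D FQ) DP QP nQP.
  by exists C; [exact/childrenP|exact/asboolP].
rewrite big_seq [leRHS]big_seq; apply: ler_sum => C /(childrenP _ DP) CC.
rewrite -big_filter; apply: (IH C CC (TC C CC)); first by rewrite filter_uniq.
by move=> Q; rewrite mem_filter => /andP[/asboolP QC /rP [FQ _]].
Qed.

(** Either the mass controls the length of each cube, or one of the cubes is all
    of [E] and hence the only one. *)
Lemma minimal_sum_len P : T P -> forall r, uniq r ->
  (forall Q, Q \in r -> F Q /\ subcube Q P) ->
  \sum_(Q <- r) ell Q ^+ d <= (1 + 2%:R / mass_constant) * ell P ^+ d.
Proof.
move=> TP r ur rP; have m0 := mass_constant_gt0.
have lP0 : 0 <= ell P ^+ d by rewrite exprn_ge0 // cube_len_ge0.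
have [[Q [Qr EQ]]|none] := pselect (exists Q, Q \in r /\ E `<=` cube_set Q).
  have [FQ QP] := rP Q Qr.
  have all_eq : {in r, forall Q', Q' = Q}.
    move=> Q' /rP [FQ' _].
    have DQ' := minimal_D FQ'; have DQ := minimal_D FQ.
    have zQ : cube_set Q (zeta Q') by apply: EQ; exact: center_in_E.
    have [le|/ltW le] := leP (gen Q) (gen Q').
      have sub := cube_nested DQ DQ' le zQ (center_in_cube DQ').
      by apply: minimal_eq sub => //; exact: minimal_region.
    have sub := cube_nested DQ' DQ le (center_in_cube DQ') zQ.
    by apply/esym; apply: minimal_eq sub => //; exact: minimal_region.
  have -> : r = [:: Q].
    case: r ur Qr all_eq {rP} => // Q1 [|Q2 r] /= ur Qr all_eq.
      by rewrite (all_eq Q1) ?mem_head.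
    have h1 : Q1 = Q by apply: all_eq; exact: mem_head.
    have h2 : Q2 = Q by apply: all_eq; rewrite in_cons mem_head orbT.
    by move: ur; rewrite h1 h2 mem_head.
  rewrite big_seq1; apply: (@le_trans _ _ (ell P ^+ d)).
    by rewrite lerXn2r ?nnegrE ?cube_len_ge0 // cube_len_le; case: QP.
  by rewrite ler_peMl // lerDl divr_ge0 // ltW.
apply: (@le_trans _ _ ((\sum_(Q <- r) mass Q) / mass_constant)).
  rewrite mulr_suml big_seq [leRHS]big_seq; apply: ler_sum => Q Qr.
  have [FQ QP] := rP Q Qr; have DQ := minimal_D FQ.
  rewrite ler_pdivlMr // mulrC; apply: mass_ge => //.
    by apply: region_gen; exact: minimal_region.
  apply: half_core_lt_diameter; apply: cube_len_le_diameter => // EQ.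
  by apply: none; exists Q.
rewrite mulrDl mul1r -[leLHS]add0r lerD // mulrAC ler_pM2r ?invr_gt0 //.
exact: le_trans (minimal_sum_mass TP ur rP) (mass_le P).
Qed.

(** The infimum is finite as the family is not empty. *)
Definition dist_min (x : 'rV[R]_n) : R := fine (d_family rho F x).

Lemma dist_minE x : d_family rho F x = (dist_min x)%:E.
Proof.
have TQT := str_top str; have DQT := region_D TQT.
have [Q [FQ Qz _]] := region_minimal_at TQT (center_in_cube DQT).
rewrite /dist_min fineK // ge0_fin_numE.
  apply: (@le_lt_trans _ _ ((ell Q)%:E + dist_set x (cube_set Q))%E).
    by apply: ereal_inf_lbound; exists Q.
  apply: (@le_lt_trans _ _ (ell Q + edistance x (zeta QT))%:E); last exact: ltry.
  by rewrite EFinD leeD2l //; apply: ereal_inf_lbound; exists (zeta QT).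
apply: le_ereal_inf_tmp => _ [P _ <-].
by rewrite adde_ge0 ?dist_set_ge0 // lee_fin cube_len_ge0.
Qed.

Lemma dist_min_le x Q y : F Q -> cube_set Q y -> dist_min x <= ell Q + edistance x y.
Proof.
move=> FQ Qy; rewrite -lee_fin -dist_minE.
apply: (@le_trans _ _ ((ell Q)%:E + dist_set x (cube_set Q))%E).
  by apply: ereal_inf_lbound; exists Q.
by rewrite EFinD leeD2l //; apply: ereal_inf_lbound; exists y.
Qed.

Lemma dist_min_lt x b : dist_min x < b ->
  exists Q y, [/\ F Q, cube_set Q y & ell Q + edistance x y < b].
Proof.
rewrite -lte_fin -dist_minE => /ereal_inf_lt [_ [Q FQ <-]] lt.
have : (dist_set x (cube_set Q) < (b - ell Q)%:E)%E.
  by rewrite EFinB lteBrDl.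
move=> /ereal_inf_lt [_ [y Qy <-]]; rewrite lte_fin => lt2.
by exists Q, y; split => //; rewrite -ltrBrDl.
Qed.

Lemma dist_min_lipschitz x y : dist_min x <= dist_min y + edistance x y.
Proof.
rewrite leNgt; apply/negP; rewrite -ltrBrDr => /dist_min_lt [Q [z [FQ Qz lt]]].
have := dist_min_le x FQ Qz; have := edistance_triangle y x z; lra.
Qed.

Lemma dist_min_ge x : 5%:R * rho ^ k0%:Z <= dist_min x.
Proof.
rewrite leNgt; apply/negP => /dist_min_lt [Q [y [FQ Qy lt]]].
have : 5%:R * rho ^ k0%:Z <= ell Q.
  (* only the generation of this cube matters *)
  pose Qk : gcube R n := (k0%:Z, set0).
  have -> : 5%:R * rho ^ k0%:Z = ell Qk by [].
  by rewrite cube_len_le; apply: region_gen; exact: minimal_region.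
have := edistance_ge0 x y; lra.
Qed.

Lemma dist_min_gt0 x : 0 < dist_min x.
Proof. by apply: lt_le_trans (dist_min_ge x); rewrite mulr_gt0 // exprz_gt0. Qed.

Lemma dist_min_le_top x : dist_min x <= ell QT + edistance x (zeta QT).
Proof.
have TQT := str_top str; have DQT := region_D TQT.
have [Q [FQ Qz QQT]] := region_minimal_at TQT (center_in_cube DQT).
apply: (le_trans (dist_min_le x FQ Qz)); rewrite lerD2r cube_len_le.
by case: QQT.
Qed.

Lemma dist_min_near x : exists Q y,
  [/\ F Q, cube_set Q y & ell Q + edistance x y <= 2%:R * dist_min x].
Proof.
have [|Q [y [FQ Qy lt]]] := @dist_min_lt x (2%:R * dist_min x).
  by have := dist_min_gt0 x; lra.
by exists Q, y; split => //; exact: ltW.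
Qed.

(** * The dyadic cover *)

Section Cover.
Variables (C0 t : R).
Hypotheses (d_lt_n : (d < n)%N) (C0_gt4 : 4%:R < C0) (t_gt0 : 0 < t).
Hypothesis t_le : t * (2%:R * n.+1%:R) <= 1.
Local Notation f := dist_min.
Local Notation dset := (@dyadic_set R n).
Local Notation len := (dyadic_len R).

Definition fine_cube (I : dyadic n) : Prop := forall x, dset I x -> len I <= t * f x.

(** The maximal dyadic cubes that are small compared to the distance to the
    minimal cubes, among those that meet the part of [E] to be covered. *)
Definition cover_cubes : set (dyadic n) :=
  [set I | [/\ fine_cube I, ~ fine_cube (dyadic_parent R I) &
    exists x, [/\ E x, edistance (zeta QT) x <= C0 * ell QT & dset I x]]].
Local Notation Cov := cover_cubes.

(** A marked point of [E]; the default [0] only serves cubes outside the cover. *)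
Definition cover_pt (I : dyadic n) : 'rV[R]_n :=
  xget 0 [set x | [/\ E x, edistance (zeta QT) x <= C0 * ell QT & dset I x]].

Lemma cover_ptP I : Cov I ->
  [/\ E (cover_pt I), edistance (zeta QT) (cover_pt I) <= C0 * ell QT & dset I (cover_pt I)].
Proof.
move=> [_ _ [x Hx]]; rewrite /cover_pt; case: xgetP => [y _ []//|/(_ x)]; by case.
Qed.

Lemma n_t_le_half : n%:R * t <= 2%:R^-1.
Proof.
move: t_le; have -> : t * (2%:R * n.+1%:R) = 2%:R * (n%:R * t) + 2%:R * t by ring.
by move: t_gt0; lra.
Qed.

Lemma t_le_half : t <= 2%:R^-1.
Proof.
have : 0 <= n%:R * t by rewrite mulr_ge0 // ltW.
move: t_le; have -> : t * (2%:R * n.+1%:R) = 2%:R * (n%:R * t) + 2%:R * t by ring.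
lra.
Qed.

Lemma cover_len_le I x : Cov I -> dset I x -> len I <= t * f x.
Proof. by case=> h _ _; exact: h. Qed.

(** The smallness fails at some point of the parent, and the distance to the
    minimal cubes varies little over the parent. *)
Lemma cover_len_ge I x : Cov I -> dset I x -> t * f x <= 3%:R * len I.
Proof.
move=> [_ nf _] Ix.
have [y Py lt] : exists2 y, dset (dyadic_parent R I) y & t * f y < 2%:R * len I.
  apply: contrapT => nex; apply: nf => y Py; rewrite dyadic_parent_len leNgt.
  by apply/negP => lt; apply: nex; exists y.
have Px := dyadic_parent_sub Ix.
have := dyadic_hull_edistance (dyadic_set_hull Px) (dyadic_set_hull Py).
rewrite dyadic_parent_len => xy.
have h1 : t * f x <= t * f y + t * edistance x y.
  by rewrite -mulrDr ler_pM2l // dist_min_lipschitz.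
have h2 : t * edistance x y <= len I.
  apply: (@le_trans _ _ (t * (n%:R * (2%:R * len I)))); first by rewrite ler_pM2l.
  have -> : t * (n%:R * (2%:R * len I)) = (n%:R * t) * (2%:R * len I) by ring.
  have l0 : 0 <= 2%:R * len I by rewrite mulr_ge0 // dyadic_len_ge0.
  have := ler_wpM2r l0 n_t_le_half; lra.
lra.
Qed.

Lemma cover_disjoint I J x : Cov I -> Cov J -> dset I x -> dset J x -> I = J.
Proof.
wlog le : I J / I.1 <= J.1.
  move=> H CI CJ Ix Jx; have [le|/ltW le] := leP I.1 J.1; first exact: H.
  by apply/esym; exact: H.
move=> CI CJ Ix Jx.
have [/eqP e|ne] := boolP (I.1 == J.1); first exact: dyadic_eq e Ix Jx.
have lt : I.1 < J.1 by rewrite lt_neqAle ne.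
have [_ nf _] := CI; have [fJ _ _] := CJ.
case: nf => y Py.
have sub : dset (dyadic_parent R I) `<=` dset J.
  apply: (@dyadic_nested _ _ _ _ x) => //; last exact: dyadic_parent_sub.
  by rewrite /=; lia.
apply: le_trans (fJ _ (sub _ Py)).
by rewrite dyadic_len_le /=; lia.
Qed.

(** The dyadic cubes around [x] are small enough at the scale of the smallest
    minimal cubes and too large at the scale of the distance from [x]. *)
Lemma cover_covers x : E x -> edistance (zeta QT) x <= C0 * ell QT -> exists2 I, Cov I & dset I x.
Proof.
move=> Ex xB.
have two1 : (1 : R) < 2%:R by rewrite ltr1n.
have [k2 [k2le _]] : exists k, 2%:R ^ k <= t * (5%:R * rho ^ k0%:Z) /\
    t * (5%:R * rho ^ k0%:Z) < 2%:R ^ (k + 1).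
  by apply: integer_log => //; rewrite mulr_gt0 // mulr_gt0 // exprz_gt0.
have [k3 [_ k3lt]] := integer_log two1 (mulr_gt0 t_gt0 (dist_min_gt0 x)).
have fine2 : fine_cube (dyadic_at k2 x).
  move=> y _; apply: (le_trans k2le); rewrite ler_pM2l //; exact: dist_min_ge.
have ex : exists j : nat, `[< ~ fine_cube (dyadic_at (k2 + j%:Z + 1) x) >].
  exists (absz (k3 - k2)); apply/asboolP => /(_ _ (mem_dyadic_at _ x)).
  rewrite leNgt => /negP; apply; apply: (lt_le_trans k3lt).
  have kk : k3 + 1 <= k2 + (absz (k3 - k2))%:Z + 1.
    by rewrite lerD2r -lerBlDl abszE ler_norm.
  exact: (ler_weXz2l (ltW two1) kk).
case: (ex_minnP ex) => j /asboolP nf minj.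
exists (dyadic_at (k2 + j%:Z) x); last exact: mem_dyadic_at.
split; last by exists x; split => //; exact: mem_dyadic_at.
  case: j nf minj => [|j] nf minj; first by rewrite addr0.
  apply: contrapT => nf'; have := minj j; rewrite ltnn => H.
  suff : (j.+1 <= j)%N by rewrite ltnn.
  apply: minj; apply/asboolP.
  by have <- : k2 + j.+1%:Z = k2 + j%:Z + 1 by rewrite intS [1 + _]addrC addrA.
have -> // : dyadic_parent R (dyadic_at (k2 + j%:Z) x) = dyadic_at (k2 + j%:Z + 1) x.
apply: (@dyadic_eq R _ _ _ x) => //; last exact: mem_dyadic_at.
by apply: dyadic_parent_sub; exact: mem_dyadic_at.
Qed.

Lemma C0_gt0 : 0 < C0. Proof. by apply: lt_trans C0_gt4; rewrite ltr0n. Qed.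

Lemma cover_len_le_top I : Cov I -> len I <= t * ((1 + C0) * ell QT).
Proof.
move=> CI; have [_ xB Ix] := cover_ptP CI.
apply: (le_trans (cover_len_le CI Ix)); rewrite ler_pM2l //.
by apply: (le_trans (dist_min_le_top _)); rewrite edistanceC mulrDl mul1r lerD2l.
Qed.

Lemma cover_nlen_le I : Cov I -> n%:R * len I <= C0 * ell QT.
Proof.
move=> CI; apply: (@le_trans _ _ (n%:R * (t * ((1 + C0) * ell QT)))).
  by rewrite ler_wpM2l // cover_len_le_top.
rewrite mulrA; have l0 := cube_len_ge0 QT.
apply: (@le_trans _ _ (2%:R^-1 * ((1 + C0) * ell QT))).
  by rewrite ler_wpM2r ?n_t_le_half // mulr_ge0 // addr_ge0 // ltW // C0_gt0.
by rewrite mulrA ler_wpM2r //; have := C0_gt4; lra.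
Qed.

Lemma cover_len_le_C0 I : Cov I -> len I <= C0 * ell QT.
Proof.
move=> CI; apply: (le_trans (cover_len_le_top CI)); rewrite mulrA ler_wpM2r ?cube_len_ge0 //.
apply: (@le_trans _ _ (2%:R^-1 * (1 + C0))).
  by rewrite ler_wpM2r ?t_le_half // addr_ge0 // ltW // C0_gt0.
by have := C0_gt4; lra.
Qed.

Lemma cover_hull_ball I x : Cov I -> dyadic_hull I x ->
  edistance (zeta QT) x <= 2%:R * C0 * ell QT.
Proof.
move=> CI Ix; have [_ pB Ip] := cover_ptP CI.
apply: (le_trans (edistance_triangle (cover_pt I) _ _)).
have := dyadic_hull_edistance (dyadic_set_hull Ip) Ix; have := cover_nlen_le CI; lra.
Qed.

Lemma cover_disjointP I J : Cov I -> Cov J -> I <> J ->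
  ~ (dset I `&` dset J !=set0).
Proof. by move=> CI CJ IJ [x [Ix Jx]]; apply: IJ; exact: cover_disjoint Ix Jx. Qed.

Definition min_len : R := t * (5%:R * rho ^ k0%:Z) / 3%:R.

Lemma min_len_gt0 : 0 < min_len.
Proof. by rewrite /min_len divr_gt0 // mulr_gt0 // mulr_gt0 // exprz_gt0. Qed.

Lemma cover_min_len I : Cov I -> min_len <= len I.
Proof.
move=> CI; have [_ _ Ix] := cover_ptP CI.
rewrite /min_len ler_pdivrMr // [leRHS]mulrC; apply: le_trans (cover_len_ge CI Ix).
by rewrite ler_pM2l // dist_min_ge.
Qed.

(** The corners of disjoint cubes are as far apart as the cubes are long. *)
Lemma packing_cover (r : seq (dyadic n)) (x : 'rV[R]_n) (w L : R) : 0 < w -> uniq r ->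
  (forall I, I \in r -> [/\ Cov I, w <= len I &
     edistance x (cover_pt I) + n%:R * len I <= L * w]) ->
  (size r <= packing_number n L)%N.
Proof.
move=> w0 ur H; apply: (@packing R n _ r (@dyadic_corner_pt R n) x w L) => //.
  move=> I J /H[CI wI _] /H[CJ wJ _] /eqP IJ.
  apply: dyadic_corner_separated => //; exact: cover_disjointP.
move=> I /H[CI _ h]; apply: le_trans h.
apply: (le_trans (edistance_triangle (cover_pt I) _ _)); rewrite lerD2l.
have [_ _ Ix] := cover_ptP CI.
by apply: dyadic_hull_edistance; apply: dyadic_set_hull => //; exact: mem_dyadic_corner_pt.
Qed.

Lemma finite_cover : finite_set Cov.
Proof.
pose L := (2%:R * C0 * ell QT) / min_len.
apply: (@finite_of_packing _ _ (packing_number n L)) => r ur rC.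
apply: (@packing_cover r (zeta QT) min_len) => // [|I /rC CI]; first exact: min_len_gt0.
split => //; first exact: cover_min_len.
rewrite /L divfK ?gt_eqF ?min_len_gt0 //.
have [_ pB _] := cover_ptP CI; have := cover_nlen_le CI; lra.
Qed.

(** A minimal cube and a point of it that nearly realise the distance from the
    marked point of a cube of the cover. *)
Definition near_pair (I : dyadic n) : gcube R n * 'rV[R]_n :=
  let w := cid (dist_min_near (cover_pt I)) in (projT1 w, projT1 (cid (projT2 w))).
Definition near_cube I := (near_pair I).1.
Definition near_pt I := (near_pair I).2.

(** A factor 2 from the choice of the pair and a factor 3 from [cover_len_ge]. *)
Definition near_ratio : R := 6%:R / t.

Lemma near_ratio_ge12 : 12%:R <= near_ratio.
Proof. by rewrite /near_ratio ler_pdivlMr //; have := t_le_half; lra. Qed.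

Lemma near_cubeP I : F (near_cube I) /\ cube_set (near_cube I) (near_pt I).
Proof.
rewrite /near_cube /near_pt /near_pair /=; case: cid => Q /= exy; case: cid => y /= [].
by [].
Qed.

Lemma near_le2 I : ell (near_cube I) + edistance (cover_pt I) (near_pt I) <=
  2%:R * f (cover_pt I).
Proof.
rewrite /near_cube /near_pt /near_pair /=; case: cid => Q /= exy; case: cid => y /= [].
by [].
Qed.

Lemma near_le I : Cov I ->
  ell (near_cube I) + edistance (cover_pt I) (near_pt I) <= near_ratio * len I.
Proof.
move=> CI; have [_ _ Ix] := cover_ptP CI; apply: (le_trans (near_le2 I)).
rewrite /near_ratio mulrAC ler_pdivlMr // -mulrA [f _ * t]mulrC.
have := cover_len_ge CI Ix; lra.
Qed.

(** * Lower regularity of the skeleton *)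

Local Notation ET := (@dyadic_skeleton R n d Cov).

(** The radii in question are at most [4 C0] times the length of the top cube, so
    a ball whose radius is reduced by this ratio around a point near the top cube
    remains in the covered ball. *)
Definition reach_ratio : R := (8%:R * C0)^-1.

(** The marked point of a cube whose side is below this fraction of [r] has distance
    less than [reach_ratio * r] to the minimal cubes. *)
Definition fine_ratio : R := t * reach_ratio / 3%:R.

Lemma reach_ratio_gt0 : 0 < reach_ratio.
Proof. by rewrite /reach_ratio invr_gt0 mulr_gt0 // C0_gt0. Qed.

Lemma reach_ratio_C0 : reach_ratio * C0 = 8%:R^-1.
Proof. by rewrite /reach_ratio invfM -mulrA mulVf ?mulr1 // gt_eqF // C0_gt0. Qed.

Lemma reach_ratio_le : reach_ratio <= 32%:R^-1.
Proof.
rewrite /reach_ratio lef_pV2 ?posrE ?mulr_gt0 ?C0_gt0 //; have := C0_gt4; lra.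
Qed.

Lemma fine_ratio_gt0 : 0 < fine_ratio.
Proof. by rewrite /fine_ratio divr_gt0 // mulr_gt0 // reach_ratio_gt0. Qed.

Lemma fine_ratio_le1 : fine_ratio <= 1.
Proof.
rewrite /fine_ratio ler_pdivrMr // mul1r.
have := ler_pM (ltW t_gt0) (ltW reach_ratio_gt0) t_le_half reach_ratio_le; lra.
Qed.

Lemma diameter_ET : (diameter ET <= (4%:R * C0 * ell QT)%:E)%E.
Proof.
have pos : 0 <= 2%:R * C0 * ell QT.
  by rewrite mulr_ge0 ?cube_len_ge0 // mulr_ge0 // ltW // C0_gt0.
apply: diameter_le => [|x y [I CI Ix] [J CJ Jy]]; first by rewrite lee_fin; lra.
rewrite lee_fin; apply: (le_trans (edistance_triangle (zeta QT) _ _)).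
rewrite edistanceC; have := cover_hull_ball CI (skeleton_hull Ix).
have := cover_hull_ball CJ (skeleton_hull Jy); lra.
Qed.

(** The ball contains a box inside the face through its centre. *)
Lemma lower_regular_near I xi r : Cov I -> @skeleton R n d I xi -> 0 < r -> fine_ratio * r <= len I ->
  (((fine_ratio / (10%:R * n.+1%:R) * r) ^+ d)%:E <= hausdorff_measure d (cball xi r `&` ET))%E.
Proof.
move=> CI Ixi r0 le.
have e0 := fine_ratio_gt0; have e1 := fine_ratio_le1.
have er : 0 < fine_ratio * r by rewrite mulr_gt0.
pose a := fine_ratio * r / n.+1%:R.
have a0 : 0 < a by rewrite divr_gt0.
have aI : a <= len I.
  apply: le_trans le; rewrite /a ler_pdivrMr // ler_peMr ?(ltW er) //.
  by rewrite ler1n.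
have -> : fine_ratio / (10%:R * n.+1%:R) * r = a / 10%:R.
  by rewrite /a; field; rewrite nat1r.
apply: (le_trans (hausdorff_content_skeleton_ge d_gt0 Ixi a0 aI)).
apply: (le_trans (hausdorff_content_le_measure _ _)); apply: hausdorff_measure_subset => z [zb zI].
split; last by exists I.
apply: (le_trans zb); apply: (@le_trans _ _ (1 * r)); last by rewrite mul1r.
have -> : n%:R * a = (n%:R / n.+1%:R * fine_ratio) * r by rewrite /a; ring.
rewrite ler_pM2r //; apply: (@le_trans _ _ (1 * 1)); last by rewrite mulr1.
rewrite ler_pM ?(ltW e0) ?divr_ge0 //.
by rewrite ler_pdivrMr // mul1r ler_nat.
Qed.

(** Around a cube that is small compared to the radius, the set [E] itself
    reaches far inside the covered ball; the cubes that cover it there have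
    disjoint middle faces in the ball of the skeleton. *)
Lemma lower_regular_far I xi r : Cov I -> @skeleton R n d I xi -> 0 < r ->
  (r%:E < diameter ET)%E -> len I < fine_ratio * r ->
  ((c * (reach_ratio / (20%:R * n.+1%:R) * r) ^+ d)%:E <= hausdorff_measure d (cball xi r `&` ET))%E.
Proof.
move=> CI Ixi r0 rET lenI.
have s0 := reach_ratio_gt0; have sC := reach_ratio_C0; have s32 := reach_ratio_le; have C4 := C0_gt4.
have l0 := cube_len_gt0 QT.
have nl J y : Cov J -> dset J y -> n%:R * len J <= f y / 2%:R.
  move=> CJ Jy; apply: (@le_trans _ _ (n%:R * (t * f y))).
    by rewrite ler_wpM2l // cover_len_le.
  by rewrite mulrA mulrC ler_pM2l ?dist_min_gt0 // n_t_le_half.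
set x := cover_pt I.
have [Ex xB Ix] := cover_ptP CI; rewrite -/x in Ex xB Ix.
have sr0 : 0 < reach_ratio * r by rewrite mulr_gt0.
have fx : f x < reach_ratio * r.
  have h := cover_len_ge CI Ix.
  rewrite -(ltr_pM2l t_gt0); apply: (le_lt_trans h).
  have -> : t * (reach_ratio * r) = 3%:R * (fine_ratio * r) by rewrite /fine_ratio; field.
  by rewrite ltr_pM2l.
have r4 : reach_ratio * r < ell QT / 2%:R.
  have : r < 4%:R * C0 * ell QT by rewrite -lte_fin; apply: lt_le_trans rET diameter_ET.
  move=> h; have : reach_ratio * r < reach_ratio * (4%:R * C0 * ell QT) by rewrite ltr_pM2l.
  have -> : reach_ratio * (4%:R * C0 * ell QT) = (reach_ratio * C0) * (4%:R * ell QT) by ring.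
  rewrite sC; lra.
have x2 : edistance (zeta QT) x <= 2%:R * ell QT.
  have [FQ Qy] := near_cubeP I; have h := near_le2 I; rewrite -/x in h.
  have TQ := minimal_region FQ.
  have [_ QQT] := str_max str TQ.
  have yT := cube_outer (region_D (str_top str)) (QQT _ Qy).
  apply: (le_trans (edistance_triangle (near_pt I) _ _)).
  rewrite [X in _ + X]edistanceC; have := cube_len_gt0 (near_cube I); lra.
set r' := reach_ratio * r.
have fy y : edistance x y <= r' -> f y <= 2%:R * r'.
  move=> xy; have := dist_min_lipschitz y x; rewrite edistanceC /r'; rewrite /r' in xy; lra.
(* if [E] were smaller than the radius, the distance to the minimal cubes would be
   small on all of [E], all cubes of the cover would be small, and the skeleton
   would have diameter less than [r] *)
have r'E : (r'%:E < diameter E)%E.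
  rewrite ltNge; apply/negP => dE.
  have [xi1 [xi2 [[I1 CI1 Ixi1] [I2 CI2 Ixi2] lt]]] := diameter_gt (ltW r0) rET.
  have [Ex1 _ Ix1] := cover_ptP CI1; have [Ex2 _ Ix2] := cover_ptP CI2.
  set x1 := cover_pt I1 in Ex1 Ix1; set x2' := cover_pt I2 in Ex2 Ix2.
  have dist u v : E u -> E v -> edistance u v <= r'.
    by move=> Eu Ev; rewrite -lee_fin; apply: le_trans dE; exact: edistance_le_diameter.
  have h1 := dyadic_hull_edistance (skeleton_hull Ixi1) (dyadic_set_hull Ix1).
  have h2 := dyadic_hull_edistance (dyadic_set_hull Ix2) (skeleton_hull Ixi2).
  have g1 := nl _ _ CI1 Ix1; have g2 := nl _ _ CI2 Ix2.
  have f1 := fy _ (dist _ _ Ex Ex1); have f2 := fy _ (dist _ _ Ex Ex2).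
  have t1 := edistance_triangle x1 xi1 xi2; have t2 := edistance_triangle x2' x1 xi2.
  have d12 := dist _ _ Ex1 Ex2.
  have small : r' <= r * 32%:R^-1 by rewrite /r' mulrC ler_pM2l.
  have a1 : edistance xi1 x1 <= r'.
    by apply: (le_trans h1); apply: (le_trans g1); exact: half_le.
  have a2 : edistance x2' xi2 <= r'.
    by apply: (le_trans h2); apply: (le_trans g2); exact: half_le.
  have : edistance xi1 xi2 <= r' + (r' + r').
    by apply: (le_trans t1); apply: lerD => //; apply: (le_trans t2); exact: lerD.
  by move=> /(lt_le_trans lt); rewrite ltNge small_triple.
pose A := [set J | Cov J /\ exists y, [/\ E y, edistance x y <= r' & dset J y]].
have finA : finite_set A by apply: sub_finite_set finite_cover => J [].
set s := enum_fset (fset_set A).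
have sA J : J \in s -> A J by move/(fset_setP _ finA).
have cover_sum : c * r' ^+ d <= \sum_(J <- s) (n.+1%:R * len J) ^+ d.
  rewrite -lee_fin; apply: (le_trans (reg Ex sr0 r'E)).
  apply: (@hausdorff_delta_le_diameters R n d d_gt0 _ s dset).
  - exact: leey.
  - move=> y [Ey xy].
    have [J CJ Jy] : exists2 J, Cov J & dset J y.
      apply: cover_covers => //; apply: (le_trans (edistance_triangle x _ _)).
      rewrite /cball /= -/r' in xy; rewrite -/r' in r4.
      have : 4%:R * ell QT <= C0 * ell QT by rewrite ler_pM2r // ltW.
      lra.
    by exists J => //; apply/(fset_setP _ finA); split => //; exists y.
  - move=> J _; split.
    + by rewrite mulr_ge0 // dyadic_len_ge0.
    + exact: leey.
    + apply: diameter_le => [|u v Ju Jv]; first by rewrite lee_fin mulr_ge0 // dyadic_len_ge0.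
      rewrite lee_fin; apply: (le_trans (dyadic_hull_edistance (dyadic_set_hull Ju) (dyadic_set_hull Jv))).
      by rewrite ler_wpM2r ?dyadic_len_ge0 // ler_nat.
have m0 := min_len_gt0.
have m4 : 0 < min_len / 4%:R by rewrite divr_gt0.
apply: (@le_trans _ _ (\sum_(J <- s) ((len J / 20%:R) ^+ d))%:E).
  rewrite lee_fin.
  have -> : \sum_(J <- s) (len J / 20%:R) ^+ d =
     (20%:R * n.+1%:R) ^- d * \sum_(J <- s) (n.+1%:R * len J) ^+ d.
    rewrite mulr_sumr; apply: eq_bigr => J _.
    by rewrite -exprVn -exprMn; congr (_ ^+ _); field; rewrite nat1r.
  have -> : c * (reach_ratio / (20%:R * n.+1%:R) * r) ^+ d = (20%:R * n.+1%:R) ^- d * (c * r' ^+ d).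
    rewrite mulrCA -exprVn -exprMn; congr (_ * _ ^+ _); rewrite /r'; ring.
  by rewrite ler_wpM2l // invr_ge0 exprn_ge0 // mulr_ge0.
apply: le_trans (hausdorff_delta_le_measure _ _ m4).
apply: (@le_trans _ _ (\sum_(J <- s) hausdorff_delta d (min_len / 4%:R)%:E (@middle_face R n d J))%E).
  rewrite -sumEFin; apply: lee_sum => J _.
  apply: (@le_trans _ _ (hausdorff_content d (@middle_face R n d J))).
    exact: hausdorff_content_middle_face_ge.
  exact: hausdorff_content_le_delta.
apply: hausdorff_delta_sum_separated => //.
- exact: ltW.
- exact: fset_uniq.
- move=> J K u v /sA[CJ _] /sA[CK _] /eqP JK Ju Kv.
  apply: middle_face_separated Ju Kv => //; try exact: cover_min_len.
  exact: cover_disjointP.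
- move=> J /sA[CJ [y [Ey xy Jy]]] z Jz.
  have Sz := middle_face_skeleton d_lt_n Jz.
  split; last by exists J.
  have h1 := dyadic_hull_edistance (skeleton_hull Ixi) (dyadic_set_hull Ix).
  have h2 := dyadic_hull_edistance (dyadic_set_hull Jy) (skeleton_hull Sz).
  have g1 := nl _ _ CI Ix; have g2 := nl _ _ CJ Jy; have f2 := fy _ xy.
  have t1 := edistance_triangle x xi z; have t2 := edistance_triangle y x z.
  have : r' <= r * 32%:R^-1 by rewrite /r' mulrC ler_pM2l.
  rewrite /cball /= -/r' in fx *; lra.
Qed.

Definition lower_constant : R :=
  Num.min ((fine_ratio / (10%:R * n.+1%:R)) ^+ d) (c * (reach_ratio / (20%:R * n.+1%:R)) ^+ d).

Lemma lower_constant_gt0 : 0 < lower_constant.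
Proof.
rewrite lt_min; apply/andP; split; first by rewrite exprn_gt0 // divr_gt0 ?fine_ratio_gt0 // mulr_gt0.
by rewrite mulr_gt0 // exprn_gt0 // divr_gt0 ?reach_ratio_gt0 // mulr_gt0.
Qed.

Lemma lower_regular xi r : ET xi -> 0 < r -> (r%:E < diameter ET)%E ->
  ((lower_constant * r ^+ d)%:E <= hausdorff_measure d (cball xi r `&` ET))%E.
Proof.
move=> [I CI Ixi] r0 rET; have rd : 0 <= r ^+ d by rewrite exprn_ge0 // ltW.
have [le|lt] := leP (fine_ratio * r) (len I).
  apply: le_trans (lower_regular_near CI Ixi r0 le).
  by rewrite lee_fin exprMn ler_wpM2r // ge_min lexx.
apply: le_trans (lower_regular_far CI Ixi r0 rET lt).
by rewrite lee_fin exprMn mulrA ler_wpM2r // ge_min lexx orbT.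
Qed.

(** * Upper regularity of the skeleton *)

(** Dyadic cubes shorter than this fraction of [P] have their marked point within
    [rho / 1000] times the length of [P] from their near cube. Together with the
    outer radius of the central child this is less than the inner radius of [P]. *)
Definition small_ratio : R := rho / (1000%:R * near_ratio).
Definition big_count : nat := packing_number n ((near_ratio * C0 + 1 + n%:R * C0) / small_ratio).
Definition outer_constant : R := big_count%:R * C0 ^+ d / (mass_constant * rho ^+ d).

Lemma near_ratio_gt0 : 0 < near_ratio. Proof. by apply: lt_le_trans near_ratio_ge12; rewrite ltr0n. Qed.

Lemma small_ratio_gt0 : 0 < small_ratio.
Proof.
apply: divr_gt0; [exact: rho_gt0|apply: mulr_gt0; [exact: ltr0Sn|exact: near_ratio_gt0]].
Qed.

Lemma near_small_ratio : near_ratio * small_ratio = rho / 1000%:R.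
Proof.
have L0 : near_ratio != 0 by rewrite gt_eqF // near_ratio_gt0.
by rewrite /small_ratio invfM mulrCA [_^-1 * _^-1]mulrC (mulVKf L0).
Qed.

Lemma rho_milli : rho / 1000%:R < 2000%:R^-1.
Proof.
rewrite ltr_pdivrMr; last exact: ltr0Sn.
apply: lt_trans rho_small _; lra.
Qed.

Lemma small_ratio_le_rho : small_ratio <= rho.
Proof.
rewrite /small_ratio ler_pdivrMr; last first.
  apply: mulr_gt0; [exact: ltr0Sn|exact: near_ratio_gt0].
by apply: ler_peMr; [exact: ltW|have := near_ratio_ge12; lra].
Qed.

Lemma outer_constant_ge0 : 0 <= outer_constant.
Proof.
rewrite /outer_constant divr_ge0 // mulr_ge0 ?exprn_ge0 // ?(ltW C0_gt0) ?(ltW rho_gt0) //.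
exact: ltW mass_constant_gt0.
Qed.

Lemma outer_constantE P : big_count%:R * (C0 * ell P) ^+ d =
  outer_constant * (mass_constant * (rho * ell P) ^+ d).
Proof.
have m0 := mass_constant_gt0.
rewrite /outer_constant !exprMn; field.
by rewrite expf_neq0 ?gt_eqF.
Qed.

Lemma outer_big P (r : seq (dyadic n)) : T P -> uniq r ->
  (forall I, I \in r -> [/\ Cov I, subcube (near_cube I) P & len I <= C0 * ell P]) ->
  \sum_(I <- r | small_ratio * ell P <= len I) len I ^+ d <= big_count%:R * (C0 * ell P) ^+ d.
Proof.
move=> TP ur rP; have l0 := cube_len_gt0 P; have DP := region_D TP.
apply: big_seq_le_size.
- by rewrite exprn_ge0 // mulr_ge0 ?(ltW l0) // ltW // C0_gt0.
- apply: (@packing_cover _ (zeta P) (small_ratio * ell P)).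
  + by rewrite mulr_gt0 // small_ratio_gt0.
  + by rewrite filter_uniq.
  + move=> I; rewrite mem_filter => /andP[le /rP[CI nP lenI]]; split => //.
    rewrite mulrA divfK; last by rewrite gt_eqF // small_ratio_gt0.
    have [FQ Qy] := near_cubeP I; have [_ QP] := nP.
    have h1 := cube_outer DP (QP _ Qy); have h2 := near_le CI.
    have h3 := cube_len_gt0 (near_cube I).
    have t1 := edistance_triangle (near_pt I) (zeta P) (cover_pt I).
    rewrite [edistance (near_pt I) _]edistanceC in t1.
    have h4 : near_ratio * len I <= near_ratio * (C0 * ell P) by rewrite ler_pM2l // near_ratio_gt0.
    have h5 : n%:R * len I <= n%:R * (C0 * ell P) by rewrite ler_wpM2l.
    have -> : (near_ratio * C0 + 1 + n%:R * C0) * ell P =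
      near_ratio * (C0 * ell P) + ell P + n%:R * (C0 * ell P) by ring.
    lra.
- move=> I /rP[_ _ h] _; rewrite lerXn2r ?nnegrE ?dyadic_len_ge0 //.
  by rewrite mulr_ge0 ?(ltW l0) // ltW // C0_gt0.
Qed.

(** Cubes of the cover near [P] but marked by points outside of [P]: the child
    in the centre of [P] is too deep inside of [P] to have small ones near it,
    and its share of the mass pays for the large ones near [P]. *)
Lemma outer_sum P : T P -> forall r, uniq r ->
  (forall I, I \in r -> [/\ Cov I, subcube (near_cube I) P,
      ~ cube_set P (cover_pt I) & len I <= C0 * ell P]) ->
  \sum_(I <- r) len I ^+ d <= outer_constant * mass P.
Proof.
move=> TP; have := TP; have := region_gen TP; have := region_D TP; move: P {TP}.
have m0 := mass_constant_gt0; have o0 := outer_constant_ge0.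
(* a cube that is all of [E] has no marked points outside *)
have pre P r : T P -> uniq r ->
  (forall I, I \in r -> [/\ Cov I, subcube (near_cube I) P,
      ~ cube_set P (cover_pt I) & len I <= C0 * ell P]) ->
  (((c0 * ell P)%:E <= diameter E)%E ->
    \sum_(I <- r) len I ^+ d <= outer_constant * mass P) ->
  \sum_(I <- r) len I ^+ d <= outer_constant * mass P.
  move=> TP ur rP H; have DP := region_D TP.
  have [EP|] := pselect (E `<=` cube_set P); last first.
    by move=> /(cube_len_le_diameter DP); exact: H.
  case: r ur rP {H} => [|I r] _ rP; first by rewrite big_nil mulr_ge0 ?mass_ge0.
  have [CI _ nP _] := rP I (mem_head _ _).
  by have [Ex _ _] := cover_ptP CI; case: nP; exact: EP.
have minimal P : F P -> forall r, uniq r ->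
  (forall I, I \in r -> [/\ Cov I, subcube (near_cube I) P,
      ~ cube_set P (cover_pt I) & len I <= C0 * ell P]) ->
  \sum_(I <- r) len I ^+ d <= outer_constant * mass P.
  move=> FP r ur rP; have TP := minimal_region FP.
  apply: pre => // big; have DP := region_D TP.
  have -> : \sum_(I <- r) len I ^+ d = \sum_(I <- r | small_ratio * ell P <= len I) len I ^+ d.
    rewrite big_seq [RHS]big_seq_cond; apply: eq_bigl => I.
    case Ir: (I \in r) => //=; apply/esym.
    have [CI nP _ _] := rP I Ir; have [FQ _] := near_cubeP I.
    have PE : near_cube I = P by apply: minimal_eq nP => //; exact: minimal_region.
    have h := near_le CI; rewrite PE in h.
    have e0 := edistance_ge0 (cover_pt I) (near_pt I).
    apply: (@le_trans _ _ (small_ratio * (near_ratio * len I))).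
      by rewrite ler_pM2l ?small_ratio_gt0 //; lra.
    rewrite mulrA [small_ratio * _]mulrC near_small_ratio.
    by apply: ler_piMl; [exact: dyadic_len_ge0|have := rho_milli; lra].
  apply: (le_trans (outer_big TP ur _)); first by move=> I /rP[].
  rewrite outer_constantE ler_wpM2l //.
  apply: le_trans (mass_ge DP (region_gen TP) (half_core_lt_diameter big)).
  have lP0 := cube_len_ge0 P.
  have rl0 : 0 <= rho * ell P by rewrite mulr_ge0 // ltW.
  have rl1 : rho * ell P <= ell P by apply: ler_piMl => //; apply: ltW; exact: rho_lt1.
  by rewrite ler_pM2l // lerXn2r ?nnegrE.
move=> P DP gP; move: P DP gP.
apply: (@gen_ind (fun P => T P -> forall r, uniq r ->
  (forall I, I \in r -> [/\ Cov I, subcube (near_cube I) P,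
      ~ cube_set P (cover_pt I) & len I <= C0 * ell P]) ->
  \sum_(I <- r) len I ^+ d <= outer_constant * mass P)).
  move=> P DP gP TP; apply: minimal => //; apply: contrapT => /(region_children TP) [lt _ _].
  by rewrite gP ltxx in lt.
move=> P DP gP IH TP r ur rP.
have [FP|nFP] := pselect (F P); first exact: minimal ur rP.
apply: pre => // big.
have [_ massE TC] := region_children TP nFP.
have l0 := cube_len_gt0 P.
have [Pc CPc zPc] := central_child DP.
have lPc : ell Pc = rho * ell P by apply: cube_len_succ; case: CPc.
have small_near I : I \in r -> len I < small_ratio * ell P ->
    ell (near_cube I) + edistance (cover_pt I) (near_pt I) <= rho / 1000%:R * ell P.
  move=> /rP[CI _ _ _] lt; apply: (le_trans (near_le CI)).
  by rewrite -near_small_ratio -mulrA ler_pM2l ?near_ratio_gt0 // ltW.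
pose rs := [seq I <- r | ~~ (small_ratio * ell P <= len I)].
have urs : uniq rs by rewrite filter_uniq.
have rsP I : I \in rs -> I \in r /\ len I < small_ratio * ell P.
  by rewrite mem_filter -ltNge => /andP[].
have small : \sum_(I <- rs) len I ^+ d <= outer_constant * (mass P - mass Pc).
  apply: (le_trans (@big_seq_le_cover R _ _ rs (children P)
     (fun C I => `[< subcube (near_cube I) C >]) _ _ _)).
  - by move=> I _; rewrite exprn_ge0 // dyadic_len_ge0.
  - move=> I /rsP[Ir lt]; have [CI nP _ _] := rP I Ir; have [FQ _] := near_cubeP I.
    have nQ : near_cube I <> P.
      move=> QE; have h := small_near I Ir lt; rewrite QE in h.
      have e0 := edistance_ge0 (cover_pt I) (near_pt I).
      have h2 : rho / 1000%:R * ell P < 2000%:R^-1 * ell P by rewrite ltr_pM2r // rho_milli.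
      lra.
    have [C CC QC] := subcube_child (minimal_D FQ) DP nP nQ.
    by exists C; [exact/childrenP|exact/asboolP].
  have Pcr : Pc \in children P by exact/childrenP.
  have uch : uniq (children P) by exact: fset_uniq.
  have -> : mass P - mass Pc = \sum_(C <- children P | C != Pc) mass C.
    by rewrite massE (bigD1_seq Pc) //= addrAC subrr add0r.
  rewrite (bigD1_seq Pc) //= big_seq_cond big1 ?add0r; last first.
    move=> I /andP[/rsP[Ir lt] /asboolP nPc].
    have [CI _ nxP _] := rP I Ir; case: nxP; have [Ex _ _] := cover_ptP CI.
    apply: cube_inner => //; have [_ Qy] := near_cubeP I; have [_ QPc] := nPc.
    have DPc : D Pc by case: CPc.
    have h1 := cube_outer DPc (QPc _ Qy); rewrite zPc lPc in h1.
    have h := small_near I Ir lt; have h3 := cube_len_gt0 (near_cube I).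
    have t1 := edistance_triangle (near_pt I) (zeta P) (cover_pt I).
    rewrite [edistance (near_pt I) _]edistanceC in t1.
    have h2 : rho / 1000%:R * ell P < 2000%:R^-1 * ell P by rewrite ltr_pM2r // rho_milli.
    have h4 : rho * ell P < 1000%:R^-1 * ell P by rewrite ltr_pM2r.
    have -> : c0 * ell P = 500%:R^-1 * ell P by [].
    lra.
  rewrite mulr_sumr big_seq_cond [leRHS]big_seq_cond; apply: ler_sum => C /andP[/(childrenP _ DP) CC _].
  have [DC gC CP] := CC.
  rewrite -big_filter; apply: (IH C CC (TC C CC)); first by rewrite filter_uniq.
  move=> I; rewrite mem_filter => /andP[/asboolP QC /rsP[Ir lt]].
  have [CI _ nxP _] := rP I Ir; split => //; first by move=> /CP.
  rewrite (cube_len_succ gC) mulrA; apply: (le_trans (ltW lt)); rewrite ler_pM2r //.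
  apply: (le_trans small_ratio_le_rho); rewrite ler_peMl ?(ltW rho_gt0) //.
  by have := C0_gt4; lra.
have large : \sum_(I <- r | small_ratio * ell P <= len I) len I ^+ d <= outer_constant * mass Pc.
  apply: (le_trans (outer_big TP ur _)); first by move=> I /rP[].
  have DPc : D Pc by case: CPc.
  rewrite outer_constantE -lPc ler_wpM2l //; apply: mass_ge => //.
    by apply: region_gen; exact: TC.
  apply: half_core_lt_diameter; apply: le_trans big.
  rewrite lee_fin ler_wpM2l ?(ltW c_cube_gt0) // lPc ler_piMl ?(ltW l0) //.
  by rewrite ltW // rho_lt1.
rewrite (bigID (fun I => small_ratio * ell P <= len I)) /=.
rewrite -[X in _ + X <= _]big_filter -/rs.
by apply: (le_trans (lerD large small)); rewrite -mulrDr addrC subrK.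
Qed.

Lemma gen_le_of_len Q Q' : ell Q <= 2%:R * ell Q' -> gen Q' <= gen Q.
Proof.
move=> le; rewrite leNgt; apply/negP => lt.
(* only the generation of this cube matters *)
pose Q1 : gcube R n := (gen Q + 1, set0).
have h1 : ell Q1 = rho * ell Q by apply: cube_len_succ.
have h2 : ell Q' <= ell Q1 by rewrite cube_len_le -[gen Q1]/(gen Q + 1); lia.
have h3 : rho * ell Q < 1000%:R^-1 * ell Q by rewrite ltr_pM2r // cube_len_gt0.
have := cube_len_gt0 Q; lra.
Qed.

Definition minimal_count : R := (packing_number n (20%:R : R))%:R.
Definition inner_constant : R :=
  minimal_count * ((packing_number n (2%:R * near_ratio))%:R + 2%:R * outer_constant).

Lemma inner_constant_ge0 : 0 <= inner_constant.
Proof.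
by rewrite mulr_ge0 // /minimal_count ?ler0n // addr_ge0 // mulr_ge0 // outer_constant_ge0.
Qed.

(** The cubes of the cover marked by points of one minimal cube [Q] are near the
    boundedly many cubes of the region around [Q] of the generation of [Q]. They
    are comparable to [Q] if they are near [Q] itself; otherwise their marked
    points lie outside of the cube they are near to. *)
Lemma inner_sum Q r : F Q -> uniq r ->
  (forall I, I \in r -> Cov I /\ cube_set Q (cover_pt I)) ->
  \sum_(I <- r) len I ^+ d <= inner_constant * ell Q ^+ d.
Proof.
move=> FQ ur rQ; have DQ := minimal_D FQ; have l0 := cube_len_gt0 Q.
have TQ := minimal_region FQ.
have o0 := outer_constant_ge0.
have fI I : I \in r -> f (cover_pt I) <= ell Q.
  by move=> /rQ[CI Qx]; have := dist_min_le (cover_pt I) FQ Qx; rewrite edistancexx addr0.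
have lenI I : I \in r -> len I <= ell Q / 2%:R /\ n%:R * len I <= ell Q / 2%:R.
  move=> Ir; have [CI _] := rQ I Ir; have [_ _ Ix] := cover_ptP CI.
  have h := cover_len_le CI Ix.
  have f0 := dist_min_gt0 (cover_pt I); have h2 := fI I Ir.
  have h3 : t * f (cover_pt I) <= 2%:R^-1 * f (cover_pt I) by rewrite ler_pM2r // t_le_half.
  have h4 : n%:R * len I <= n%:R * (t * f (cover_pt I)) by rewrite ler_wpM2l.
  have h5 : n%:R * (t * f (cover_pt I)) <= 2%:R^-1 * f (cover_pt I).
    by rewrite mulrA ler_pM2r // n_t_le_half.
  by split; lra.
pose A := [set P | [/\ T P, gen P = gen Q & edistance (zeta Q) (zeta P) <= 4%:R * ell Q]].
have packA (l : seq (gcube R n)) : uniq l -> (forall P, P \in l -> A P) ->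
    (size l <= packing_number n (20%:R : R))%N.
  move=> ul lA; apply: (@packing_cubes l (gen Q) (zeta Q)) => // P /lA[TP gP h]; split => //.
    exact: region_D.
  apply: (le_trans h); have -> // : 4%:R * ell Q = 20%:R * rho ^ gen Q.
  by rewrite /cube_len mulrA -natrM.
have finA : finite_set A by apply: finite_of_packing packA.
apply: (le_trans (@big_seq_le_cover R _ _ r (fset_set A)
     (fun P I => `[< subcube (near_cube I) P >]) _ _ _)).
- by move=> I _; rewrite exprn_ge0 // dyadic_len_ge0.
- move=> I Ir; have [CI Qx] := rQ I Ir; have [FN Ny] := near_cubeP I.
  have h := near_le2 I; have h2 := fI I Ir.
  have e0 := edistance_ge0 (cover_pt I) (near_pt I).
  have gN : gen Q <= gen (near_cube I) by apply: gen_le_of_len; lra.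
  have [P [TP gP NP]] := region_ancestor (minimal_region FN) (region_top_gen TQ) gN.
  exists P; last exact/asboolP.
  apply/(fset_setP _ finA); split => //.
  have [_ NPs] := NP; have h3 := cube_outer (region_D TP) (NPs _ Ny).
  have lP : ell P = ell Q by rewrite /cube_len gP.
  rewrite lP in h3; have h4 := cube_outer DQ Qx; have h5 := cube_len_gt0 (near_cube I).
  have t1 := edistance_triangle (cover_pt I) (zeta Q) (zeta P).
  have t2 := edistance_triangle (near_pt I) (cover_pt I) (zeta P).
  rewrite [edistance (near_pt I) (zeta P)]edistanceC in t2; lra.
rewrite /inner_constant -mulrA /minimal_count.
have -> : \sum_(P <- fset_set A) \sum_(I <- r | `[< subcube (near_cube I) P >]) len I ^+ d =
   \sum_(P <- fset_set A | xpredT P) \sum_(I <- r | `[< subcube (near_cube I) P >]) len I ^+ d by [].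
apply: big_seq_le_size.
- by rewrite mulr_ge0 ?exprn_ge0 ?(ltW l0) // addr_ge0 // mulr_ge0.
- rewrite filter_predT; apply: packA; first exact: fset_uniq.
  by move=> P /(fset_setP _ finA).
move=> P /(fset_setP _ finA) [TP gP _] _.
have lP : ell P = ell Q by rewrite /cube_len gP.
have [PQ|PQ] := pselect (P = Q).
  have ld0 : 0 <= ell Q ^+ d by rewrite exprn_ge0 // ltW.
  have o2 : 0 <= 2%:R * outer_constant by rewrite mulr_ge0.
  rewrite mulrDl -[leLHS]addr0; apply: lerD; last exact: mulr_ge0.
  apply: big_seq_le_size; first by rewrite exprn_ge0 // ltW.
    apply: (@packing_cover _ (zeta Q) (ell Q / near_ratio)).
    + by rewrite divr_gt0 // near_ratio_gt0.
    + by rewrite filter_uniq.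
    + move=> I; rewrite mem_filter => /andP[/asboolP nP Ir].
      have [CI Qx] := rQ I Ir; have [FN Ny] := near_cubeP I; split => //.
        have NQ : near_cube I = Q.
          by apply: minimal_eq => //; [exact: minimal_region|rewrite -PQ].
        have h := near_le CI; rewrite NQ in h.
        have e0 := edistance_ge0 (cover_pt I) (near_pt I).
        by rewrite ler_pdivrMr ?near_ratio_gt0 // mulrC; lra.
      have -> : 2%:R * near_ratio * (ell Q / near_ratio) = 2%:R * ell Q.
        by field; rewrite gt_eqF // near_ratio_gt0.
      have [_ h2] := lenI I Ir; have h4 := cube_outer DQ Qx; lra.
  move=> I Ir _; rewrite lerXn2r ?nnegrE ?dyadic_len_ge0 ?(ltW l0) //.
  by have [h _] := lenI I Ir; lra.
rewrite -big_filter; apply: (@le_trans _ _ (outer_constant * mass P)).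
  apply: outer_sum => //; first by rewrite filter_uniq.
  move=> I; rewrite mem_filter => /andP[/asboolP nP Ir].
  have [CI Qx] := rQ I Ir; split => //.
    by move=> Px; apply: PQ; apply: cube_eq Px Qx => //; exact: region_D.
  rewrite lP; have [h _] := lenI I Ir; apply: (le_trans h).
  rewrite mulrC ler_pM2r //; have := C0_gt4; lra.
apply: (@le_trans _ _ (outer_constant * (2%:R * ell P ^+ d))).
  by rewrite ler_wpM2l // mass_le.
rewrite lP mulrA [outer_constant * _]mulrC ler_wpM2r ?exprn_ge0 ?(ltW l0) //.
by rewrite lerDr.
Qed.

Definition local_count : R := ((packing_number n (5%:R * (n.+3)%:R : R)).+1)%:R.
Definition tree_constant : R :=
  2%:R * outer_constant + inner_constant * (1 + 2%:R / mass_constant).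
Definition local_constant : R := local_count * (tree_constant * (near_ratio / rho) ^+ d).

Lemma tree_constant_ge0 : 0 <= tree_constant.
Proof.
have m0 := mass_constant_gt0.
apply: addr_ge0; first by apply: mulr_ge0; [exact: ler0n|exact: outer_constant_ge0].
apply: mulr_ge0; first exact: inner_constant_ge0.
apply: addr_ge0; first exact: ler01.
by apply: divr_ge0; [exact: ler0n|exact: ltW].
Qed.

(** A marked point is outside of [P], or in one of the minimal cubes below [P]. *)
Lemma tree_sum P r : T P -> uniq r ->
  (forall I, I \in r -> [/\ Cov I, subcube (near_cube I) P & len I <= C0 * ell P]) ->
  \sum_(I <- r) len I ^+ d <= tree_constant * ell P ^+ d.
Proof.
move=> TP ur rP; have m0 := mass_constant_gt0; have l0 := cube_len_ge0 P.
rewrite (bigID (fun I => `[< cube_set P (cover_pt I) >])) /= addrC mulrDl; apply: lerD.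
  rewrite -big_filter; apply: (@le_trans _ _ (outer_constant * mass P)).
    apply: outer_sum => //; first by rewrite filter_uniq.
    by move=> I; rewrite mem_filter => /andP[/asboolPn nx /rP[CI nP h]].
  have -> : 2%:R * outer_constant * ell P ^+ d = outer_constant * (2%:R * ell P ^+ d) by ring.
  by apply: ler_wpM2l; [exact: outer_constant_ge0|exact: mass_le].
rewrite -big_filter; set r' := [seq I <- r | _].
have ur' : uniq r' by rewrite filter_uniq.
have r'P I : I \in r' -> Cov I /\ cube_set P (cover_pt I).
  by rewrite mem_filter => /andP[/asboolP Px /rP[CI _ _]].
pose q (I : dyadic n) : gcube R n := xget QT [set Q | [/\ F Q, cube_set Q (cover_pt I) & subcube Q P]].
have qP I : I \in r' -> [/\ F (q I), cube_set (q I) (cover_pt I) & subcube (q I) P].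
  move=> /r'P[CI Px]; rewrite /q; case: xgetP => [Q _ //|none].
  by have [Q HQ] := region_minimal_at TP Px; have := none Q.
pose B := undup (map q r').
apply: (@le_trans _ _ (\sum_(Q <- B) inner_constant * ell Q ^+ d)); last first.
  have -> : inner_constant * (1 + 2%:R / mass_constant) * ell P ^+ d =
    inner_constant * ((1 + 2%:R / mass_constant) * ell P ^+ d) by ring.
  rewrite -mulr_sumr; apply: ler_wpM2l; first exact: inner_constant_ge0.
  apply: minimal_sum_len => //; first exact: undup_uniq.
  by move=> Q; rewrite mem_undup => /mapP[I /qP[FQ _ QP] ->].
apply: (le_trans (@big_seq_le_cover R _ _ r' B (fun Q I => q I == Q) _ _ _)).
- by move=> I _; rewrite exprn_ge0 // dyadic_len_ge0.
- by move=> I Ir; exists (q I) => //; rewrite mem_undup map_f.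
rewrite big_seq [leRHS]big_seq; apply: ler_sum => Q.
rewrite mem_undup => /mapP[I0 I0r QE]; have [FQ _ _] := qP I0 I0r; rewrite -QE in FQ.
rewrite -big_filter; apply: inner_sum => //; first by rewrite filter_uniq.
move=> I; rewrite mem_filter => /andP[/eqP qI Ir]; have [CI _] := r'P I Ir.
by split => //; have [_ + _] := qP I Ir; rewrite qI.
Qed.

(** The cubes near a ball are distributed among the boundedly many cubes of the
    region near the ball whose size is comparable to the radius, or the top. *)
Lemma local_sum xi rad r : 0 < rad -> uniq r ->
  (forall I, I \in r -> [/\ Cov I, len I < rad &
      edistance xi (cover_pt I) <= n.+1%:R * rad]) ->
  \sum_(I <- r) len I ^+ d <= local_constant * rad ^+ d.
Proof.
move=> rad0 ur rI; have L12 := near_ratio_ge12; have L0 := near_ratio_gt0.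
have Lr0 : 0 < near_ratio * rad / 5%:R by rewrite divr_gt0 // mulr_gt0.
have inv1 : 1 < rho^-1 by rewrite invf_gt1 // rho_lt1.
have [k [k1 k2]] := integer_log inv1 Lr0.
rewrite !exprz_inv in k1 k2.
pose kr := - (k + 1).
have kr1 : near_ratio * rad < 5%:R * rho ^ kr.
  by move: k2; rewrite ltr_pdivrMr ?ltr0n // [_ * 5%:R]mulrC.
have kr2 : 5%:R * rho ^ kr <= near_ratio * rad / rho.
  rewrite ler_pdivlMr //; move: k1; rewrite ler_pdivlMr ?ltr0n //.
  have -> : - k = kr + 1 by rewrite /kr opprD subrK.
  rewrite expfzDr ?gt_eqF // expr1z; lra.
pose ks := Num.max (gen QT) kr.
pose L : R := 5%:R * rho ^ ks.
have lL P : gen P = ks -> ell P = L by rewrite /cube_len /L => ->.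
have L_le : L <= near_ratio * rad / rho.
  apply: le_trans kr2; rewrite /L.
  have := @cube_len_le (kr, set0) (ks, set0); rewrite /cube_len /generation /= => ->.
  by rewrite le_max lexx orbT.
have L_gt0 : 0 < L by rewrite /L mulr_gt0 // exprz_gt0.
have L_d : L ^+ d <= (near_ratio / rho) ^+ d * rad ^+ d.
  have LE : L <= near_ratio / rho * rad by rewrite mulrAC.
  have r0 : 0 <= near_ratio / rho * rad by apply: le_trans LE; exact: ltW.
  by rewrite -exprMn; apply: lerXn2r; rewrite ?nnegrE ?(ltW L_gt0).
have near_lt I : I \in r -> ell (near_cube I) + edistance (cover_pt I) (near_pt I) < near_ratio * rad.
  move=> /rI[CI lt _]; apply: (le_lt_trans (near_le CI)); by rewrite ltr_pM2l.
have gnear I : I \in r -> ks <= gen (near_cube I).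
  move=> Ir; have [FN _] := near_cubeP I; rewrite ge_max; apply/andP; split.
    by apply: region_top_gen; exact: minimal_region.
  have := @cube_len_le (kr, set0) (near_cube I); rewrite {2}/generation /= => <-.
  have := near_lt I Ir; have := edistance_ge0 (cover_pt I) (near_pt I).
  have -> : ell (kr, set0) = 5%:R * rho ^ kr by [].
  lra.
have [top|notop] := leP kr (gen QT).
  have ksE : ks = gen QT by rewrite /ks; apply/max_idPl.
  have lQT := lL QT (esym ksE).
  apply: (@le_trans _ _ (tree_constant * ell QT ^+ d)).
    apply: tree_sum => //; first exact: str_top str.
    move=> I /rI[CI _ _]; have [FN _] := near_cubeP I; split => //.
      by apply: (str_max str); exact: minimal_region.
    exact: cover_len_le_C0.
  rewrite /local_constant -mulrA -[X in X <= _]mul1r; apply: ler_pM => //.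
  - by rewrite mulr_ge0 ?tree_constant_ge0 // exprn_ge0 // cube_len_ge0.
  - by rewrite /local_count ler1n.
  - by rewrite lQT -mulrA; apply: ler_wpM2l; first exact: tree_constant_ge0.
have ksE : ks = kr by rewrite /ks; apply/max_idPr; exact: ltW.
pose A := [set P | [/\ T P, gen P = ks & edistance xi (zeta P) <= n.+3%:R * L]].
have packA (l : seq (gcube R n)) : uniq l -> (forall P, P \in l -> A P) ->
    (size l <= packing_number n (5%:R * n.+3%:R : R))%N.
  move=> ul lA; apply: (@packing_cubes l ks xi) => // P /lA[TP gP h]; split => //.
    exact: region_D.
  by apply: (le_trans h); rewrite /L mulrCA mulrA.
have finA : finite_set A by apply: finite_of_packing packA.
have radL : rad <= L.
  rewrite /L ksE; apply: ltW; apply: le_lt_trans kr1.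
  by rewrite ler_peMl ?(ltW rad0) //; lra.
apply: (le_trans (@big_seq_le_cover R _ _ r (fset_set A)
     (fun P I => `[< subcube (near_cube I) P >]) _ _ _)).
- by move=> I _; rewrite exprn_ge0 // dyadic_len_ge0.
- move=> I Ir; have [CI lt h] := rI I Ir; have [FN Ny] := near_cubeP I.
  have TN := minimal_region FN.
  have gQTk : gen QT <= ks by rewrite ksE ltW.
  have [P [TP gP NP]] := region_ancestor TN gQTk (gnear I Ir).
  exists P; last exact/asboolP.
  apply/(fset_setP _ finA); split => //.
  have [_ NPs] := NP; have h3 := cube_outer (region_D TP) (NPs _ Ny).
  rewrite (lL P gP) in h3; have h5 := cube_len_gt0 (near_cube I).
  have h6 := near_lt I Ir.
  have t1 := edistance_triangle (cover_pt I) xi (zeta P).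
  have t2 := edistance_triangle (near_pt I) (cover_pt I) (zeta P).
  rewrite [edistance (near_pt I) (zeta P)]edistanceC in t2.
  have h7 : n.+1%:R * rad <= n.+1%:R * L by rewrite ler_wpM2l.
  have h8 : near_ratio * rad < L by rewrite /L ksE.
  have -> : n.+3%:R * L = n.+1%:R * L + L + L.
    by rewrite -[n.+3%:R]natr1 -[n.+2%:R]natr1; ring.
  lra.
rewrite /local_constant -mulrA.
apply: (@le_trans _ _ ((packing_number n (5%:R * n.+3%:R : R))%:R * (tree_constant * L ^+ d))); last first.
  apply: ler_pM => //.
  - by rewrite mulr_ge0 ?tree_constant_ge0 // exprn_ge0 // ltW.
  - by rewrite /local_count ler_nat.
  - by rewrite -mulrA; apply: ler_wpM2l; first exact: tree_constant_ge0.
have -> : \sum_(P <- fset_set A) \sum_(I <- r | `[< subcube (near_cube I) P >]) len I ^+ d =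
   \sum_(P <- fset_set A | xpredT P) \sum_(I <- r | `[< subcube (near_cube I) P >]) len I ^+ d by [].
apply: big_seq_le_size.
- by rewrite mulr_ge0 ?tree_constant_ge0 // exprn_ge0 // ltW.
- rewrite filter_predT; apply: packA; first exact: fset_uniq.
  by move=> P /(fset_setP _ finA).
move=> P /(fset_setP _ finA) [TP gP _] _; rewrite -(lL P gP) -big_filter.
apply: tree_sum => //; first by rewrite filter_uniq.
move=> I; rewrite mem_filter => /andP[/asboolP nP Ir]; have [CI lt _] := rI I Ir; split => //.
rewrite (lL P gP); apply: (le_trans (ltW lt)); apply: (le_trans radL).
rewrite ler_peMl ?(ltW L_gt0) //; have := C0_gt4; lra.
Qed.

Definition upper_constant : R :=
  (packing_number n (2%:R * n.+1%:R : R))%:R * ((4 ^ n)%:R * n%:R ^+ d) +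
  (4 ^ n)%:R * n%:R ^+ d * local_constant.

(** Large cubes contribute only skeleta of a dyadic grid at the scale of the
    ball. *)
Lemma upper_regular xi rad : 0 < rad ->
  (hausdorff_measure d (cball xi rad `&` ET) <= (upper_constant * rad ^+ d)%:E)%E.
Proof.
move=> rad0; have two1 : (1 : R) < 2%:R by rewrite ltr1n.
have [s [s1 s2]] := integer_log two1 rad0.
pose CL := [set I | Cov I /\ s <= I.1].
pose A := [set I | [/\ Cov I, I.1 < s & edistance xi (cover_pt I) <= n.+1%:R * rad]].
have finA : finite_set A by apply: sub_finite_set finite_cover => I [].
set r := enum_fset (fset_set A).
have rA I : I \in r -> A I by move/(fset_setP _ finA).
have lenA I : A I -> len I < rad.
  move=> [_ lt _]; apply: lt_le_trans s1.
  by rewrite /dyadic_len ltr_eXz2l.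
pose V (b : bool) := if b then cball xi rad `&` @dyadic_skeleton R n d CL
  else [set x | exists2 I, I \in r & @skeleton R n d I x].
pose b1 (b : bool) : R := if b then
   (packing_number n (2%:R * n.+1%:R : R))%:R * ((4 ^ n)%:R * (n%:R * rad) ^+ d)
  else \sum_(I <- r) (4 ^ n)%:R * (n%:R * len I) ^+ d.
have H := @hausdorff_measure_le_sum R n d d_gt0 _ [:: true; false] V b1 (cball xi rad `&` ET).
apply: (le_trans (H _ _)).
- move=> x [xb [I CI Ix]]; have [le|lt] := leP s I.1.
    by exists true => //; split => //; exists I.
  exists false; first by rewrite !inE.
  exists I => //; apply/(fset_setP _ finA); split => //.
  have [_ _ Ip] := cover_ptP CI.
  have h := dyadic_hull_edistance (skeleton_hull Ix) (dyadic_set_hull Ip).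
  apply: (le_trans (edistance_triangle x _ _)).
  have h2 : n%:R * len I <= n%:R * rad.
    rewrite ler_wpM2l //; apply: ltW; apply: lt_le_trans s1.
    by rewrite /dyadic_len ltr_eXz2l.
  rewrite /cball /= in xb; rewrite -natr1 mulrDl mul1r; lra.
- case=> _; rewrite /V /b1.
    apply: (hausdorff_measure_large_skeleton_le d_gt0 xi s1) => //; last by move=> I [].
    by apply: ltW; apply: (lt_le_trans s2); rewrite expfzDr // expr1z mulrC.
  apply: (@hausdorff_measure_le_sum R n d d_gt0 _ r (@skeleton R n d)) => //.
  by move=> I _; exact: hausdorff_measure_skeleton_le.
rewrite !big_cons big_nil addr0 lee_fin /b1 /upper_constant [leRHS]mulrDl; apply: lerD.
  by rewrite exprMn !mulrA.
have -> : \sum_(I <- r) (4 ^ n)%:R * (n%:R * len I) ^+ d =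
   (4 ^ n)%:R * n%:R ^+ d * \sum_(I <- r) len I ^+ d.
  by rewrite mulr_sumr; apply: eq_bigr => I _; rewrite exprMn mulrA.
rewrite -[leRHS]mulrA ler_wpM2l ?mulr_ge0 ?exprn_ge0 //.
apply: (@local_sum xi) => //; first exact: fset_uniq.
move=> I /rA AI; have lt := lenA I AI; by case: AI.
Qed.

(** * Properties of the cover *)

Definition ahlfors_constant : R := lower_constant^-1 + upper_constant.

Lemma upper_constant_ge0 : 0 <= upper_constant.
Proof.
have c4 : (0 : R) <= (4 ^ n)%:R * n%:R ^+ d by rewrite mulr_ge0 // exprn_ge0.
apply: addr_ge0; first by apply: mulr_ge0 => //; exact: ler0n.
apply: mulr_ge0 => //; apply: mulr_ge0; first exact: ler0n.
apply: mulr_ge0; first exact: tree_constant_ge0.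
by apply: exprn_ge0; apply: divr_ge0; apply: ltW; first exact: near_ratio_gt0.
Qed.

Lemma cover_ahlfors : ahlfors_regular d ahlfors_constant ET.
Proof.
have l0 := lower_constant_gt0; have u0 := upper_constant_ge0.
have K0 : 0 < ahlfors_constant by rewrite /ahlfors_constant ltr_pwDl // invr_gt0.
split => // xi r xiE r0 rE; have rd : 0 <= r ^+ d by rewrite exprn_ge0 // ltW.
split.
  apply: le_trans (lower_regular xiE r0 rE); rewrite lee_fin mulrC ler_wpM2r //.
  by rewrite -[leRHS]invrK lef_pV2 ?posrE ?invr_gt0 // lerDl.
apply: le_trans (upper_regular xi r0) _; rewrite lee_fin ler_wpM2r //.
by rewrite lerDr invr_ge0 ltW.
Qed.

Lemma cover_properties (tau K2 : R) : 0 < tau -> 0 < K2 ->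
  n%:R * t <= K2 * tau -> t <= K2 * tau -> 3%:R * tau <= K2 * t ->
  let dF := d_family rho F in
  let BT := fun lam : R => cball (zeta QT) (lam * ell QT) in
  [/\ trivIset Cov dset,
      BT C0 `&` E `<=` \bigcup_(I in Cov) dset I /\
      \bigcup_(I in Cov) dset I `<=` BT (2%:R * C0),
      forall x, E x -> BT C0 x -> (dist_set x ET <= (K2 * tau)%:E * dF x)%E &
      forall I, Cov I ->
        let m := ereal_inf [set dF x | x in dset I] in
        ((len I)%:E <= (K2 * tau)%:E * m)%E /\
        (tau%:E * m <= (K2 * len I)%:E)%E].
Proof.
move=> tau0 K0 h1 h2 h3 dF BT; have Kt0 : 0 < K2 * tau by rewrite mulr_gt0.
split.
- by move=> I J CI CJ [x [Ix Jx]]; exact: cover_disjoint Ix Jx.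
- split; first by move=> x [xB Ex]; have [I CI Ix] := cover_covers Ex xB; exists I.
  by move=> x [I CI Ix]; exact: cover_hull_ball CI (dyadic_set_hull Ix).
- move=> x Ex xB; have [I CI Ix] := cover_covers Ex xB.
  rewrite /dF dist_minE -EFinM.
  apply: (@le_trans _ _ (edistance x (dyadic_corner_pt R I))%:E).
    apply: ereal_inf_lbound; exists (dyadic_corner_pt R I) => //.
    by exists I => //; exact: skeleton_corner_pt.
  rewrite lee_fin; apply: (@le_trans _ _ (n%:R * len I)).
    by apply: dyadic_hull_edistance; apply: dyadic_set_hull => //; exact: mem_dyadic_corner_pt.
  apply: (@le_trans _ _ (n%:R * (t * f x))); first by rewrite ler_wpM2l // cover_len_le.
  by rewrite mulrA ler_pM2r // dist_min_gt0.
move=> I CI m.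
have m_ge : ((len I / (K2 * tau))%:E <= m)%E.
  apply: le_ereal_inf_tmp => _ [x Ix <-]; rewrite /dF dist_minE lee_fin ler_pdivrMr // mulrC.
  apply: (le_trans (cover_len_le CI Ix)); by rewrite ler_pM2r // dist_min_gt0.
have m_le : (m <= (f (dyadic_corner_pt R I))%:E)%E.
  apply: ereal_inf_lbound; exists (dyadic_corner_pt R I); first exact: mem_dyadic_corner_pt.
  by rewrite /dF dist_minE.
split.
  have -> : (len I)%:E = ((K2 * tau)%:E * (len I / (K2 * tau))%:E)%E.
    by rewrite -EFinM mulrC divfK // gt_eqF.
  by apply: lee_wpmul2l => //; rewrite lee_fin ltW.
apply: (@le_trans _ _ (tau%:E * (f (dyadic_corner_pt R I))%:E)%E).
  by apply: lee_wpmul2l => //; rewrite lee_fin ltW.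
rewrite -EFinM lee_fin.
have h := cover_len_ge CI (@mem_dyadic_corner_pt R n I).
have f0 := dist_min_gt0 (dyadic_corner_pt R I).
rewrite -(ler_pM2l (ltr0Sn R 2)) mulrA.
apply: (@le_trans _ _ (K2 * t * f (dyadic_corner_pt R I))); first by rewrite ler_pM2r.
by rewrite -mulrA [leRHS]mulrCA ler_pM2l.
Qed.

End Cover.
End Region.
End Mass.
End Cubes.

(* K1 bounds the packing sum, KA C0 tau is the Ahlfors constant, and K2 tau0 is
   the constant of the two comparisons with dF, uniform in 0 < tau <= tau0. *)
Theorem mainTheorem3 (R : realType) (n : nat) :
  exists K2 : R -> R, (forall tau0, 0 < K2 tau0) /\
  forall (d : nat) (c rho : R),
    (0 < d)%N -> (d < n)%N -> 0 < c -> 0 < rho -> rho < 1000%:R^-1 ->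
  exists (K1 : R) (KA : R -> R -> R), 0 < K1 /\
  forall (k0 : nat) (E : set 'rV[R]_n) (X : int -> set 'rV[R]_n)
    (D : set (gcube R n)) (zeta : gcube R n -> 'rV[R]_n) (Q0 : gcube R n),
    (0 < k0)%N -> lower_content_regular d c E ->
    christ_david rho E X D zeta -> D Q0 -> generation Q0 = 0 ->
  exists (Top : set (gcube R n)) (Tree : gcube R n -> set (gcube R n)),
  [/\ tree_partition D (cubes_upto D Q0 k0) Top Tree,
      ((c_cube R * cube_len rho Q0)%:E <= diameter E)%E ->
      (\esum_(Q in Top) (cube_len rho Q ^+ d)%:E
         <= K1%:E * hausdorff_measure d (cube_set Q0))%E &
      forall (Q : gcube R n) (T : set (gcube R n)) (QT : gcube R n),
        Top Q -> T `<=` Tree Q -> stopping_time_region D T QT ->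
      forall C0 tau tau0 : R, 4%:R < C0 -> 0 < tau -> tau <= tau0 ->
      let dF := d_family rho (minimal_cubes T) in
      let BT := fun lam : R => cball (zeta QT) (lam * cube_len rho QT) in
      exists C : set (dyadic n),
      let ET := @dyadic_skeleton R n d C in
      [/\ trivIset C (@dyadic_set R n),
          ahlfors_regular d (KA C0 tau) ET,
          BT C0 `&` E `<=` \bigcup_(I in C) @dyadic_set R n I /\
          \bigcup_(I in C) @dyadic_set R n I `<=` BT (2%:R * C0),
          forall x, E x -> BT C0 x ->
            (dist_set x ET <= (K2 tau0 * tau)%:E * dF x)%E &
          forall I, C I ->
            let m := ereal_inf [set dF x | x in @dyadic_set R n I] in
            ((dyadic_len R I)%:E <= (K2 tau0 * tau)%:E * m)%E /\
            (tau%:E * m <= (K2 tau0 * dyadic_len R I)%:E)%E]].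
Proof.
(* 3 from the maximality of the dyadic cubes, 2 from the definition of [t] below *)
exists (fun tau0 => 6%:R * n.+1%:R * (1 + `|tau0|)); split.
  by move=> tau0; rewrite mulr_gt0 ?ltr_pwDl // mulr_gt0.
move=> d c rho d0 dn c0 rho0 rho1.
(* [t tau] bounds the ratio of sides to distances: it is comparable to [tau] while
   [tau <= tau0] and depends on [tau] alone; [n * t tau <= 1 / 2] makes the distance
   vary little over a dyadic cube *)
pose t (tau : R) := tau / (2%:R * n.+1%:R * (1 + tau)).
exists (packing_constant d c), (fun C0 tau => ahlfors_constant n rho d c C0 (t tau)).
split; first exact: packing_constant_gt0.
move=> k0 E X D zeta Q0 _ reg CD DQ0 gQ0.
exists (tops rho D d k0 Q0), (tree rho D d k0 Q0); split.
- exact: (tree_partition_tops rho0 rho1 CD).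
- exact: (tops_packing rho0 rho1 CD k0 d0 c0 reg DQ0 gQ0).
move=> Q T QT _ TQ str C0 tau tau0 C04 tau_gt0 tau_le dF BT.
have n0 : (0 : R) < n.+1%:R by [].
have tau1 : 0 < 1 + tau by rewrite ltr_pwDl // ltW.
have den : 0 < 2%:R * n.+1%:R * (1 + tau) by rewrite !mulr_gt0.
have t0 : 0 < t tau by rewrite divr_gt0.
have tE : t tau * (2%:R * n.+1%:R) * (1 + tau) = tau.
  by rewrite -mulrA divfK // gt_eqF.
have t1 : t tau * (2%:R * n.+1%:R) <= 1.
  rewrite -(ler_pM2r tau1) tE mul1r lerDr; exact: ler01.
exists (cover_cubes rho E zeta T QT C0 (t tau)) => ET.
set K2 : R := 6%:R * n.+1%:R * (1 + `|tau0|).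
have abs0 := normr_ge0 tau0.
have K0 : 0 < K2 by rewrite mulr_gt0 ?ltr_pwDl // mulr_gt0.
have nt : n.+1%:R * t tau <= tau.
  rewrite -[leRHS]tE; have -> : t tau * (2%:R * n.+1%:R) * (1 + tau) =
    n.+1%:R * t tau + n.+1%:R * t tau * (1 + 2%:R * tau) by ring.
  have nt0 : 0 <= n.+1%:R * t tau by apply: mulr_ge0; apply: ltW.
  by rewrite lerDl; apply: mulr_ge0 => //; lra.
have K1 : 1 <= K2.
  have : 1 <= n.+1%:R * (1 + `|tau0|).
    apply: (@le_trans _ _ (1 * 1)); first by rewrite mulr1.
    by apply: ler_pM => //; [rewrite ler1n|rewrite lerDl].
  rewrite /K2 -mulrA; lra.
have tauK : tau <= K2 * tau by rewrite ler_peMl // ltW.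
have h1 : n%:R * t tau <= K2 * tau.
  apply: le_trans tauK; apply: le_trans nt; rewrite ler_pM2r // ler_nat //.
have h2 : t tau <= K2 * tau.
  apply: le_trans tauK; apply: le_trans nt; rewrite ler_peMl ?(ltW t0) // ler1n //.
have h3 : 3%:R * tau <= K2 * t tau.
  rewrite -[in leLHS]tE; have -> : 3%:R * (t tau * (2%:R * n.+1%:R) * (1 + tau)) =
    6%:R * n.+1%:R * (1 + tau) * t tau by ring.
  rewrite ler_pM2r // /K2 ler_pM2l ?mulr_gt0 // lerD2l.
  by apply: (le_trans tau_le); exact: ler_norm.
have [p1 p2 p3 p4] := cover_properties rho0 rho1 CD d0 c0 gQ0 TQ str dn C04 t0 t1
  tau_gt0 K0 h1 h2 h3.
split => //.
exact: (cover_ahlfors rho0 rho1 CD d0 c0 reg gQ0 TQ str dn C04 t0 t1).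
Qed.
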